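(* Let $M$ be a complex manifold with a nonvanishing holomorphic volume form. The bilinear operations $(\cdot,\cdot)$ and $\{\cdot,\cdot\}$ together with the operator $\mathbf{b}$ generate the structure of a BV algebra on the complex $(\mathcal{F}^{\cdot}_{sm},Q)$. That is: $(\cdot,\cdot)$ is a graded commutative associative product for which $Q$ is a derivation of degree $1$; $\mathbf{b}$ has degree $-1$, satisfies $\mathbf{b}^2=0$ and $\mathbf{b}Q+Q\mathbf{b}=0$, and is a second-order operator with respect to $(\cdot,\cdot)$; and $\{\cdot,\cdot\}$, the bracket generated by $\mathbf{b}$, makes $(\mathcal{F}^{\cdot}_{sm},Q)$ a differential Gerstenhaber algebra (with no higher homotopies).
   Context: Let $\mathcal{O}_M$ be the sheaf of holomorphic functions, $\mathcal{O}(T^{(1,0)}M)$ the sheaf of holomorphic vector fields, $[\cdot,\cdot]$ the Lie bracket of vector fields, $A(f)$ the derivative of a function $f$ along a vector field $A$, and $\mathrm{div}$ the divergence of holomorphic vector fields with respect to the given holomorphic volume form. The following is understood on sections over open subsets. The graded space $\mathcal{F}^{\cdot}_{sm}$ is $$\mathcal{F}^0_{sm}=\mathbb{C}\ni u,\quad \mathcal{F}^1_{sm}=\mathcal{O}(T^{(1,0)}M)\oplus\mathbb{C}\ni(A,v),\quad \mathcal{F}^2_{sm}=\mathcal{O}(T^{(1,0)}M)\oplus\mathcal{O}_M\ni(\tilde A,\tilde v),\quad \mathcal{F}^3_{sm}=\mathcal{O}_M\ni\tilde u.$$ Differential $Q$: $Qu=0$; $Q(A,v)=(0,\,v-\tfrac12\mathrm{div}A)\in\mathcal{F}^2_{sm}$;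 $Q(\tilde A,\tilde v)=\tfrac12\mathrm{div}\tilde A\in\mathcal{F}^3_{sm}$; $Q\tilde u=0$. Product $(\cdot,\cdot)$, of degree $0$: elements $u\in\mathcal{F}^0_{sm}=\mathbb{C}$ act by scalar multiplication, and the remaining products are, with the indicated components, - $(A_1,A_2)=-[A_1,A_2]$ in the $\mathcal{O}(T^{(1,0)}M)$ part of $\mathcal{F}^2_{sm}$; - $(v_1,A_2)=-v_1A_2$ and $(A_1,v_2)=v_2A_1$, in the $\mathcal{O}(T^{(1,0)}M)$ part of $\mathcal{F}^2_{sm}$; - $(v_1,v_2)=0$; - $(A_1,\tilde v_2)=(\tilde v_2,A_1)=-A_1(\tilde v_2)\in\mathcal{F}^3_{sm}$; - $(v_1,\tilde v_2)=(\tilde v_2,v_1)=-v_1\tilde v_2\in\mathcal{F}^3_{sm}$; - $(A_1,\tilde A_2)=(\tilde A_2,A_1)=0$ and $(v_1,\tilde A_2)=(\tilde A_2,v_1)=0$; - products of total degree greater than $3$ vanish. Operator $\mathbf{b}$, of degree $-1$: $\mathbf{b}u=0$; $\mathbf{b}(A,v)=v\in\mathcal{F}^0_{sm}$; $\mathbf{b}(\tilde A,\tilde v)=(-\tilde A,0)\in\mathcal{F}^1_{sm}$; $\mathbf{b}\tilde u=(0,-\tilde u)\in\mathcal{F}^2_{sm}$. Bracket $\{\cdot,\cdot\}$, of degree $-1$: $$(-1)^{|a_1|}\{a_1,a_2\}=\mathbf{b}(a_1,a_2)-(\mathbf{b}a_1,a_2)-(-1)^{|a_1|}(a_1,\mathbf{b}a_2).$$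 *)

(* Defs.v *)
(* The complex numbers are R[i], for R : realType. *)
From HB Require Import structures.
From mathcomp Require Import all_boot all_order all_algebra.
From mathcomp Require Import complex.
From mathcomp Require Import boolp classical_sets functions reals topology
  normedtype derive.

Set Implicit Arguments.
Unset Strict Implicit.
Unset Printing Implicit Defensive.

Import Order.TTheory GRing.Theory Num.Theory.
Import numFieldNormedType.Exports.

Local Open Scope classical_set_scope.
Local Open Scope ring_scope.
Local Open Scope complex_scope.

(* R[i] with its usual topology and norm, as a normed space over itself.
   Differentiability of maps between normed R[i]-spaces is then complex
   differentiability. *)
HB.instance Definition _ (R : realType) := NormedModule.copy R[i] R[i]^o.

Section ComplexManifolds.
Variables (R : realType) (n : nat).
Local Notation C := R[i].

Record chart (M : topologicalType) := Chart {
  cdom : set M;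
  ccod : set 'rV[C]_n;
  cto : M -> 'rV[C]_n;
  cof : 'rV[C]_n -> M;
  cdom_open : open cdom;
  ccod_open : open ccod;
  cto_cod : forall p, cdom p -> ccod (cto p);
  cof_dom : forall z, ccod z -> cdom (cof z);
  ctoK : forall p, cdom p -> cof (cto p) = p;
  cofK : forall z, ccod z -> cto (cof z) = z;
  cto_continuous : forall p, cdom p -> {for p, continuous cto};
  cof_continuous : forall z, ccod z -> {for z, continuous cof} }.

Record complexManifold := ComplexManifold {
  points :> topologicalType;
  points_hausdorff : hausdorff_space points;
  points_second_countable : @second_countable points;
  chart_index : Type;
  atlas : chart_index -> chart points;
  atlas_cover : forall p, exists i, cdom (atlas i) p;
  transition_holomorphic : forall i j z,
    ccod (atlas i) z -> cdom (atlas j) (cof (atlas i) z) ->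
    differentiable (cto (atlas j) \o cof (atlas i)) z }.

Variable M : complexManifold.

Definition transition (i j : chart_index M) : 'rV[C]_n -> 'rV[C]_n :=
  cto (atlas j) \o cof (atlas i).

Definition coord (i : chart_index M) (p : M) : 'rV[C]_n := cto (atlas i) p.

(* The expression, in the i-th coordinates, of a map defined on M. *)
Definition inchart (T : Type) (i : chart_index M) (f : M -> T) : 'rV[C]_n -> T :=
  f \o cof (atlas i).

Definition chart_at (p : M) : chart_index M := projT1 (cid (atlas_cover p)).

(* The sheaf O_M.  Sections over U are represented by functions on all of M
   that vanish off U, so that equality of sections is Leibniz equality. *)
Definition holomorphic_function (U : set M) (f : M -> C) : Prop :=
  (forall p, ~ U p -> f p = 0) /\
  (forall i p, U p -> cdom (atlas i) p ->
     differentiable (inchart i f) (coord i p)).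

(* Sections of T^(1,0)M: A i p is the row of components of A at p in the frame
   d/dz^1, ..., d/dz^n of the i-th chart, and is 0 where this is meaningless. *)
Definition fields := chart_index M -> M -> 'rV[C]_n.

Definition holomorphic_field (U : set M) (A : fields) : Prop :=
  [/\ forall i p, ~ (U p /\ cdom (atlas i) p) -> A i p = 0,
      forall i p, U p -> cdom (atlas i) p ->
        differentiable (inchart i (A i)) (coord i p)
    & forall i j p, U p -> cdom (atlas i) p -> cdom (atlas j) p ->
        A j p = 'd (transition i j) (coord i p) (A i p)].

(* A nowhere vanishing holomorphic n-form, equal to
   vcoef i dz^1 /\ ... /\ dz^n in the i-th chart. *)
Record volumeForm := VolumeForm {
  vcoef : chart_index M -> M -> C;
  vcoef_holomorphic : forall i p, cdom (atlas i) p ->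
    differentiable (inchart i (vcoef i)) (coord i p);
  vcoef_neq0 : forall i p, cdom (atlas i) p -> vcoef i p != 0;
  vcoef_transition : forall i j p, cdom (atlas i) p -> cdom (atlas j) p ->
    vcoef i p = vcoef j p * \det ('J (transition i j) (coord i p)) }.

(* The derivative A(f), in any chart around p.  It vanishes wherever A does. *)
Definition field_act (A : fields) (f : M -> C) : M -> C := fun p =>
  let i := chart_at p in 'd (inchart i f) (coord i p) (A i p).

(* [A, B]^k = \sum_j (A^j d_j B^k - B^j d_j A^k) in each chart. *)
Definition lie_bracket (A B : fields) : fields := fun i p =>
  'd (inchart i (B i)) (coord i p) (A i p)
  - 'd (inchart i (A i)) (coord i p) (B i p).

(* The function div A with L_A Omega = (div A) Omega: in any chart around p,
   where Omega = w dz^1 /\ ... /\ dz^n, it is w^-1 \sum_k d_k (w A^k). *)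
Definition divergence (Omega : volumeForm) (U : set M) (A : fields) : M -> C :=
  patch (fun=> 0) U (fun p =>
    let i := chart_at p in
    (vcoef Omega i p)^-1 *
    \sum_(k < n) 'D_(delta_mx 0 k)
      (inchart i (fun q => vcoef Omega i q * A i q 0 k)) (coord i p)).

Definition constant_function (U : set M) (v : C) : M -> C :=
  patch (fun=> 0) U (fun=> v).

(* An element (u, (A, v), (A', v'), u') lists components of degree 0, 1, 2, 3. *)
Definition sm_total : lmodType C :=
  (C * (fields * C) * (fields * (M -> C)) * (M -> C))%type.

Definition sm_space (U : set M) (k : int) : set sm_total :=
  match k with
  | Posz 0 => [set x | exists u, x = (u, 0, 0, 0)]
  | Posz 1 => [set x | exists A v, holomorphic_field U A /\
                                   x = (0, (A, v), 0, 0)]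
  | Posz 2 => [set x | exists A v, [/\ holomorphic_field U A,
                         holomorphic_function U v & x = (0, 0, (A, v), 0)]]
  | Posz 3 => [set x | exists u, holomorphic_function U u /\
                                 x = (0, 0, 0, u)]
  | _ => [set 0]
  end.

Definition sm_Q (Omega : volumeForm) (U : set M) (x : sm_total) : sm_total :=
  let: (_, (A, v), (A', _), _) := x in
  (0, 0,
   (0, constant_function U v - 2^-1 *: divergence Omega U A),
   2^-1 *: divergence Omega U A').

Definition sm_mul (x1 x2 : sm_total) : sm_total :=
  let: (u1, (A1, v1), (A1', v1'), u1') := x1 in
  let: (u2, (A2, v2), (A2', v2'), u2') := x2 in
  (u1 * u2,
   (u1 *: A2 + u2 *: A1, u1 * v2 + u2 * v1),
   (u1 *: A2' + u2 *: A1' - lie_bracket A1 A2 - v1 *: A2 + v2 *: A1,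
    u1 *: v2' + u2 *: v1'),
   u1 *: u2' + u2 *: u1'
   - field_act A1 v2' - field_act A2 v1' - v1 *: v2' - v2 *: v1').

Definition sm_b (x : sm_total) : sm_total :=
  let: (_, (_, v), (A', _), u') := x in (v, (- A', 0), (0, - u'), 0).

(* x |-> (-1)^|x| x *)
Definition sm_parity (x : sm_total) : sm_total :=
  let: (u, Av, Av', u') := x in (u, - Av, Av', - u').

Definition sm_bracket (x1 x2 : sm_total) : sm_total :=
  sm_b (sm_mul (sm_parity x1) x2) - sm_mul (sm_b (sm_parity x1)) x2
  - sm_mul x1 (sm_b x2).

End ComplexManifolds.

(* A graded space is a family F k (k : int) of linear
   subspaces of V, and only the values of the operations on homogeneous elements
   matter. *)
Section BVAlgebras.
Variables (K : fieldType) (V : lmodType K) (F : int -> set V).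

Definition graded_space : Prop :=
  forall k, F k 0 /\
    forall (c : K) x y, F k x -> F k y -> F k (c *: x + y).

Definition graded_linear (d : int) (f : V -> V) : Prop :=
  (forall k x, F k x -> F (k + d) (f x)) /\
  (forall k (c : K) x y, F k x -> F k y -> f (c *: x + y) = c *: f x + f y).

Definition graded_bilinear (d : int) (m : V -> V -> V) : Prop :=
  [/\ forall k l x y, F k x -> F l y -> F (k + l + d) (m x y),
      forall k l (c : K) x y z, F k x -> F k y -> F l z ->
        m (c *: x + y) z = c *: m x z + m y z
    & forall k l (c : K) x y z, F k x -> F l y -> F l z ->
        m x (c *: y + z) = c *: m x y + m x z].

Definition sgn (k : int) : K := (-1) ^ k.

Record dg_commutative_algebra (Q : V -> V) (mul : V -> V -> V) : Prop := {
  dgca_space : graded_space;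
  dgca_diff : graded_linear 1 Q;
  dgca_diff2 : forall k x, F k x -> Q (Q x) = 0;
  dgca_mul : graded_bilinear 0 mul;
  dgca_mulC : forall k l x y, F k x -> F l y ->
    mul x y = sgn (k * l) *: mul y x;
  dgca_mulA : forall k l m x y z, F k x -> F l y -> F m z ->
    mul (mul x y) z = mul x (mul y z);
  dgca_derivation : forall k l x y, F k x -> F l y ->
    Q (mul x y) = mul (Q x) y + sgn k *: mul x (Q y) }.

Record dg_gerstenhaber_algebra
    (Q : V -> V) (mul br : V -> V -> V) : Prop := {
  dgga_dgca : dg_commutative_algebra Q mul;
  dgga_bracket : graded_bilinear (-1) br;
  dgga_antisym : forall k l x y, F k x -> F l y ->
    br x y = - (sgn ((k - 1) * (l - 1)) *: br y x);
  dgga_leibnizr : forall k l m x y z, F k x -> F l y -> F m z ->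
    br x (mul y z) = mul (br x y) z + sgn ((k - 1) * l) *: mul y (br x z);
  dgga_leibnizl : forall k l m x y z, F k x -> F l y -> F m z ->
    br (mul x y) z = mul x (br y z) + sgn ((m - 1) * l) *: mul (br x z) y;
  dgga_jacobi : forall k l m x y z, F k x -> F l y -> F m z ->
    br x (br y z) = br (br x y) z + sgn ((k - 1) * (l - 1)) *: br y (br x z);
  dgga_derivation : forall k l x y, F k x -> F l y ->
    Q (br x y) = br (Q x) y + sgn (k - 1) *: br x (Q y) }.

Definition second_order (b : V -> V) (mul : V -> V -> V) : Prop :=
  forall k l m x y z, F k x -> F l y -> F m z ->
  b (mul (mul x y) z) =
    mul (b (mul x y)) z + sgn k *: mul x (b (mul y z))
    + sgn ((k - 1) * l) *: mul y (b (mul x z))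
    - mul (mul (b x) y) z - sgn k *: mul (mul x (b y)) z
    - sgn (k + l) *: mul (mul x y) (b z).

Record BV_algebra (Q b : V -> V) (mul br : V -> V -> V) : Prop := {
  bv_dgca : dg_commutative_algebra Q mul;
  bv_b : graded_linear (-1) b;
  bv_b2 : forall k x, F k x -> b (b x) = 0;
  bv_bQ : forall k x, F k x -> b (Q x) + Q (b x) = 0;
  bv_second_order : second_order b mul;
  bv_bracket : forall k l x y, F k x -> F l y ->
    sgn k *: br x y = b (mul x y) - mul (b x) y - sgn k *: mul x (b y);
  bv_gerstenhaber : dg_gerstenhaber_algebra Q mul br }.

End BVAlgebras.

(* Main.v *)
Require Import Defs.
From HB Require Import structures.
From mathcomp Require Import all_boot all_order all_algebra.
From mathcomp Require Import perm complex ring lra zify.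
From mathcomp Require Import boolp classical_sets functions reals topology
  normedtype landau derive.
Set Implicit Arguments.
Unset Strict Implicit.
Unset Printing Implicit Defensive.
Import Order.TTheory GRing.Theory Num.Theory.
Import numFieldNormedType.Exports.
Import Defs.
Local Open Scope classical_set_scope.
Local Open Scope ring_scope.
Local Open Scope complex_scope.
Local Notation Re := complex.Re.
Local Notation Im := complex.Im.
Import ComplexField.Normc.

(** The statement splits into algebra and analysis.

    Algebra.  Write g for the holomorphic vector fields on U, O for the
    holomorphic functions on U, and delta for half the divergence.  The whole
    structure is built from four facts: g is a Lie algebra; O is a g-module;
    delta is a cocycle, that is delta [A, B] = A (delta B) - B (delta A); and g
    kills the constants.  [lie_module_BV] derives all the axioms from these
    four facts.  An element of degree 0 only rescales, and nothing lives above
    degree 3, so every axiom has to be tested in very few positive degrees.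
    That Q is a derivation has content in degrees (1, 1) only, where it is the
    cocycle identity together with the invariance of constants.  That b has
    order two has content in degrees (1, 1, 1), where it is the Jacobi
    identity, and in the permutations of (1, 1, 2), where it is the module law
    of O.  The bracket axioms then follow formally
    ([bracket_gerstenhaber]): the order-two identity is the Leibniz rule of the
    bracket, b is a derivation of the bracket because b squares to 0, and
    applying b to the Leibniz rule gives the Jacobi identity.

    Geometry.  The four facts are checked in a chart, where they are identities
    between first and second derivatives.  They hold because second
    derivatives commute, and because the trace of a commutator is 0 for the
    cocycle identity ([local_bracket_jacobi], [local_act_bracket],
    [local_divergence_bracket]).  The same symmetry shows that the operations
    do not depend on the chart ([local_bracket_change],
    [local_divergence_change]); for the divergence one also needs the
    derivative of a determinant ([is_diff_det]).

    Analysis.  Sections are only assumed complex differentiable, so one must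
    know that a complex differentiable function of several variables is twice
    differentiable, with a symmetric second differential
    ([differential_differentiable], [second_differential_sym]).  The proof
    uses no integral.  Contour integrals around squares are replaced by
    midpoint sums, for which bisection still works ([goursat]).  Comparing two
    difference quotients on a square gives a Lipschitz bound in terms of a
    bound of the function ([lipschitz_square], [lipschitz_ball]); used twice it
    bounds second differences, and halving the increment repeatedly turns this
    into a first order Taylor formula with a uniform quadratic error
    ([taylor1_le]).  Applied to the difference quotients
    (F (x + t v) - F x) / t, this uniformity lets the differential pass to the
    limit t -> 0 ([uniform_limit_differentiable]); the limit is the second
    differential, read in either order. *)

(** * The modulus of a complex number *)

Section Normc.
Variable R : realType.
Implicit Types x y z : R[i].

Lemma normc_ge0 x : 0 <= normc x.
Proof. by case: x => a b; exact: sqrtr_ge0. Qed.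

Lemma normcE x : `|x| = (normc x)%:C.
Proof. by []. Qed.

Lemma ler_normcD x y : normc (x + y) <= normc x + normc y.
Proof. exact: le_normcD. Qed.

Lemma normcNE x : normc (- x) = normc x.
Proof. exact: normcN. Qed.

Lemma ler_normcB x y : normc (x - y) <= normc x + normc y.
Proof. by rewrite -(normcNE y); exact: ler_normcD. Qed.

Lemma normc_real (a : R) : normc a%:C = `|a|.
Proof. by rewrite /normc /= expr0n addr0 sqrtr_sqr. Qed.

Lemma normc_gt0 x : (0 < normc x) = (x != 0).
Proof.
rewrite lt_def normc_ge0 andbT; congr (~~ _).
by apply/eqP/eqP => [/eq0_normc //|->]; exact: normc0.
Qed.

Lemma ReD x y : Re (x + y) = Re x + Re y. Proof. by case: x; case: y. Qed.
Lemma ImD x y : Im (x + y) = Im x + Im y. Proof. by case: x; case: y. Qed.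
Lemma ReN x : Re (- x) = - Re x. Proof. by case: x. Qed.
Lemma ImN x : Im (- x) = - Im x. Proof. by case: x. Qed.

Lemma ler_normc_ReIm x : normc x <= `|Re x| + `|Im x|.
Proof.
case: x => a b /=.
rewrite -(ler_pXn2r (n := 2)) // ?nnegrE ?addr_ge0 ?sqrtr_ge0 //.
rewrite sqr_sqrtr ?addr_ge0 ?sqr_ge0 // sqrrD !real_normK ?num_real //.
have := mulr_ge0 (normr_ge0 a) (normr_ge0 b); lra.
Qed.

Lemma ler_Re_normc x : `|Re x| <= normc x.
Proof.
case: x => a b /=; rewrite -sqrtr_sqr ler_sqrt ?addr_ge0 ?sqr_ge0 //.
by rewrite lerDl sqr_ge0.
Qed.

Lemma ler_Im_normc x : `|Im x| <= normc x.
Proof.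
case: x => a b /=; rewrite -sqrtr_sqr ler_sqrt ?addr_ge0 ?sqr_ge0 //.
by rewrite lerDr sqr_ge0.
Qed.

Lemma half_Complex (a b : R) : (a +i* b) / 2 = (a / 2) +i* (b / 2).
Proof.
rewrite -(rmorph_nat (real_complex R) 2) -fmorphV.
by apply/eqP; rewrite eq_complex /= !mulr0 subr0 add0r !eqxx.
Qed.

End Normc.

(** * Midpoint sums along segments *)

Section Segments.
Variable R : realType.
Local Notation C := R[i].
Implicit Types (f g : C -> C) (a b : C).

(** The midpoint rule on the 2 ^ j equal parts of the segment from a to b.  It
    stands for the integral of f along this segment. *)
Fixpoint segment_sum f j a b : C :=
  if j is j'.+1 then
    segment_sum f j' a ((a + b) / 2) + segment_sum f j' ((a + b) / 2) b
  else (b - a) * f ((a + b) / 2).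

Lemma segment_sum_rev f j a b : segment_sum f j b a = - segment_sum f j a b.
Proof.
elim: j a b => [|j IH] a b /=; rewrite (addrC b a).
  by rewrite -mulNr opprB.
by rewrite opprD [LHS]addrC (IH a) (IH _ b).
Qed.

Lemma segment_sumB f g j a b :
  segment_sum (fun z => f z - g z) j a b
  = segment_sum f j a b - segment_sum g j a b.
Proof.
elim: j a b => [|j IH] a b /=; first by rewrite mulrBr.
by rewrite !IH; ring.
Qed.

Lemma segment_sumZ (c : C) f j a b :
  segment_sum (fun z => c * f z) j a b = c * segment_sum f j a b.
Proof.
elim: j a b => [|j IH] a b /=; first by rewrite mulrCA.
by rewrite !IH mulrDr.
Qed.

(** The midpoint rule is exact on affine functions.  This is what Goursat's
    argument needs: an affine approximation of f contributes nothing around a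
    square. *)
Lemma segment_sum_affine (c d : C) j a b :
  segment_sum (fun z => c + d * z) j a b
  = (c * b + d * b ^+ 2 / 2) - (c * a + d * a ^+ 2 / 2).
Proof.
elim: j a b => [|j IH] a b /=; last by rewrite !IH; ring.
by field.
Qed.

Definition midconvex (P : C -> Prop) :=
  forall a b, P a -> P b -> P ((a + b) / 2).

Lemma segment_sum_le (P : C -> Prop) f (K : R) j a b :
  midconvex P -> (forall z, P z -> normc (f z) <= K) -> P a -> P b ->
  normc (segment_sum f j a b) <= K * normc (b - a).
Proof.
move=> Pc fK; elim: j a b => [|j IH] a b Pa Pb /=.
  by rewrite normcM mulrC ler_wpM2r ?normc_ge0 // fK //; exact: Pc.
apply: le_trans (ler_normcD _ _) _.
apply: le_trans (lerD (IH _ _ Pa (Pc _ _ Pa Pb)) (IH _ _ (Pc _ _ Pa Pb) Pb)) _.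
have h : forall z : C, normc (z / 2) = normc z / 2.
  move=> z; rewrite normcM normcV -(rmorph_nat (real_complex R) 2).
    by rewrite normc_real gtr0_norm.
have -> : (a + b) / 2 - a = (b - a) / 2 by field.
have -> : b - (a + b) / 2 = (b - a) / 2 by field.
by rewrite h; lra.
Qed.

End Segments.

(** * Midpoint sums around squares *)

Section Contours.
Variable R : realType.
Local Notation C := R[i].
Implicit Types (f g : C -> C) (x y s : R).

(** The sum around the boundary of the square with lower left corner x + i y
    and side s, counterclockwise. *)
Definition square_sum f j x y s : C :=
  segment_sum f j (x +i* y) ((x + s) +i* y)
  + segment_sum f j ((x + s) +i* y) ((x + s) +i* (y + s))
  + segment_sum f j ((x + s) +i* (y + s)) (x +i* (y + s))
  + segment_sum f j (x +i* (y + s)) (x +i* y).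

(** The midpoints used at level j + 1 on a side are those used at level j on its
    two halves, and the inner sides of the four quarters cancel in pairs, so the
    splitting is an exact identity. *)
Lemma square_sum_split f j x y s :
  square_sum f j.+1 x y s =
    square_sum f j x y (s / 2) + square_sum f j (x + s / 2) y (s / 2)
    + square_sum f j x (y + s / 2) (s / 2)
    + square_sum f j (x + s / 2) (y + s / 2) (s / 2).
Proof.
rewrite /square_sum /=.
have -> : x + s / 2 + s / 2 = x + s by lra.
have -> : y + s / 2 + s / 2 = y + s by lra.
have E (a b c d : R) : (a +i* b) + (c +i* d) = (a + c) +i* (b + d) by [].
rewrite !E !half_Complex.
have -> : (x + (x + s)) / 2 = x + s / 2 by lra.
have -> : (x + s + x) / 2 = x + s / 2 by lra.
have -> : (x + s + (x + s)) / 2 = x + s by lra.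
have -> : (x + x) / 2 = x by lra.
have -> : (y + (y + s)) / 2 = y + s / 2 by lra.
have -> : (y + s + y) / 2 = y + s / 2 by lra.
have -> : (y + s + (y + s)) / 2 = y + s by lra.
have -> : (y + y) / 2 = y by lra.
set m := (x + s / 2) +i* (y + s / 2).
rewrite (segment_sum_rev f j ((x + s / 2) +i* y) m).
rewrite (segment_sum_rev f j (x +i* (y + s / 2)) m).
rewrite (segment_sum_rev f j m ((x + s) +i* (y + s / 2))).
rewrite (segment_sum_rev f j m ((x + s / 2) +i* (y + s))).
ring.
Qed.

Lemma square_sumB f g j x y s :
  square_sum (fun z => f z - g z) j x y s
  = square_sum f j x y s - square_sum g j x y s.
Proof. by rewrite /square_sum !segment_sumB; ring. Qed.

Lemma square_sumZ (c : C) f j x y s :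
  square_sum (fun z => c * f z) j x y s = c * square_sum f j x y s.
Proof. by rewrite /square_sum !segment_sumZ; ring. Qed.

Lemma square_sum_affine (c d : C) j x y s :
  square_sum (fun z => c + d * z) j x y s = 0.
Proof. by rewrite /square_sum !segment_sum_affine; ring. Qed.

Definition in_square x y s (z : C) : Prop :=
  x <= Re z <= x + s /\ y <= Im z <= y + s.

Lemma in_square_midconvex x y s : midconvex (in_square x y s).
Proof.
move=> [a1 a2] [b1 b2] [] /= /andP[? ?] /andP[? ?] [] /= /andP[? ?] /andP[? ?].
rewrite -[(a1 +i* a2) + (b1 +i* b2)]/((a1 + b1) +i* (a2 + b2)) half_Complex.
by split => /=; apply/andP; split; lra.
Qed.

Lemma square_sum_le f (K : R) j x y s : 0 <= s ->
  (forall z, in_square x y s z -> normc (f z) <= K) ->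
  normc (square_sum f j x y s) <= 4 * s * K.
Proof.
move=> s0 fK.
have L a b : in_square x y s a -> in_square x y s b ->
    normc (segment_sum f j a b) <= K * normc (b - a).
  by apply: segment_sum_le => //; exact: in_square_midconvex.
have V0 : in_square x y s (x +i* y) by split => /=; apply/andP; split; lra.
have V1 : in_square x y s ((x + s) +i* y) by split => /=; apply/andP; split; lra.
have V2 : in_square x y s ((x + s) +i* (y + s)).
  by split => /=; apply/andP; split; lra.
have V3 : in_square x y s (x +i* (y + s)) by split => /=; apply/andP; split; lra.
have E (a b c d : R) : (a +i* b) - (c +i* d) = (a - c) +i* (b - d) by [].
have Nre (a : R) : normc (a +i* 0) = `|a| by rewrite /= expr0n addr0 sqrtr_sqr.
have Nim (a : R) : normc (0 +i* a) = `|a| by rewrite /= expr0n add0r sqrtr_sqr.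
have sK : `|s| = s by exact: ger0_norm.
have := L _ _ V0 V1; have := L _ _ V1 V2; have := L _ _ V2 V3; have := L _ _ V3 V0.
rewrite !E !subrr.
have -> : x + s - x = s by lra.
have -> : y + s - y = s by lra.
have -> : x - (x + s) = - s by lra.
have -> : y - (y + s) = - s by lra.
rewrite !Nre !Nim !normrN sK => h3 h2 h1 h0.
rewrite /square_sum.
set t0 := segment_sum f j (x +i* y) _; set t1 := segment_sum f j (_ +i* y) _.
set t2 := segment_sum f j (_ +i* (y + s)) _ in h2 *; set t3 := segment_sum f j _ _ in h3 *.
have := ler_normcD (t0 + t1 + t2) t3; have := ler_normcD (t0 + t1) t2.
have := ler_normcD t0 t1.
rewrite -/t0 in h0; rewrite -/t1 in h1; lra.
Qed.

End Contours.

(** * Goursat's theorem *)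

Section Goursat.
Variable R : realType.
Local Notation C := R[i].
Implicit Types (f g : C -> C) (x y s : R).

Definition cdifferential f (z l : C) := forall e : R, 0 < e ->
  exists2 d : R, 0 < d & forall t, normc t < d ->
    normc (f (z + t) - f z - l * t) <= e * normc t.

(** An increasing function that grows by at least the square root of s over any
    interval of length s containing 0. *)
Definition signed_sqrt (x : R) := Num.sqrt x - Num.sqrt (- x).

Lemma signed_sqrt_homo : {homo signed_sqrt : x y / x <= y}.
Proof. by move=> x y xy; apply: lerB; apply: ler_wsqrtr; rewrite ?lerN2. Qed.

Lemma sqrt_le_signed_sqrtB x y : x <= 0 <= y ->
  Num.sqrt (y - x) <= signed_sqrt y - signed_sqrt x.
Proof.
move=> /andP[x0 y0]; rewrite /signed_sqrt.
rewrite (@ler0_sqrtr _ (- y)) ?oppr_le0 // (ler0_sqrtr x0) sub0r subr0 opprK.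
rewrite -(ler_pXn2r (n := 2)) // ?nnegrE ?addr_ge0 ?sqrtr_ge0 //.
rewrite sqrrD !sqr_sqrtr ?oppr_ge0 //; last by lra.
have := mulr_ge0 (sqrtr_ge0 y) (sqrtr_ge0 (- x)); lra.
Qed.

(** The bisection compares sums around squares with an additive function of
    squares.  The area s ^ 2 suffices where f is differentiable.  At w, where f is
    only continuous, a sum around a small square is merely o(s); the second term,
    the mass that the square has for the product of two measures concentrated near
    the coordinates of w, is at least s on the squares containing w. *)
Definition weight (w : C) x y s : R :=
  s ^+ 2 + (signed_sqrt (x + s - Re w) - signed_sqrt (x - Re w))
         * (signed_sqrt (y + s - Im w) - signed_sqrt (y - Im w)).

Lemma weight_split w x y s :
  weight w x y s = weight w x y (s / 2) + weight w (x + s / 2) y (s / 2)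
    + weight w x (y + s / 2) (s / 2) + weight w (x + s / 2) (y + s / 2) (s / 2).
Proof.
rewrite /weight.
have -> : x + s / 2 + s / 2 = x + s by lra.
have -> : y + s / 2 + s / 2 = y + s by lra.
by field.
Qed.

Lemma weight_ge_sqr w x y s : 0 <= s -> s ^+ 2 <= weight w x y s.
Proof.
move=> s0; rewrite lerDl mulr_ge0 // subr_ge0; apply: signed_sqrt_homo; lra.
Qed.

Lemma weight_ge_side w x y s : 0 <= s -> in_square x y s w -> s <= weight w x y s.
Proof.
move=> s0 [/andP[? ?] /andP[? ?]].
have /sqrt_le_signed_sqrtB : x - Re w <= 0 <= x + s - Re w by apply/andP; split; lra.
have /sqrt_le_signed_sqrtB : y - Im w <= 0 <= y + s - Im w by apply/andP; split; lra.
rewrite (_ : x + s - Re w - (x - Re w) = s); last by lra.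
rewrite (_ : y + s - Im w - (y - Im w) = s); last by lra.
move=> hy hx; apply: le_trans (_ : Num.sqrt s * Num.sqrt s <= _).
  by rewrite -expr2 sqr_sqrtr.
apply: ler_wpDl; first exact: sqr_ge0.
by apply: ler_pM; rewrite ?sqrtr_ge0.
Qed.

(** The corner and the side of a square are packed in a triple (x, y, s), so that
    the bisection is the iteration of one function. *)
Definition good_square f (w : C) (e : R) (q : R * R * R) : Prop :=
  exists J, forall j, (J <= j)%N ->
    normc (square_sum f j q.1.1 q.1.2 q.2) <= e * weight w q.1.1 q.1.2 q.2.

Definition quarter (h v : bool) (q : R * R * R) : R * R * R :=
  (q.1.1 + h%:R * (q.2 / 2), q.1.2 + v%:R * (q.2 / 2), q.2 / 2).

Lemma good_square_split f w e q : (forall h v, good_square f w e (quarter h v q)) -> good_square f w e q.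
Proof.
case: q => [[x y] s] gq; rewrite /good_square /=.
have [J00 g00] := gq false false; have [J01 g01] := gq false true.
have [J10 g10] := gq true false; have [J11 g11] := gq true true.
exists (maxn (maxn J00 J01) (maxn J10 J11)).+1 => -[//|j]; rewrite ltnS !geq_max.
move=> /andP[/andP[j00 j01] /andP[j10 j11]].
have := g00 _ j00; have := g01 _ j01; have := g10 _ j10; have := g11 _ j11.
rewrite /quarter /= !mul0r !addr0 !mul1r square_sum_split (weight_split w x y s).
set a := square_sum _ _ _ _ _; set b := square_sum _ _ _ _ _.
set c := square_sum _ _ _ _ _; set d := square_sum _ _ _ _ _.
move=> *; have := ler_normcD (d + b + c) a; have := ler_normcD (d + b) c.
have := ler_normcD d b; lra.
Qed.

(** The default value q makes the choice of a quarter a total function. *)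
Definition bad_quarter f w e q : R * R * R :=
  if pselect (exists hv, ~ good_square f w e (quarter hv.1 hv.2 q)) is left H
  then quarter (projT1 (cid H)).1 (projT1 (cid H)).2 q else q.

Lemma bad_quarterP f w e q : ~ good_square f w e q ->
  ~ good_square f w e (bad_quarter f w e q) /\
  exists h v, bad_quarter f w e q = quarter h v q.
Proof.
rewrite /bad_quarter; case: pselect => [H|H] bq.
  by split; [exact: (projT2 (cid H))|do 2!eexists].
exfalso; apply: bq; apply: good_square_split => h v; apply: contrapT => b.
by apply: H; exists (h, v).
Qed.

(** The quarters chosen one after the other shrink to a point, whose coordinates
    are the suprema of the coordinates of the lower left corners. *)
Lemma nested_squares f w e q : 0 <= q.2 -> ~ good_square f w e q ->
  exists z, forall d : R, 0 < d -> exists x y s,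
    [/\ ~ good_square f w e (x, y, s), 0 <= s < d, in_square x y s z &
      forall z', in_square x y s z' -> in_square q.1.1 q.1.2 q.2 z'].
Proof.
move=> q0 bq; pose S n := iter n (bad_quarter f w e) q.
have bS n : ~ good_square f w e (S n).
  by elim: n => //= n IH; have [] := bad_quarterP IH.
have sS n : (S n).2 = q.2 / 2 ^+ n.
  elim: n => [|n IH]; first by rewrite expr0 divr1.
  have [_ [h [v /= ->]]] := bad_quarterP (bS n).
  by rewrite /= IH exprSr invfM mulrA.
have s0 n : 0 <= (S n).2 by rewrite sS divr_ge0 // exprn_ge0.
have step n : [/\ (S n).1.1 <= (S n.+1).1.1, (S n).1.2 <= (S n.+1).1.2,
    (S n.+1).1.1 + (S n.+1).2 <= (S n).1.1 + (S n).2 &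
    (S n.+1).1.2 + (S n.+1).2 <= (S n).1.2 + (S n).2].
  have [_ [h [v /= ->]]] := bad_quarterP (bS n).
  have := s0 n; case: h; case: v => /=; rewrite ?mul1r ?mul0r; split; lra.
have mono m n : (m <= n)%N -> [/\ (S m).1.1 <= (S n).1.1, (S m).1.2 <= (S n).1.2,
    (S n).1.1 + (S n).2 <= (S m).1.1 + (S m).2 &
    (S n).1.2 + (S n).2 <= (S m).1.2 + (S m).2].
  elim: n => [|n IH]; first by rewrite leqn0 => /eqP ->.
  rewrite leq_eqVlt => /predU1P[-> //|]; rewrite ltnS => /IH[? ? ? ?].
  by have [? ? ? ?] := step n; split; lra.
have cross m n : (S m).1.1 <= (S n).1.1 + (S n).2 /\ (S m).1.2 <= (S n).1.2 + (S n).2.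
  have [/mono[? ? ? ?]|/ltnW/mono[? ? ? ?]] := leqP m n;
    by have := s0 n; have := s0 m; split; lra.
pose X := sup (range (fun n => (S n).1.1)); pose Y := sup (range (fun n => (S n).1.2)).
have inS n : in_square (S n).1.1 (S n).1.2 (S n).2 (X +i* Y).
  split => /=; apply/andP; split.
  - by apply: ub_le_sup; [exists ((S 0).1.1 + (S 0).2) => _ [m _ <-]; have [] := cross m 0%N|exists n].
  - by apply: ge_sup; [exists (S n).1.1; exists n|move=> _ [m _ <-]; have [] := cross m n].
  - by apply: ub_le_sup; [exists ((S 0).1.2 + (S 0).2) => _ [m _ <-]; have [] := cross m 0%N|exists n].
  - by apply: ge_sup; [exists (S n).1.2; exists n|move=> _ [m _ <-]; have [] := cross m n].
exists (X +i* Y) => d d0.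
have [n nq] : exists n, (q.2 / d < n.+1%:R).
  exists (Num.truncn (q.2 / d)); exact: truncnS_gt.
exists (S n.+1).1.1, (S n.+1).1.2, (S n.+1).2; split => //.
- by case: (S n.+1) (bS n.+1) => -[].
- rewrite s0 sS /= ltr_pdivrMr ?exprn_gt0 //.
  rewrite ltr_pdivrMr // in nq; apply: lt_le_trans nq _; rewrite mulrC.
  by rewrite ler_pM2l // -natrX ler_nat; exact: ltnW (ltn_expl _ _).
- move=> z' [/andP[? ?] /andP[? ?]]; have [? ? ? ?] := mono 0%N n.+1 isT.
  by rewrite -/(S 0%N); split; apply/andP; split; lra.
Qed.

(** Cauchy's theorem on a square, with one point w of mere continuity: the
    difference quotients of a differentiable function are of this kind.  A square
    that is not good would yield arbitrarily small ones around a point z.  Near z,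
    f is affine up to an error o(s), or constant up to o(1) when z is w, and the
    bounds of [weight] from below make small squares around z good. *)
Theorem goursat f (w : C) x y s : 0 <= s ->
  (forall z, in_square x y s z -> z != w -> exists l, cdifferential f z l) ->
  (in_square x y s w -> forall e, 0 < e -> exists2 d, 0 < d &
     forall z, normc (z - w) < d -> normc (f z - f w) <= e) ->
  forall e, 0 < e -> exists J, forall j, (J <= j)%N ->
    normc (square_sum f j x y s) <= e.
Proof.
move=> s0 df cf e e0.
(* dividing e by a bound W of the weight of the whole square *)
have [W W0 Ww] : exists2 W, 0 < W & weight w x y s <= W.
  by exists (`|weight w x y s| + 1); have := ler_norm (weight w x y s); have := normr_ge0 (weight w x y s); lra.
pose e' := e / W; have e'0 : 0 < e' by exact: divr_gt0.
suff [J gJ] : good_square f w e' (x, y, s).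
  exists J => j /gJ /= h; apply: le_trans h _; rewrite -[leRHS](divfK (lt0r_neq0 W0)).
  by rewrite ler_pM2l.
apply: contrapT => /nested_squares -/(_ s0)[z nz].
have zin : in_square x y s z.
  by have [a [b [t [_ _ zt]]]] := nz 1 ltr01; exact.
have small a b t z1 : 0 <= t -> in_square a b t z -> in_square a b t z1 ->
    normc (z1 - z) <= 2 * t.
  move=> t0 [/andP[? ?] /andP[? ?]] [/andP[? ?] /andP[? ?]].
  apply: le_trans (ler_normc_ReIm _) _; rewrite ReD ReN ImD ImN.
  have : `|Re z1 - Re z| <= t by rewrite ler_norml; apply/andP; split; lra.
  have : `|Im z1 - Im z| <= t by rewrite ler_norml; apply/andP; split; lra.
  lra.
have bound (c l : C) (d : R) : 0 < d ->
  (forall a b t, 0 <= t < d -> in_square a b t z -> exists2 K,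
     (forall z1, in_square a b t z1 -> normc (f z1 - (c + l * z1)) <= K) &
     4 * t * K <= e' * weight w a b t) -> False.
  move=> d0 H; have [a [b [t [bad td zt _]]]] := nz _ d0.
  have [K H1 H2] := H _ _ _ td zt; apply: bad; exists 0%N => j _ /=.
  have /andP[t0 _] := td.
  rewrite -[square_sum _ _ _ _ _]subr0 -(square_sum_affine c l j a b t) -square_sumB.
  exact: le_trans (square_sum_le _ t0 H1) H2.
(* A square of side t has perimeter 4 t and its points are within 2 t of z.  With
   error e' / 4 at w the sum is at most e' t; with error e' / 8 times the distance
   at other points it is at most e' t ^ 2. *)
have [zw|zw] := eqVneq z w.
  subst z; have e'4 : 0 < e' / 4 by rewrite divr_gt0.
  have [d d0 fd] := cf zin _ e'4.
  have d2 : 0 < d / 2 by rewrite divr_gt0.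
  apply: (bound (f w) 0 _ d2) => a b t /andP[t0 td] wt; exists (e' / 4).
    move=> z1 /(small _ _ _ _ t0 wt) z1w; rewrite mul0r addr0; apply: fd; lra.
  have := weight_ge_side t0 wt; rewrite -(ler_pM2l e'0); lra.
have [l dl] := df _ zin zw.
have e'8 : 0 < e' / 8 by rewrite divr_gt0.
have [d d0 fd] := dl _ e'8.
have d2 : 0 < d / 2 by rewrite divr_gt0.
apply: (bound (f z - l * z) l _ d2) => a b t /andP[t0 td] zt; exists (e' / 8 * (2 * t)).
  move=> z1 /(small _ _ _ _ t0 zt) z1z.
  have := fd (z1 - z); rewrite (addrC z) subrK.
  rewrite (_ : f z1 - (f z - l * z + l * z1) = f z1 - f z - l * (z1 - z)); last by ring.
  move=> h; apply: le_trans (h _) _; first by lra.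
  by rewrite ler_pM2l.
have := weight_ge_sqr w a b t0; rewrite -(ler_pM2l e'0) expr2; lra.
Qed.

End Goursat.

(** * The sum of 1/z around a square *)

Section Boundary.
Variable R : realType.
Local Notation C := R[i].
Implicit Types (f g : C -> C) (x y s : R).

Lemma segment_sum_ext (P : C -> Prop) f g j a b :
  midconvex P -> (forall z, P z -> f z = g z) -> P a -> P b ->
  segment_sum f j a b = segment_sum g j a b.
Proof.
move=> Pc fg; elim: j a b => [|j IH] a b Pa Pb /=; first by rewrite fg //; exact: Pc.
by rewrite !IH //; exact: Pc.
Qed.

Lemma midconvexI (P Q : C -> Prop) : midconvex P -> midconvex Q ->
  midconvex (fun z => P z /\ Q z).
Proof. by move=> hP hQ a b [Pa Qa] [Pb Qb]; split; [exact: hP|exact: hQ]. Qed.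

Lemma midconvex_Re (c : R) : midconvex (fun z : C => Re z = c).
Proof.
move=> [a1 a2] [b1 b2] ra rb.
rewrite -[(a1 +i* a2) + _]/((a1 + b1) +i* (a2 + b2)) half_Complex.
by move: ra rb => /= -> ->; lra.
Qed.

Lemma midconvex_Im (c : R) : midconvex (fun z : C => Im z = c).
Proof.
move=> [a1 a2] [b1 b2] ra rb.
rewrite -[(a1 +i* a2) + _]/((a1 + b1) +i* (a2 + b2)) half_Complex.
by move: ra rb => /= -> ->; lra.
Qed.

Arguments midconvexI {P Q} _ _.
Arguments midconvex_Re c : clear implicits.
Arguments midconvex_Im c : clear implicits.

Definition on_boundary x y s (z : C) : Prop := in_square x y s z /\
  [\/ Im z = y, Re z = x + s, Im z = y + s | Re z = x].

(** A contour sum only evaluates f on the boundary of the square, which is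
    where a kernel with a pole inside the square can be bounded. *)
Lemma square_sum_ext f g j x y s : 0 <= s ->
  (forall z, on_boundary x y s z -> f z = g z) ->
  square_sum f j x y s = square_sum g j x y s.
Proof.
move=> s0 fg; have Q := @in_square_midconvex R x y s.
rewrite /square_sum; congr (_ + _ + _ + _).
- apply: (segment_sum_ext _ (midconvexI Q (midconvex_Im y))).
  + by move=> z [? ?]; apply: fg; split => //; constructor 1.
  + by do !split => /=; lra.
  + by do !split => /=; lra.
- apply: (segment_sum_ext _ (midconvexI Q (midconvex_Re (x + s)))).
  + by move=> z [? ?]; apply: fg; split => //; constructor 2.
  + by do !split => /=; lra.
  + by do !split => /=; lra.
- apply: (segment_sum_ext _ (midconvexI Q (midconvex_Im (y + s)))).
  + by move=> z [? ?]; apply: fg; split => //; constructor 3.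
  + by do !split => /=; lra.
  + by do !split => /=; lra.
- apply: (segment_sum_ext _ (midconvexI Q (midconvex_Re x))).
  + by move=> z [? ?]; apply: fg; split => //; constructor 4.
  + by do !split => /=; lra.
  + by do !split => /=; lra.
Qed.

Lemma square_sum_le_boundary f (K : R) j x y s : 0 <= s -> 0 <= K ->
  (forall z, on_boundary x y s z -> normc (f z) <= K) ->
  normc (square_sum f j x y s) <= 4 * s * K.
Proof.
move=> s0 K0 fK.
pose g z := if pselect (on_boundary x y s z) is left _ then f z else 0.
rewrite (@square_sum_ext f g) //; last first.
  by move=> z zb; rewrite /g; case: pselect.
apply: square_sum_le => // z _; rewrite /g; case: pselect => [/fK //|_].
by rewrite normc0.
Qed.

(** dz / z is invariant under the rotation by 'i, so the four sides of the square
    centred at 0 contribute equally. *)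
Lemma segment_sum_inv_rot j (a b : C) :
  segment_sum (fun z => z^-1) j ('i * a) ('i * b) = segment_sum (fun z => z^-1) j a b.
Proof.
have i0 : ('i : C) != 0 by rewrite eq_complex /= oner_eq0 andbF.
elim: j a b => [|j IH] a b /=; last by rewrite -mulrDr -mulrA !IH.
by rewrite -mulrDr -mulrBr -mulrA invfM mulrACA divff // mul1r.
Qed.

(** On the right side of the square, z = 1 + i m with m ^ 2 <= 1, and dz / z has
    imaginary part dm / (1 + m ^ 2), at least dm / 2. *)
Lemma Im_segment_sum_inv j (u v : R) : -1 <= u <= v -> v <= 1 ->
  (v - u) / 2 <= Im (segment_sum (fun z : C => z^-1) j (1 +i* u) (1 +i* v)).
Proof.
have mid (a b : R) : ((1 +i* a) + (1 +i* b)) / 2 = 1 +i* ((a + b) / 2).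
  rewrite -[(1 +i* a) + _]/((1 + 1) +i* (a + b)) half_Complex; congr (_ +i* _); lra.
elim: j u v => [|j IH] u v /andP[u1 uv] v1.
  rewrite /segment_sum mid.
  rewrite -[(1 +i* v) - _]/((1 - 1) +i* (v - u)) subrr.
  set m := (u + v) / 2; rewrite -[(1 +i* m)^-1]/(ComplexField.invc _) /=.
  rewrite mul0r add0r ler_wpM2l ?subr_ge0 // expr1n mul1r.
  have m1 : m ^+ 2 <= 1 by rewrite /m expr2; nra.
  by rewrite lef_pV2 ?posrE //; [lra|apply: ltr_pwDl => //; exact: sqr_ge0].
rewrite /segment_sum -/segment_sum mid ImD.
have h1 : -1 <= u <= (u + v) / 2 by apply/andP; split; lra.
have h2 : -1 <= (u + v) / 2 <= v by apply/andP; split; lra.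
have h3 : (u + v) / 2 <= 1 by lra.
have := IH _ _ h1 h3; have := IH _ _ h2 v1; lra.
Qed.

(** A lower bound is enough in place of the exact value 2 pi i of the integral:
    each side contributes an imaginary part of at least 1. *)
Lemma square_sum_inv_ge j : 4 <= normc (square_sum (fun z : C => z^-1) j (-1) (-1) 2).
Proof.
have e1 : -1 + 2 = 1 :> R by lra.
rewrite /square_sum e1; set r := segment_sum _ j (1 +i* -1) (1 +i* 1).
have rot (a b c d : R) : segment_sum (fun z : C => z^-1) j ((- b) +i* a) ((- d) +i* c)
    = segment_sum (fun z : C => z^-1) j (a +i* b) (c +i* d).
  rewrite -[RHS]segment_sum_inv_rot; congr (segment_sum _ _ _ _);
    by apply/eqP; rewrite eq_complex /=; apply/andP; split; apply/eqP; ring.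
have r2 : segment_sum (fun z : C => z^-1) j (1 +i* 1) (-1 +i* 1) = r.
  by have := rot 1 (-1) 1 1; rewrite opprK.
have r3 : segment_sum (fun z : C => z^-1) j (-1 +i* 1) (-1 +i* -1) = r.
  by rewrite -r2 -(rot 1 1 (-1) 1).
have r4 : segment_sum (fun z : C => z^-1) j (-1 +i* -1) (1 +i* -1) = r.
  by rewrite -r3 -(rot (-1) 1 (-1) (-1)) opprK.
rewrite r2 r3 r4; apply: le_trans (ler_Im_normc _); rewrite !ImD.
have /= := @Im_segment_sum_inv j (-1) 1; rewrite lexx -/r => h.
have := h _ (lexx _); rewrite (_ : (1 - -1) / 2 = 1 :> R); last by lra.
move=> /(_ ltac:(lra)) h1; apply: le_trans (ler_norm _); lra.
Qed.

End Boundary.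

(** * Differentiability with real epsilons *)

Section Norms.
Variable R : realType.
Local Notation C := R[i].
Variable V : normedModType C.
Implicit Types (x y v : V).

(** Norms over C are complex numbers that happen to be real; estimates are made
    on their real parts. *)
Definition rnorm (v : V) : R := Re `|v|.

Lemma rnormE v : `|v| = (rnorm v)%:C.
Proof. by rewrite /rnorm RRe_real // normr_real. Qed.

Lemma rnorm_ge0 v : 0 <= rnorm v.
Proof. by rewrite -lecR -rnormE normr_ge0. Qed.

Lemma ler_rnormD x y : rnorm (x + y) <= rnorm x + rnorm y.
Proof. by rewrite -lecR rmorphD /= -!rnormE; exact: ler_normD. Qed.

Lemma rnormZ (a : C) v : rnorm (a *: v) = normc a * rnorm v.
Proof. by apply: complexI; rewrite rmorphM /= -!rnormE normrZ. Qed.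

Lemma rnorm0 : rnorm 0 = 0.
Proof. by rewrite /rnorm normr0. Qed.

Lemma rnormN v : rnorm (- v) = rnorm v.
Proof. by rewrite /rnorm normrN. Qed.

Lemma rnorm_eq0 v : rnorm v = 0 -> v = 0.
Proof. by move=> v0; apply/eqP; rewrite -normr_eq0 rnormE v0. Qed.

Lemma nbhs_rnormP (A : set V) x :
  nbhs x A <-> exists2 r : R, 0 < r & forall y, rnorm (y - x) < r -> A y.
Proof.
split=> [/nbhs_ballP[e /= e0 eA]|[r r0 rA]].
  have eR : (Re e)%:C = e by rewrite RRe_real // gtr0_real.
  exists (Re e) => [|y yx]; first by rewrite -ltcR eR.
  apply: eA; rewrite -ball_normE /ball_ /= distrC rnormE -eR ltcR.
  exact: yx.
apply/nbhs_ballP; exists r%:C => /=; first by rewrite ltcR.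
move=> y; rewrite -ball_normE /ball_ /= distrC rnormE ltcR; exact: rA.
Qed.

End Norms.

Section Differentials.
Variable R : realType.
Local Notation C := R[i].

Lemma differentiable_eps (V : normedModType C) (F : V -> C) p :
  differentiable F p -> forall e : R, 0 < e ->
  exists2 d : R, 0 < d & forall h, rnorm h < d ->
    normc (F (p + h) - F p - 'd F p h) <= e * rnorm h.
Proof.
move=> /diff_locally /eqaddoP dF e e0.
have := dF e%:C; rewrite ltcR => /(_ e0) /nbhs_rnormP[r r0 H].
exists r => // h hr; rewrite -lecR rmorphM /= -rnormE; have := H h.
rewrite subr0 => /(_ hr); rewrite (addrC p).
suff -> : (F \o shift p - (cst (F p) + 'd F p)) h = F (h + p) - F p - 'd F p h by [].
by rewrite -addrA -opprD.
Qed.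

Lemma eps_differentiable (V : normedModType C) (F : V -> C) p (L : {linear V -> C}) :
  continuous L ->
  (forall e : R, 0 < e -> exists2 d : R, 0 < d & forall h, rnorm h < d ->
    normc (F (p + h) - F p - L h) <= e * rnorm h) ->
  differentiable F p /\ 'd F p = L :> (V -> C).
Proof.
move=> Lc H.
have Ld : F \o shift p = cst (F p) + L +o_ 0 id.
  apply/eqaddoP => e e0; have eR : (Re e)%:C = e by rewrite RRe_real // gtr0_real.
  have [] := H (Re e); first by rewrite -ltcR eR.
  move=> d d0 Hd; apply/nbhs_rnormP; exists d => // h; rewrite subr0 => /Hd.
  rewrite -lecR rmorphM /= -rnormE eR (addrC p).
  suff -> : (F \o shift p - (cst (F p) + L)) h = F (h + p) - F p - L h by [].
  by rewrite -addrA -opprD.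
have dE := diff_unique Lc Ld.
by split; [apply/diff_locallyP; rewrite dE; split; [exact: Lc|exact: Ld]|exact: dE].
Qed.

Lemma cdifferential_differentiable (f : C -> C) z l :
  cdifferential f z l -> differentiable f z.
Proof.
move=> fl.
have Lc : continuous ( *:%R l : C -> C) by exact: scaler_continuous.
have [] // := @eps_differentiable C f z ( *:%R l) Lc.
Qed.

Lemma differentiable_line (V : normedModType C) (F : V -> C) p v (t : C) :
  differentiable F (p + t *: v) ->
  cdifferential (fun t => F (p + t *: v)) t ('d F (p + t *: v) v).
Proof.
move=> dF e e0.
have n0 := rnorm_ge0 v.
have e1 : 0 < e / (1 + rnorm v) by apply: divr_gt0 => //; lra.
have [d d0 H] := differentiable_eps dF e1.
have d1 : 0 < d / (1 + rnorm v) by apply: divr_gt0 => //; lra.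
exists (d / (1 + rnorm v)) => // s sd; have s0 := normc_ge0 s.
have := H (s *: v); rewrite rnormZ scalerDl addrA linearZ /= => h.
rewrite mulrC; apply: le_trans (h _) _.
  apply: le_lt_trans (_ : normc s * (1 + rnorm v) < _); first by nra.
  by rewrite -ltr_pdivlMr //; lra.
rewrite mulrAC ler_pdivrMr; last lra.
by rewrite -[leRHS]mulrA ler_pM2l // ler_wpM2l //; lra.
Qed.

Lemma differentiable_cdifferential (f : C -> C) z :
  differentiable f z -> exists l, cdifferential f z l.
Proof.
move=> df; exists ('d f z 1) => e e0.
have [d d0 H] := differentiable_eps df e0; exists d => // t td.
have := H t td; suff -> : 'd f z t = 'd f z 1 * t by [].
by rewrite -[in LHS](mulr1 t) -[t * 1]/(t *: (1 : C)) linearZ /= mulrC.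
Qed.

End Differentials.

Section NearEqual.
Variables (K : numFieldType) (V W : normedModType K).

Lemma near_eq_diff (f g : V -> W) (p : V) :
  (\forall x \near p, f x = g x) -> differentiable f p ->
  differentiable g p /\ 'd g p = 'd f p :> (V -> W).
Proof.
move=> fg df; have fgp := nbhs_singleton fg.
have dfc : continuous ('d f p) by exact: diff_continuous.
have Lg : g \o shift p = cst (g p) + 'd f p +o_ 0 id.
  apply/eqaddoP => e e0; have /eqaddoP /(_ e e0) := diff_locally df.
  have : \forall h \near (0 : V), f (h + p) = g (h + p).
    by move: fg; rewrite (near_shift 0 p) /= subr0.
  apply: filterS2 => h fgh; rewrite -[(_ - _) h]/(f (h + p) - (f p + 'd f p h)).
  by rewrite fgh fgp.
have dE := diff_unique dfc Lg.
by split; [apply/diff_locallyP; rewrite dE; split; [exact: dfc|exact: Lg]|exact: dE].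
Qed.

End NearEqual.

(** * A Cauchy estimate from Goursat's theorem *)

Section Lipschitz.
Variable R : realType.
Local Notation C := R[i].
Implicit Types f : C -> C.

Definition difference_quotient f (w z : C) : C :=
  if z == w then 'd f w 1 else (f z - f w) / (z - w).

Lemma difference_quotient_differentiable f w z : z != w ->
  differentiable f z -> differentiable (difference_quotient f w) z.
Proof.
move=> zw df.
have dq : differentiable (fun z => (f z - f w) * (z - w)^-1) z.
  apply: differentiableM; first exact: differentiableB.
  apply: differentiableV; last by rewrite subr_eq0.
  by apply: differentiableB.
have [] // := near_eq_diff (g := difference_quotient f w) _ dq.
have : 0 < rnorm (z - w) by rewrite [rnorm _]/(normc (z - w)) normc_gt0 subr_eq0.
move=> zw0; apply/nbhs_rnormP; exists (rnorm (z - w)) => // y yz.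
rewrite /difference_quotient; case: eqP => // yw; move: yz.
by rewrite yw -rnormN opprB ltxx.
Qed.

Lemma difference_quotient_continuous f w : differentiable f w ->
  forall e, 0 < e -> exists2 d, 0 < d & forall z, normc (z - w) < d ->
    normc (difference_quotient f w z - difference_quotient f w w) <= e.
Proof.
move=> df e e0; have [d d0 H] := differentiable_eps df e0; exists d => // z zw.
rewrite /difference_quotient eqxx; case: eqP => [_|/eqP zw0].
  by rewrite subrr normc0 ltW.
have n0 : 0 < normc (z - w) by rewrite normc_gt0 subr_eq0.
have := H _ zw; rewrite (addrC w) subrK => h.
have -> : (f z - f w) / (z - w) - 'd f w 1 = (f z - f w - 'd f w (z - w)) / (z - w).
  have -> : 'd f w (z - w) = 'd f w 1 * (z - w).
    by rewrite -[in LHS](mulr1 (z - w)) -[_ * 1]/((z - w) *: (1 : C)) linearZ /= mulrC.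
  by field; rewrite subr_eq0.
by rewrite normcM normcV ler_pdivrMr.
Qed.

(** The difference quotients of f at w and at 0 have vanishing sums around the
    square by Goursat's theorem.  Their difference is
      (f z - f w) w / (z (z - w)) - (f w - f 0) / z,
    so the sum of (f w - f 0) / z equals that of the first term.  The sum of 1/z
    has modulus at least 4, and on the boundary |z| >= 1 and |z - w| >= 1/2, so the
    first term is at most 4 B |w| over a perimeter of 8. *)
Lemma lipschitz_square f (B : R) w :
  (forall z, in_square (-1) (-1) 2 z -> differentiable f z) ->
  (forall z, in_square (-1) (-1) 2 z -> normc (f z) <= B) ->
  normc w <= 1 / 2 -> normc (f w - f 0) <= 8 * B * normc w.
Proof.
move=> df fB w2.
have [->|w0] := eqVneq w 0; first by rewrite subrr normc0 mulr0.
have in0 : in_square (-1) (-1) 2 (0 : C) by split => /=; apply/andP; split; lra.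
have inw : in_square (-1) (-1) 2 w.
  have := ler_Re_normc w; have := ler_Im_normc w; rewrite !ler_norml.
  by move=> /andP[? ?] /andP[? ?]; split; apply/andP; split; lra.
have B0 : 0 <= B by apply: le_trans (normc_ge0 _) (fB _ in0).
have small v : in_square (-1) (-1) 2 v -> forall e : R, 0 < e ->
    exists J, forall j, (J <= j)%N ->
      normc (square_sum (difference_quotient f v) j (-1) (-1) 2) <= e.
  move=> vin; apply: (@goursat _ _ v) => // [z zin zv|_].
    apply: differentiable_cdifferential.
    by apply: difference_quotient_differentiable => //; exact: df.
  by apply: difference_quotient_continuous; exact: df.
pose k z := (f z - f w) * (w / (z * (z - w))).
have bd1 (z : C) : on_boundary (-1) (-1) 2 z -> 1 <= normc z.
  have hR := ler_Re_normc z; have hI := ler_Im_normc z.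
  move=> [_ [] h]; [have := ler_norm (- Im z)|have := ler_norm (Re z)
    |have := ler_norm (Im z)|have := ler_norm (- Re z)]; rewrite ?normrN; lra.
have bdw (z : C) : on_boundary (-1) (-1) 2 z -> 1 / 2 <= normc (z - w).
  by move/bd1; have := ler_normcD (z - w) w; rewrite subrK; lra.
have ident z : on_boundary (-1) (-1) 2 z ->
    difference_quotient f w z - difference_quotient f 0 z = k z - (f w - f 0) * z^-1.
  move=> zb; have z1 := bd1 _ zb; have z2 := bdw _ zb.
  have z0 : z != 0 by rewrite -normc_gt0; lra.
  have zw : z - w != 0 by rewrite -normc_gt0; lra.
  rewrite /difference_quotient /k -[z == w]subr_eq0 (negPf zw) (negPf z0).
  by field; rewrite z0 zw.
have kB z : on_boundary (-1) (-1) 2 z -> normc (k z) <= 4 * B * normc w.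
  move=> zb; have z1 := bd1 _ zb; have z2 := bdw _ zb.
  rewrite /k !normcM normcV normcM mulrA ler_pdivrMr; last by apply: mulr_gt0; lra.
  have := ler_normcB (f z) (f w); have := fB _ inw; have := fB _ zb.1 => h1 h2 h3.
  have h4 : 1 / 2 <= normc z * normc (z - w) by nra.
  have wn := normc_ge0 w.
  apply: le_trans (_ : 2 * B * normc w <= _); first by rewrite ler_wpM2r //; lra.
  have := mulr_ge0 B0 wn; nra.
apply/ler_addgt0Pr => e e0; have [J1 H1] := small _ inw _ e0.
have [J2 H2] := small _ in0 _ e0; pose j := maxn J1 J2.
have := H1 j (leq_maxl _ _); have := H2 j (leq_maxr _ _).
have := square_sumB (difference_quotient f w) (difference_quotient f 0) j (-1) (-1) 2.
rewrite (square_sum_ext j _ ident) // square_sumB square_sumZ.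
have := square_sum_inv_ge R j.
set I := square_sum _ j _ _ _; set S := square_sum k _ _ _ _.
set X := square_sum _ _ _ _ _; set Y := square_sum _ _ _ _ _ => I4 E Y1 X1.
have S1 : normc S <= 4 * 2 * (4 * B * normc w).
  apply: square_sum_le_boundary => //.
  by rewrite !mulr_ge0 ?normc_ge0.
have E2 : (f w - f 0) * I = S - X + Y by rewrite -[LHS](subKr S) E; ring.
have : normc ((f w - f 0) * I) <= normc S + normc X + normc Y.
  rewrite E2; apply: le_trans (ler_normcD _ _) _; rewrite lerD2r; exact: ler_normcB.
rewrite normcM => h.
have := ler_wpM2l (normc_ge0 (f w - f 0)) I4; lra.
Qed.

End Lipschitz.

(** * Estimates of first and second order in several variables *)

Section SeveralVariables.
Variable R : realType.
Local Notation C := R[i].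
Variable V : normedModType C.
Implicit Types (F : V -> C) (p x y h v : V).

Lemma differentiable_shift F x h :
  differentiable F (x + h) ->
  differentiable (fun y => F (y + h)) x /\
  'd (fun y => F (y + h)) x = 'd F (x + h) :> (V -> C).
Proof.
move=> dF.
have sd : is_diff x (fun y => y + h) id.
  have -> : (id : V -> V) = id + (0 : V -> V) by apply/funext => y; rewrite /= addr0.
  exact: is_diffD.
have Fd : is_diff (x + h) F ('d F (x + h)) by exact: differentiableP.
have [] := @is_diff_comp _ _ _ _ (fun y => y + h) id F ('d F (x + h)) x sd Fd.
by move=> ? ?; split.
Qed.

Lemma normc_in_square_lt2 (z : C) : in_square (-1) (-1) 2 z -> normc z < 2.
Proof.
case: z => a b [] /= /andP[? ?] /andP[? ?].
rewrite -(ltr_pXn2r (n := 2)) ?nnegrE ?sqrtr_ge0 //.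
rewrite sqr_sqrtr ?addr_ge0 ?sqr_ge0 // !expr2; nra.
Qed.

(** The homothety of ratio r / 2 maps the square [-1, 1] x [-1, 1] into the disc
    of radius r, since the square has radius the square root of 2.  It covers the
    points t with |t| <= r / 4; for the others the bound 2 B is good enough. *)
Lemma lipschitz_disc (f : C -> C) (B r : R) t : 0 < r ->
  (forall z, normc z < r -> differentiable f z) ->
  (forall z, normc z < r -> normc (f z) <= B) ->
  normc t < r -> normc (f t - f 0) <= 16 * B / r * normc t.
Proof.
move=> r0 df fB tr.
have z0 : normc (0 : C) < r by rewrite normc0.
have B0 := le_trans (normc_ge0 _) (fB _ z0).
have t0 := normc_ge0 t.
have [tr4|tr4] := leP (normc t) (r / 4); last first.
  apply: le_trans (ler_normcB _ _) _; apply: le_trans (lerD (fB _ tr) (fB _ z0)) _.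
  rewrite mulrAC ler_pdivlMr //; nra.
have rn0 : (r / 2)%:C != 0 :> C by rewrite -normc_gt0 normc_real gtr0_norm; lra.
pose g z := f ((r / 2)%:C *: z).
have sq z : in_square (-1) (-1) 2 z -> normc ((r / 2)%:C * z) < r.
  move=> /normc_in_square_lt2 z2; rewrite normcM normc_real gtr0_norm; nra.
have dg z : in_square (-1) (-1) 2 z -> differentiable g z.
  move=> /sq /df zd; apply: (differentiable_comp _ zd).
  by have [] := @is_diff_scaler C C (r / 2)%:C z.
have gB z : in_square (-1) (-1) 2 z -> normc (g z) <= B by move=> /sq /fB.
have := @lipschitz_square R g B (t / (r / 2)%:C) dg gB.
rewrite normcM normcV normc_real gtr0_norm; last lra.
rewrite /g scaler0.
have -> : (r / 2)%:C *: (t / (r / 2)%:C) = t.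
  by rewrite -[LHS]/((r / 2)%:C * (t / (r / 2)%:C)) mulrC divfK.
move=> h.
apply: le_trans (h _) _; first by rewrite ler_pdivrMr; lra.
rewrite le_eqVlt; apply/orP; left; apply/eqP; field.
exact: lt0r_neq0.
Qed.

Definition bounded_holomorphic F p (r B : R) :=
  forall x, rnorm (x - p) < r -> differentiable F x /\ normc (F x) <= B.

(** F is restricted to the complex line through x and y, on which the disc of
    radius rho = (2 r / 3) / |y - x| stays in the ball: 16 B / rho is
    24 B |y - x| / r. *)
Lemma lipschitz_ball F p (r B : R) x y : 0 < r -> bounded_holomorphic F p r B ->
  rnorm (x - p) < r / 3 -> rnorm (y - p) < r / 3 ->
  normc (F y - F x) <= 24 * B / r * rnorm (y - x).
Proof.
move=> r0 FB xp yp; have [->|xy] := eqVneq y x.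
  by rewrite !subrr normc0 rnorm0 mulr0.
have d0 : 0 < rnorm (y - x).
  rewrite lt_def rnorm_ge0 andbT; apply: contraNneq xy => /rnorm_eq0 /eqP.
  by rewrite subr_eq0.
have yx : rnorm (y - x) < 2 * r / 3.
  have := ler_rnormD (y - p) (p - x); rewrite addrA subrK -(rnormN (p - x)) opprB; lra.
pose rho := (2 * r / 3) / rnorm (y - x).
have rho0 : 0 < rho by apply: divr_gt0 => //; lra.
have inb z : normc z < rho -> rnorm (x + z *: (y - x) - p) < r.
  rewrite /rho ltr_pdivlMr // addrAC => zr.
  by apply: le_lt_trans (ler_rnormD _ _) _; rewrite rnormZ; lra.
have := @lipschitz_disc (fun t => F (x + t *: (y - x))) B rho 1 rho0.
rewrite scale1r scale0r addr0 (addrC x) subrK normc1 mulr1 => h.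
apply: le_trans (h _ _ _) _.
- move=> z /inb /FB[dF _].
  apply: (@cdifferential_differentiable _ _ _ ('d F (x + z *: (y - x)) (y - x))).
  exact: differentiable_line.
- by move=> z /inb /FB[].
- by rewrite /rho ltr_pdivlMr // mul1r.
rewrite le_eqVlt; apply/orP; left; apply/eqP; rewrite /rho; field.
by rewrite !lt0r_neq0.
Qed.

(** The Lipschitz bound is applied to F (. + h) - F, itself bounded by
    24 B |h| / r on the ball of radius r / 6, and 3456 = 24 * 24 * 6. *)
Lemma second_difference_le F p (r B : R) x y h : 0 < r -> bounded_holomorphic F p r B ->
  rnorm (x - p) < r / 18 -> rnorm (y - p) < r / 18 -> rnorm h < r / 6 ->
  normc ((F (y + h) - F y) - (F (x + h) - F x))
    <= 3456 * B / r ^+ 2 * rnorm h * rnorm (y - x).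
Proof.
move=> r0 FB xp yp hr.
have D : bounded_holomorphic (fun x => F (x + h) - F x) p (r / 6) (24 * B / r * rnorm h).
  move=> z zp; have zh : rnorm (z + h - p) < r / 3.
    by rewrite addrAC; apply: le_lt_trans (ler_rnormD _ _) _; lra.
  split.
    have [dz _] : differentiable F z /\ normc (F z) <= B by apply: FB; lra.
    have [/differentiable_shift[dzh _] _] : differentiable F (z + h) /\ normc (F (z + h)) <= B.
      by apply: FB; lra.
    exact: differentiableB.
  have := lipschitz_ball r0 FB (x := z) (y := z + h).
  have zhz : z + h - z = h by rewrite addrAC subrr add0r.
  by rewrite zhz; apply => //; lra.
have := lipschitz_ball (x := x) (y := y) _ D.
move=> /(_ ltac:(lra) ltac:(lra) ltac:(lra)) H; apply: le_trans H _.
rewrite le_eqVlt; apply/orP; left; apply/eqP; field.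
exact: lt0r_neq0.
Qed.

(** Let E h be the Taylor remainder at x.  The second difference of F for two
    increments h / 2 is E h - 2 E (h / 2), hence
    |E h| <= 2 |E (h / 2)| + K |h| ^ 2 / 4.  Iterating, the quadratic terms form a
    geometric series, while 2 ^ n E (h / 2 ^ n) tends to 0 by differentiability. *)
Lemma taylor1_le F p (r B : R) x h : 0 < r -> bounded_holomorphic F p r B ->
  rnorm (x - p) < r / 36 -> rnorm h < r / 36 ->
  normc (F (x + h) - F x - 'd F x h) <= 3456 * B / r ^+ 2 * rnorm h ^+ 2.
Proof.
move=> r0 FB xp hr; set K := 3456 * B / r ^+ 2.
have pp : rnorm (p - p) < r by rewrite subrr rnorm0.
have B0 := le_trans (normc_ge0 _) (FB _ pp).2.
have K0 : 0 <= K by rewrite /K divr_ge0 ?exprn_ge0 ?mulr_ge0 // ltW.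
pose E h := F (x + h) - F x - 'd F x h.
pose half h : V := (2^-1 : R)%:C *: h.
have halfD h' : half h' + half h' = h'.
  rewrite -scalerDl -rmorphD /= (_ : 2^-1 + 2^-1 = 1 :> R) ?scale1r //; lra.
have halfN h' : rnorm (half h') = rnorm h' / 2.
  by rewrite rnormZ normc_real gtr0_norm ?invr_gt0 // mulrC.
have step h' : rnorm h' < r / 36 ->
    normc (E h') <= 2 * normc (E (half h')) + K * rnorm h' ^+ 2 / 4.
  move=> h'r; have n0 := rnorm_ge0 h'.
  have := second_difference_le (x := x) (y := x + half h') (h := half h') r0 FB.
  have xh : rnorm (x + half h' - p) < r / 18.
    by rewrite addrAC; apply: le_lt_trans (ler_rnormD _ _) _; rewrite halfN; lra.
  have hh : rnorm (half h') < r / 6 by rewrite halfN; lra.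
  have e1 : x + half h' + half h' = x + h' by rewrite -addrA halfD.
  have e2 : x + half h' - x = half h' by rewrite addrAC subrr add0r.
  move=> /(_ ltac:(lra) xh hh); rewrite e1 e2 -/K halfN.
  have -> : E h' = (F (x + h') - F (x + half h') - (F (x + half h') - F x)) + (E (half h') + E (half h')).
    have dd : 'd F x h' = 'd F x (half h') + 'd F x (half h') by rewrite -linearD halfD.
    by rewrite /E dd; ring.
  move=> H; apply: le_trans (ler_normcD _ _) _.
  have := ler_normcD (E (half h')) (E (half h')).
  rewrite -mulrA in H; rewrite expr2; lra.
have iterN n h' : rnorm (iter n half h') = rnorm h' / 2 ^+ n.
  elim: n => [|n IH]; first by rewrite divr1.
  by rewrite iterS halfN IH exprSr invfM mulrA.
have bound n h' : rnorm h' < r / 36 ->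
    normc (E h') <= 2 ^+ n * normc (E (iter n half h')) + K * rnorm h' ^+ 2 / 2.
  elim: n h' => [|n IH] h' h'r.
    rewrite expr0 mul1r lerDl; apply: divr_ge0 => //.
    by apply: mulr_ge0 => //; exact: sqr_ge0.
  have n0 := rnorm_ge0 h'.
  have := IH (half h'); rewrite halfN -iterSr => /(_ ltac:(lra)).
  by have := step _ h'r; rewrite (exprS 2 n) !expr2; lra.
have h0 := rnorm_ge0 h.
have T0 : 0 <= K * rnorm h ^+ 2 by apply: mulr_ge0 => //; exact: sqr_ge0.
apply/ler_addgt0Pr => e e0.
have e1 : 0 < e / (1 + rnorm h) by apply: divr_gt0 => //; lra.
have xr : rnorm (x - p) < r by lra.
have [d d0 H] := differentiable_eps (FB _ xr).1 e1.
have [n nh] : exists n, rnorm h / d < n.+1%:R.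
  by exists (Num.truncn (rnorm h / d)); exact: truncnS_gt.
have hd : rnorm (iter n.+1 half h) < d.
  rewrite iterN ltr_pdivrMr ?exprn_gt0 //; rewrite ltr_pdivrMr // in nh.
  apply: lt_le_trans nh _; rewrite mulrC ler_pM2l // -natrX ler_nat.
  exact: ltnW (ltn_expl _ _).
apply: le_trans (bound n.+1 _ hr) _; rewrite addrC; apply: lerD; first lra.
rewrite mulrC -ler_pdivlMr ?exprn_gt0 //; apply: le_trans (H _ hd) _.
rewrite iterN mulrA ler_pM2r ?invr_gt0 ?exprn_gt0 // mulrAC ler_pdivrMr; last lra.
by rewrite ler_pM2l //; lra.
Qed.

End SeveralVariables.

(** * Limits at a punctured point *)

Section CauchyLimit.
Variable R : realType.
Local Notation C := R[i].

Definition punctured_limit (q : C -> C) (l : C) := forall e : R, 0 < e ->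
  exists2 d : R, 0 < d & forall t, 0 < normc t < d -> normc (q t - l) <= e.

Lemma real_cauchy_limit (q : C -> R) :
  (forall e : R, 0 < e -> exists2 d : R, 0 < d & forall t t',
     0 < normc t < d -> 0 < normc t' < d -> `|q t - q t'| <= e) ->
  exists l, forall e : R, 0 < e -> exists2 d : R, 0 < d & forall t,
     0 < normc t < d -> `|q t - l| <= e.
Proof.
move=> H.
have near0 (P : C -> Prop) (d : R) : 0 < d -> (forall t, 0 < normc t < d -> P t) ->
    \forall t \near 0^', P t.
  move=> d0 dP; rewrite near_withinE; apply/nbhs_rnormP; exists d => // t.
  by rewrite subr0 => td t0; apply: dP; rewrite normc_gt0 t0.
have : cauchy (q @ (0 : C)^').
  apply: cauchy_exP => e e0; have e2 : 0 < e / 2 by rewrite divr_gt0.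
  have [d d0 qd] := H _ e2; have d2 : 0 < normc (d / 2)%:C < d.
    by rewrite normc_real gtr0_norm; [apply/andP; split; lra|lra].
  exists (q (d / 2)%:C); apply: (near0 _ d d0) => t td.
  by rewrite /ball /= (le_lt_trans (qd _ _ d2 td)) //; lra.
move=> /cauchy_cvg /cvg_ex[l /cvgrPdist_le ql]; exists l => e e0.
have := ql _ e0; rewrite near_withinE => /nbhs_rnormP[d d0 qd].
exists d => // t /andP[t0 td]; rewrite distrC; apply: qd; first by rewrite subr0.
by rewrite -normc_gt0.
Qed.

Lemma cauchy_punctured_limit (q : C -> C) :
  (forall e : R, 0 < e -> exists2 d : R, 0 < d & forall t t',
     0 < normc t < d -> 0 < normc t' < d -> normc (q t - q t') <= e) ->
  exists l, punctured_limit q l.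
Proof.
move=> H.
have [a qa] : exists l, forall e : R, 0 < e -> exists2 d : R, 0 < d & forall t,
     0 < normc t < d -> `|Re (q t) - l| <= e.
  apply: real_cauchy_limit => e /H[d d0 qd]; exists d => // t t' td t'd.
  by rewrite -ReN -ReD; apply: le_trans (ler_Re_normc _) (qd _ _ td t'd).
have [b qb] : exists l, forall e : R, 0 < e -> exists2 d : R, 0 < d & forall t,
     0 < normc t < d -> `|Im (q t) - l| <= e.
  apply: real_cauchy_limit => e /H[d d0 qd]; exists d => // t t' td t'd.
  by rewrite -ImN -ImD; apply: le_trans (ler_Im_normc _) (qd _ _ td t'd).
exists (a +i* b) => e e0; have e2 : 0 < e / 2 by rewrite divr_gt0.
have [d1 d10 h1] := qa _ e2; have [d2 d20 h2] := qb _ e2.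
exists (Num.min d1 d2) => [|t /andP[t0]]; first by rewrite lt_min d10.
rewrite lt_min => /andP[t1 t2]; apply: le_trans (ler_normc_ReIm _) _.
rewrite ReD ReN ImD ImN /=.
have := h1 t; have := h2 t; rewrite t0 t1 t2 => /(_ isT) ? /(_ isT) ?; lra.
Qed.

Lemma punctured_limit_unique (q : C -> C) l l' :
  punctured_limit q l -> punctured_limit q l' -> l = l'.
Proof.
move=> H H'; apply/eqP; rewrite -subr_eq0; apply/negPn/negP; rewrite -normc_gt0 => e0.
have e3 : 0 < normc (l - l') / 3 by rewrite divr_gt0.
have [d d0 h] := H _ e3; have [d' d'0 h'] := H' _ e3.
pose m := Num.min d d' / 2; have m0 : 0 < m by rewrite divr_gt0 // lt_min d0.
have mN : normc m%:C = m by rewrite normc_real gtr0_norm.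
have := h m%:C; have := h' m%:C; rewrite mN m0 /=.
have md : m < d.
  have : Num.min d d' <= d by rewrite ge_min lexx.
  by move: m0; rewrite /m; lra.
have md' : m < d'.
  have : Num.min d d' <= d' by rewrite ge_min lexx orbT.
  by move: m0; rewrite /m; lra.
move=> /(_ md') h1 /(_ md) h2.
have := ler_normcB (q m%:C - l') (q m%:C - l).
rewrite (_ : q m%:C - l' - (q m%:C - l) = l - l'); last by ring.
lra.
Qed.

Lemma punctured_limitD (q q' : C -> C) (c l l' : C) :
  punctured_limit q l -> punctured_limit q' l' ->
  punctured_limit (fun t => c * q t + q' t) (c * l + l').
Proof.
move=> H H' e e0; have c1 : 0 < 1 + normc c by have := normc_ge0 c; lra.
have e2 : 0 < e / 2 / (1 + normc c) by rewrite !divr_gt0.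
have e3 : 0 < e / 2 by rewrite divr_gt0.
have [d d0 h] := H _ e2; have [d' d'0 h'] := H' _ e3.
exists (Num.min d d') => [|t /andP[t0]]; first by rewrite lt_min d0.
rewrite lt_min => /andP[td td'].
have := h t; have := h' t; rewrite t0 td td' => /(_ isT) h1 /(_ isT).
rewrite ler_pdivlMr // => h2.
rewrite (_ : _ - _ = c * (q t - l) + (q' t - l')); last by ring.
apply: le_trans (ler_normcD _ _) _; rewrite normcM.
have := normc_ge0 (q t - l); nra.
Qed.

Lemma differential_punctured_limit (V : normedModType C) (F : V -> C) p v :
  differentiable F p ->
  punctured_limit (fun t => (F (p + t *: v) - F p) / t) ('d F p v).
Proof.
move=> dF e e0; have dF0 : differentiable F (p + 0 *: v) by rewrite scale0r addr0.
have [d d0 h] := differentiable_line dF0 e0; exists d => // t /andP[t0 td].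
have := h t td; rewrite scale0r add0r addr0 => H.
have tn : t != 0 by rewrite -normc_gt0.
rewrite (_ : _ - _ = (F (p + t *: v) - F p - 'd F p v * t) / t); last by field.
by rewrite normcM normcV ler_pdivrMr.
Qed.

(** Needed because the limit of a family of continuous linear maps is linear, but
    its continuity has to come from a bound. *)
Lemma locally_bounded_linear_continuous (V : normedModType C) (L : {linear V -> C}) (M r : R) :
  0 < r -> (forall h, rnorm h < r -> normc (L h) <= M) -> continuous L.
Proof.
move=> r0 LM.
have M0 : 0 <= M by apply: le_trans (normc_ge0 _) (LM 0 _); rewrite rnorm0.
have Lle e h : 0 < e -> rnorm h < r * (e / (1 + M)) -> normc (L h) < e.
  move=> e0 hr; have M1 : 0 < 1 + M by lra.
  have c0 : 0 < (1 + M) / e by rewrite divr_gt0.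
  have := LM (((1 + M) / e)%:C *: h); rewrite rnormZ linearZ normcM normc_real gtr0_norm //.
  move=> H; have : (1 + M) / e * rnorm h < r.
    by rewrite mulrC -ltr_pdivlMr // invf_div.
  move=> /H; rewrite mulrAC ler_pdivrMr // => h2; nra.
move=> x; apply/cvgrPdist_lt => e e0; have eR : (Re e)%:C = e by rewrite RRe_real // gtr0_real.
have eR0 : 0 < Re e by rewrite -ltcR eR.
apply/nbhs_rnormP; exists (r * (Re e / (1 + M))) => [|y yx].
  by rewrite mulr_gt0 // divr_gt0 //; lra.
rewrite -linearB -eR normcE ltcR; apply: Lle => //.
by rewrite -rnormN opprB.
Qed.

End CauchyLimit.

(** * Differentials of uniform limits *)

Section UniformLimit.
Variable R : realType.
Local Notation C := R[i].
Variable V : normedModType C.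

(** G t tends to D near p as t tends to 0, and q t approximates the increments of
    G t at p with a quadratic error that does not depend on t. *)
Variables (G : C -> V -> C) (q : C -> {linear V -> C}) (D : V -> C) (p : V).
Variables (t0 r K K' M : R).
Hypotheses (t0_gt0 : 0 < t0) (r_gt0 : 0 < r) (K_ge0 : 0 <= K) (K'_ge0 : 0 <= K').
Hypothesis GD : forall t h, 0 < normc t < t0 -> rnorm h < r ->
  normc (G t (p + h) - D (p + h)) <= K' * normc t.
Hypothesis Gq : forall t h, 0 < normc t < t0 -> rnorm h < r ->
  normc (G t (p + h) - G t p - q t h) <= K * rnorm h ^+ 2.
Hypothesis DM : forall h, rnorm h < r -> normc (D (p + h) - D p) <= M.

Let GDp t : 0 < normc t < t0 -> normc (G t p - D p) <= K' * normc t.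
Proof. by move=> tt; have := GD (h := 0) tt; rewrite rnorm0 addr0; exact. Qed.

Lemma uniform_limit_estimate t t' h : 0 < normc t < t0 -> 0 < normc t' < t0 ->
  rnorm h < r -> normc (q t h - q t' h)
    <= 2 * (K * rnorm h ^+ 2) + 2 * (K' * normc t + K' * normc t').
Proof.
move=> tt tt' hr.
have a := GD tt hr; have a' := GD tt' hr; have b := Gq tt hr; have b' := Gq tt' hr.
have c := GDp tt; have c' := GDp tt'.
rewrite (_ : q t h - q t' h = ((G t' (p + h) - G t' p - q t' h)
    - (G t (p + h) - G t p - q t h)) + (((G t (p + h) - D (p + h))
    - (G t' (p + h) - D (p + h))) - ((G t p - D p) - (G t' p - D p)))); last by ring.
apply: le_trans (ler_normcD _ _) _.
apply: le_trans (lerD (le_trans (ler_normcB _ _) (lerD b' b)) (le_trans (ler_normcB _ _)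
  (lerD (le_trans (ler_normcB _ _) (lerD a a')) (le_trans (ler_normcB _ _) (lerD c c'))))) _.
by move: (K * _) (K' * _) (K' * _) => x y z; lra.
Qed.

(** For the increment h = s u the estimate reads, after division by s,
    2 K s |u| ^ 2 + O(|t| + |t'|) / s: choose s first, then t and t'. *)
Lemma uniform_limit_cauchy u : exists l, punctured_limit (fun t => q t u) l.
Proof.
apply: cauchy_punctured_limit => e e0.
have u0 := rnorm_ge0 u.
have [s [s0 su sK]] : exists s : R, [/\ 0 < s, s * rnorm u < r &
    2 * (K * (s * rnorm u) ^+ 2) <= s * (e / 2)].
  have U0 : 0 < 1 + rnorm u by lra.
  have T0 : 0 <= K * rnorm u ^+ 2 by rewrite mulr_ge0 // exprn_ge0.
  have KU0 : 0 < 4 * (K * rnorm u ^+ 2) + 1 by lra.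
  have a0 : 0 < r / (1 + rnorm u) / 2 by rewrite !divr_gt0.
  have b0 : 0 < e / (4 * (K * rnorm u ^+ 2) + 1) by rewrite divr_gt0.
  exists (Num.min (r / (1 + rnorm u) / 2) (e / (4 * (K * rnorm u ^+ 2) + 1))).
  set s := Num.min _ _; have s0 : 0 < s by rewrite lt_min a0.
  have s1 : s <= r / (1 + rnorm u) / 2 by rewrite ge_min lexx.
  have s2 : s <= e / (4 * (K * rnorm u ^+ 2) + 1) by rewrite ge_min lexx orbT.
  move: s s0 s1 s2 => s s0; rewrite ler_pdivlMr // => s1 s2.
  split => //.
    by rewrite ler_pdivlMr // in s1; have := mulr_ge0 (ltW s0) u0; lra.
  move: s2; rewrite ler_pdivlMr // -(ler_pM2l s0) exprMn !expr2.
  by have := mulr_gt0 s0 s0; lra.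
have k0 : 0 < 8 * K' + 1 by have := K'_ge0; lra.
have dd0 : 0 < s * e / (8 * K' + 1) by rewrite divr_gt0 // mulr_gt0.
exists (Num.min t0 (s * e / (8 * K' + 1))); first by rewrite lt_min t0_gt0.
move=> t t'; rewrite !lt_min => /andP[tn /andP[tt td]] /andP[t'n /andP[t't t'd]].
have := @uniform_limit_estimate t t' (s%:C *: u).
rewrite tn tt t'n t't rnormZ normc_real gtr0_norm // => /(_ isT isT su).
have qE t1 : q t1 (s%:C *: u) = s%:C * q t1 u by exact: linearZ.
rewrite !qE -mulrBr normcM normc_real gtr0_norm // => H.
rewrite -(ler_pM2l s0); apply: le_trans H _.
have bound x : normc x < s * e / (8 * K' + 1) -> K' * normc x <= s * e / 8.
  by rewrite ltr_pdivlMr //; have := normc_ge0 x; lra.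
by have := bound _ td; have := bound _ t'd; lra.
Qed.

Theorem uniform_limit_differentiable : exists L : {linear V -> C},
  [/\ differentiable D p, 'd D p = L :> (V -> C) &
      forall u, punctured_limit (fun t => q t u) (L u)].
Proof.
pose l u := projT1 (cid (uniform_limit_cauchy u)).
have lP u : punctured_limit (fun t => q t u) (l u).
  exact: (projT2 (cid (uniform_limit_cauchy u))).
have l_linear : linear l.
  move=> c u w; apply: punctured_limit_unique (lP _) _.
  have := punctured_limitD c (lP u) (lP w).
  by congr punctured_limit; apply/funext => t; rewrite linearP.
pose L : {linear V -> C} := HB.pack l (GRing.isLinear.Build C V C *:%R l l_linear).
have estimate h : rnorm h < r -> normc (D (p + h) - D p - L h) <= K * rnorm h ^+ 2.
  move=> hr; apply/ler_addgt0Pr => e e0; have e2 : 0 < e / 2 by rewrite divr_gt0.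
  have [d d0 Hd] := lP h _ e2.
  have k0 : 0 < 4 * K' + 1 by have := K'_ge0; lra.
  have dd0 : 0 < e / (4 * K' + 1) by rewrite divr_gt0.
  have [m [m0 mt md me]] : exists m, [/\ 0 < m, m < t0, m < d & m <= e / (4 * K' + 1)].
    have [m1 m1P] : exists m, m = Num.min t0 (Num.min d (e / (4 * K' + 1))) by eexists.
    have m10 : 0 < m1 by rewrite m1P !lt_min t0_gt0 d0.
    have a1 : m1 <= t0 by rewrite m1P ge_min lexx.
    have a2 : m1 <= d by rewrite m1P !ge_min lexx orbT.
    have a3 : m1 <= e / (4 * K' + 1) by rewrite m1P !ge_min lexx !orbT.
    by exists (m1 / 2); split; lra.
  have mN : normc m%:C = m by rewrite normc_real gtr0_norm.
  have T : 0 < normc m%:C < t0 by rewrite mN m0.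
  have := Gq T hr; have := GDp T; have := GD T hr.
  have := Hd m%:C; rewrite mN m0 md => /(_ isT).
  have mb : K' * m <= e / 4 by rewrite ler_pdivlMr // in me; lra.
  rewrite -[l h]/(L h) => h1 h2 h3 h4.
  rewrite (_ : D (p + h) - D p - L h = ((G m%:C (p + h) - G m%:C p - q m%:C h)
    + (q m%:C h - L h)) - ((G m%:C (p + h) - D (p + h)) - (G m%:C p - D p))); last by ring.
  apply: le_trans (ler_normcB _ _) _.
  have := ler_normcB (G m%:C (p + h) - D (p + h)) (G m%:C p - D p).
  have := ler_normcD (G m%:C (p + h) - G m%:C p - q m%:C h) (q m%:C h - L h).
  by lra.
have Lc : continuous L.
  apply: (@locally_bounded_linear_continuous _ _ _ (M + K * r ^+ 2) r r_gt0) => h hr.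
  rewrite (_ : L h = (D (p + h) - D p) - (D (p + h) - D p - L h)); last by ring.
  apply: le_trans (ler_normcB _ _) _; apply: lerD; first exact: DM.
  apply: le_trans (estimate _ hr) _; rewrite ler_wpM2l // ler_pXn2r ?nnegrE ?rnorm_ge0 //.
    exact: ltW.
  exact: ltW.
have eps e : 0 < e -> exists2 d : R, 0 < d & forall h, rnorm h < d ->
    normc (D (p + h) - D p - L h) <= e * rnorm h.
  move=> e0; have k0 : 0 < K + 1 by have := K_ge0; lra.
  exists (Num.min r (e / (K + 1))) => [|h].
    by rewrite lt_min r_gt0 divr_gt0.
  rewrite lt_min ltr_pdivlMr // => /andP[hr he]; apply: le_trans (estimate _ hr) _.
  have n0 := rnorm_ge0 h; rewrite expr2 mulrA ler_wpM2r //.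
  by lra.
have [dD dE] := eps_differentiable Lc eps.
exists L; split; [exact: dD|exact: dE|exact: lP].
Qed.

End UniformLimit.

(** * The differential of a holomorphic function is holomorphic *)

Section Regularity.
Variable R : realType.
Local Notation C := R[i].
Variable V : normedModType C.
Implicit Types (F : V -> C) (p x y h v : V).

Lemma diff_scaled_difference (f g : V -> C) p (c : C) :
  differentiable f p -> differentiable g p ->
  differentiable (fun x => (f x - g x) * c) p /\
  forall u, 'd (fun x => (f x - g x) * c) p u = ('d f p u - 'd g p u) * c.
Proof.
move=> df dg.
have E : (fun x => (f x - g x) * c) = c *: (f - g).
  by apply/funext => x; rewrite mulrC.
rewrite E.
have H := is_diffZ c (is_diffB (differentiableP df) (differentiableP dg)).
have [dfg dE] := H; split => // u.
apply: (etrans (congr1 (fun h : V -> C => h u) dE)).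
exact: mulrC.
Qed.

(** The limit of uniform families is applied to G t = (F (. + t v) - F) / t, which
    tends to the derivative of F along v at a linear rate by Taylor's formula.  The
    G t are bounded by the Lipschitz constant of F, so Taylor's formula for them is
    uniform in t.  The differential of G t at p in the direction u is the difference
    quotient along v of the derivative of F along u: this makes the second
    differential symmetric. *)
Lemma differential_differentiable_ball F p v (r B : R) : 0 < r ->
  bounded_holomorphic F p r B ->
  exists L : {linear V -> C}, [/\ differentiable (fun x => 'd F x v) p,
    'd (fun x => 'd F x v) p = L :> (V -> C) &
    forall u, punctured_limit (fun t => ('d F (p + t *: v) u - 'd F p u) / t) (L u)].
Proof.
move=> r0 FB; set K := 3456 * B / r ^+ 2.
have pp : rnorm (p - p) < r by rewrite subrr rnorm0.
have B0 := le_trans (normc_ge0 _) (FB _ pp).2.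
have K0 : 0 <= K by rewrite /K divr_ge0 ?exprn_ge0 ?mulr_ge0 // ltW.
have v0 := rnorm_ge0 v.
have [r1 r1E] : exists r1, r1 = r / 36 by eexists.
have r10 : 0 < r1 by rewrite r1E divr_gt0.
have [t0 t0E] : exists t0, t0 = r1 / (1 + rnorm v) by eexists.
have t00 : 0 < t0 by rewrite t0E divr_gt0 //; clear -v0; lra.
have tvr t : normc t < t0 -> rnorm (t *: v) < r1.
  have n0 := normc_ge0 t; rewrite rnormZ t0E ltr_pdivlMr; clear -v0 n0; lra.
pose G t x := (F (x + t *: v) - F x) / t.
have tvr3 t x : normc t < t0 -> rnorm (x - p) < r1 -> rnorm (x + t *: v - p) < r / 3.
  move=> /tvr h1 h2; rewrite addrAC; apply: le_lt_trans (ler_rnormD _ _) _.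
  by clear -h1 h2 r1E r0; lra.
have r1r : r1 < r / 3 by clear -r1E r0; lra.
have r3r : r / 3 < r by clear -r0; lra.
have GD t x : 0 < normc t < t0 -> rnorm (x - p) < r1 ->
    normc (G t x - 'd F x v) <= K * rnorm v ^+ 2 * normc t.
  move=> /andP[tn /tvr tv] xp; have tn0 : t != 0 by rewrite -normc_gt0.
  rewrite r1E in xp tv; have := taylor1_le r0 FB xp tv; rewrite -/K linearZ rnormZ => H.
  rewrite (_ : G t x - _ = (F (x + t *: v) - F x - t * 'd F x v) / t); last first.
    by rewrite /G; field.
  rewrite normcM normcV ler_pdivrMr //; apply: le_trans H _.
  by rewrite le_eqVlt; apply/orP; left; apply/eqP; ring.
have [B1 B1E] : exists B1, B1 = 24 * B / r * rnorm v by eexists.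
have GB t : 0 < normc t < t0 -> bounded_holomorphic (G t) p r1 B1.
  move=> /andP[tn tt] x xp; have tn0 : t != 0 by rewrite -normc_gt0.
  have xr3 := lt_trans xp r1r; have xr := lt_trans xr3 r3r.
  have xtr := tvr3 _ _ tt xp; have xtr' := lt_trans xtr r3r.
  split.
    have [dxt _] := differentiable_shift (FB _ xtr').1.
    by have [] := diff_scaled_difference t^-1 dxt (FB _ xr).1.
  have := lipschitz_ball r0 FB xr3 xtr.
  rewrite addrAC subrr add0r rnormZ /G normcM normcV ler_pdivrMr // B1E.
  by move=> H; apply: le_trans H _; rewrite le_eqVlt; apply/orP; left; apply/eqP; ring.
have dG t u : 0 < normc t < t0 -> 'd (G t) p u = ('d F (p + t *: v) u - 'd F p u) / t.
  move=> /andP[tn tt].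
  have ptr : rnorm (p + t *: v - p) < r.
    by apply: lt_trans r3r; apply: tvr3 => //; rewrite subrr rnorm0.
  have [dxt dE] := differentiable_shift (FB _ ptr).1.
  have [_ dGE] := diff_scaled_difference t^-1 dxt (FB _ pp).1.
  apply: (etrans (dGE u)); congr ((_ - _) * _).
  exact: (congr1 (fun h : V -> C => h u) dE).
have [r2 r2E] : exists r2, r2 = r1 / 36 by eexists.
have r20 : 0 < r2 by rewrite r2E divr_gt0.
have r21 : r2 < r1 by clear -r2E r10; lra.
have B10 : 0 <= B1 by rewrite B1E mulr_ge0 // divr_ge0 ?mulr_ge0 // ltW.
have Gq t h : 0 < normc t < t0 -> rnorm h < r2 ->
    normc (G t (p + h) - G t p - 'd (G t) p h) <= 3456 * B1 / r1 ^+ 2 * rnorm h ^+ 2.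
  move=> tt hr; apply: (taylor1_le r10 (GB _ tt)); first by rewrite subrr rnorm0 divr_gt0.
  by rewrite -r2E.
have php h : p + h - p = h by rewrite addrAC subrr add0r.
have GDh t h : 0 < normc t < t0 -> rnorm h < r2 ->
    normc (G t (p + h) - 'd F (p + h) v) <= K * rnorm v ^+ 2 * normc t.
  by move=> tt hr; apply: GD => //; rewrite php; exact: lt_trans r21.
have K10 : 0 <= 3456 * B1 / r1 ^+ 2.
  by apply: divr_ge0; [exact: mulr_ge0|apply: exprn_ge0; exact: ltW].
have K20 : 0 <= K * rnorm v ^+ 2 by rewrite mulr_ge0 // exprn_ge0.
(* G at the parameter t0 / 2 bounds its limit, the derivative along v *)
have tN : normc (t0 / 2)%:C = t0 / 2 by rewrite normc_real gtr0_norm // divr_gt0.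
have T : 0 < normc (t0 / 2)%:C < t0 by rewrite tN; clear -t00; apply/andP; split; lra.
have DM h : rnorm h < r2 ->
    normc ('d F (p + h) v - 'd F p v) <= 2 * (K * rnorm v ^+ 2 * t0 + B1).
  move=> hr; have hr1 := lt_trans hr r21.
  have h0 : rnorm (0 : V) < r2 by rewrite rnorm0.
  have bd h' : rnorm h' < r2 -> normc ('d F (p + h') v) <= K * rnorm v ^+ 2 * t0 + B1.
    move=> h'r; have := GDh _ _ T h'r.
    have [] := GB _ T (p + h'); first by rewrite php; exact: lt_trans r21.
    move=> _ a b; rewrite tN in b.
    rewrite (_ : 'd F _ v = G (t0 / 2)%:C (p + h') - (G (t0 / 2)%:C (p + h') - 'd F (p + h') v)); last by ring.
    apply: le_trans (ler_normcB _ _) _; rewrite addrC; apply: lerD => //.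
    apply: le_trans b _; rewrite ler_wpM2l //; clear -t00; lra.
  have := bd _ hr; have := bd _ h0; rewrite addr0 => a b.
  apply: le_trans (ler_normcB _ _) _; clear -a b; lra.
have [L [dD dE LP]] := @uniform_limit_differentiable R V G (fun t => 'd (G t) p)
  (fun x => 'd F x v) p t0 r2 _ _ _ t00 r20 K10 K20 GDh Gq DM.
exists L; split; [exact: dD|exact: dE|] => u e e0.
have [d d0 H] := LP u e e0; exists (Num.min d t0); first by rewrite lt_min d0.
move=> t /andP[tn]; rewrite lt_min => /andP[td tt].
by rewrite -dG ?tn // H // tn.
Qed.

Lemma differentiable_bounded_holomorphic F p :
  (\forall x \near p, differentiable F x) ->
  exists r B : R, 0 < r /\ bounded_holomorphic F p r B.
Proof.
move=> dF; have Fc := differentiable_continuous (nbhs_singleton dF).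
have : \forall x \near p, normc (F x) <= normc (F p) + 1.
  have /cvgrPdist_le /(_ 1 ltr01) := Fc; apply: filterS => x.
  rewrite normcE -(rmorph1 (real_complex R)) lecR => h.
  rewrite (_ : F x = F p - (F p - F x)); last by ring.
  by apply: le_trans (ler_normcB _ _) _; rewrite lerD2l.
move=> Fb; have dFb : nbhs p (fun x => differentiable F x /\ normc (F x) <= normc (F p) + 1).
  exact: filterI dF Fb.
have /nbhs_rnormP[r r0 rP] := dFb.
by exists r, (normc (F p) + 1).
Qed.

Theorem differential_differentiable F p v :
  (\forall x \near p, differentiable F x) -> differentiable (fun x => 'd F x v) p.
Proof.
move=> /differentiable_bounded_holomorphic[r [B [r0 FB]]].
by have [L []] := differential_differentiable_ball v r0 FB.
Qed.

Theorem second_differential_sym F p u v :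
  (\forall x \near p, differentiable F x) ->
  'd (fun x => 'd F x v) p u = 'd (fun x => 'd F x u) p v.
Proof.
move=> /differentiable_bounded_holomorphic[r [B [r0 FB]]].
have [L [_ dE LP]] := differential_differentiable_ball v r0 FB.
have [L' [du _ _]] := differential_differentiable_ball u r0 FB.
apply: (etrans (congr1 (fun h : V -> C => h u) dE)).
exact: punctured_limit_unique (LP u) (differential_punctured_limit _ du).
Qed.

End Regularity.

(** * Second order calculus on row vectors *)

Section Calculus.
Variable K : numFieldType.

Lemma near_eq_is_diff (V W : normedModType K) (f g df : V -> W) (p : V) :
  (\forall x \near p, f x = g x) -> is_diff p f df -> is_diff p g df.
Proof.
move=> fg [df1 dfE]; have [dg dgE] := near_eq_diff fg df1.
by apply: DiffDef; [exact: dg|exact: etrans dgE dfE].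
Qed.

Lemma is_diff_apply (V W : normedModType K) (f df : V -> W) (p u : V) :
  is_diff p f df -> 'd f p u = df u.
Proof. by move=> [_ dfE]; exact: (congr1 (fun h : V -> W => h u) dfE). Qed.

Lemma is_diff_bigsum (V W : normedModType K) (I : Type) (r : seq I)
    (f df : I -> V -> W) (p : V) : (forall i, is_diff p (f i) (df i)) ->
  is_diff p (fun x => \sum_(i <- r) f i x) (fun u => \sum_(i <- r) df i u).
Proof.
move=> fd; elim: r => [|i r IH].
  have -> : (fun x => \sum_(i <- [::]) f i x) = cst 0.
    by apply/funext => x; rewrite big_nil.
  have -> : (fun x => \sum_(i <- [::]) df i x) = 0.
    by apply/funext => x; rewrite big_nil.
  exact: is_diff_cst.
have -> : (fun x => \sum_(i <- i :: r) f i x) = f i + (fun x => \sum_(i <- r) f i x).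
  by apply/funext => x; rewrite big_cons.
have -> : (fun x => \sum_(i <- i :: r) df i x) = df i + (fun x => \sum_(i <- r) df i x).
  by apply/funext => x; rewrite big_cons.
exact: is_diffD.
Qed.

Lemma is_diff_coord (V : normedModType K) m (f df : V -> 'rV[K]_m) (p : V) k :
  is_diff p f df -> is_diff p (fun x => f x 0 k : K) (fun u => df u 0 k : K).
Proof.
move=> fd.
have @c : {linear 'rV[K]_m -> K}.
  by exists (fun v : 'rV[K]_m => v 0 k); do 2![eexists]; do ?[constructor];
     rewrite ?mxE// => ? *; rewrite ?mxE//; move=> ?; rewrite !mxE.
have cc : continuous c by exact: coord_continuous.
have cd : is_diff (f p) c c.
  by apply: DiffDef; [exact: linear_differentiable|exact: diff_lin].
exact: (is_diff_comp fd cd).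
Qed.

Lemma is_diff_row (V : normedModType K) m (f df : V -> 'rV[K]_m) (p : V) :
  (forall k, is_diff p (fun x => f x 0 k : K) (fun u => df u 0 k : K)) ->
  is_diff p f df.
Proof.
move=> fd.
have E (g : V -> 'rV[K]_m) : g = (fun x => \sum_(k < m) g x 0 k *: delta_mx 0 k).
  by apply/funext => x; exact: row_sum_delta.
rewrite (E f) (E df); apply: is_diff_bigsum => k.
have sd := @is_diff_scalel K _ (f p 0 k) (delta_mx 0 k : 'rV[K]_m).
exact: (is_diff_comp (fd k) sd).
Qed.

Lemma is_diff_mul (V : normedModType K) (f df g dg : V -> K) (p : V) :
  is_diff p f df -> is_diff p g dg ->
  is_diff p (fun x => f x * g x) (fun u => f p * dg u + df u * g p).
Proof.
move=> fd gd; apply: (is_diff_eq (is_diffM fd gd)).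
by apply/funext => u; rewrite /= [in RHS]mulrC [df u * _]mulrC [dg u * _]mulrC.
Qed.

(** The second differential is taken one direction at a time, which avoids a norm
    on the space of linear maps. *)
Definition twice_differentiable n (W : normedModType K) (F : 'rV[K]_n -> W) p :=
  [/\ \forall x \near p, differentiable F x,
      forall v, differentiable (fun x => 'd F x v) p &
      forall u v, 'd (fun x => 'd F x v) p u = 'd (fun x => 'd F x u) p v].

Section Evaluation.
Variable n : nat.
Implicit Types p u v : 'rV[K]_n.

Lemma linear_expand (W : normedModType K) (L : {linear 'rV[K]_n -> W}) v :
  L v = \sum_(k < n) v 0 k *: L (delta_mx 0 k).
Proof.
by rewrite [in LHS](row_sum_delta v) linear_sum; apply: eq_bigr => k _; rewrite linearZ.
Qed.

(** Expanding A x on the standard basis makes the evaluation a finite sum of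
    products of scalar functions.  Its first part does not see that A varies, so it
    is recognized by comparing with the constant field of value A p. *)
Lemma is_diff_evalK (F : 'rV[K]_n -> K) (A : 'rV[K]_n -> 'rV[K]_n) p :
  (forall v, differentiable (fun x => 'd F x v) p) -> differentiable A p ->
  is_diff p (fun x => 'd F x (A x))
    (fun u => 'd (fun x => 'd F x (A p)) p u + 'd F p ('d A p u)).
Proof.
move=> Fd Ad.
have key (B : 'rV[K]_n -> 'rV[K]_n) : differentiable B p -> is_diff p (fun x => 'd F x (B x))
    (fun u => \sum_(k < n) (B p 0 k * 'd (fun x => 'd F x (delta_mx 0 k)) p u
       + 'd B p u 0 k * 'd F p (delta_mx 0 k))).
  move=> Bd.
  have -> : (fun x => 'd F x (B x)) = (fun x => \sum_(k < n) B x 0 k * 'd F x (delta_mx 0 k)).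
    by apply/funext => x; exact: linear_expand.
  apply: is_diff_bigsum => k; apply: is_diff_mul; last exact: differentiableP.
  exact: is_diff_coord (differentiableP Bd).
apply: (is_diff_eq (key A Ad)); apply/funext => u.
rewrite big_split /=; congr (_ + _); last by rewrite (linear_expand ('d F p)).
have e0 : 'd (cst (A p)) p u = 0 := is_diff_apply u (is_diff_cst (A p) p).
apply/esym; apply: (etrans (is_diff_apply u (key (cst (A p)) (differentiable_cst _ _)))).
by apply: eq_bigr => k _; rewrite e0 mxE mul0r addr0.
Qed.

End Evaluation.
End Calculus.

Section VectorEvaluation.
Variable K : numFieldType.
Variable n : nat.
Implicit Types p u v : 'rV[K]_n.

Definition hessian (W : normedModType K) (F : 'rV[K]_n -> W) p u v : W :=
  'd (fun x => 'd F x v) p u.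

Lemma hessian_coord m (F : 'rV[K]_n -> 'rV[K]_m) p u v j : twice_differentiable F p ->
  differentiable (fun x => 'd (fun y => F y 0 j : K) x v) p /\
  hessian (fun y => F y 0 j : K) p u v = hessian F p u v 0 j.
Proof.
move=> [nF dF _].
have H := is_diff_coord j (differentiableP (dF v)).
have N : \forall x \near p, ('d F x v 0 j : K) = 'd (fun y => F y 0 j : K) x v.
  apply: filterS nF => x xF; apply/esym.
  exact: is_diff_apply (is_diff_coord j (differentiableP xF)).
have G := near_eq_is_diff N H.
by split; [exact: (@ex_diff _ _ _ _ _ _ _ G)|exact: (is_diff_apply u G)].
Qed.

Lemma is_diff_eval m (F : 'rV[K]_n -> 'rV[K]_m) (A : 'rV[K]_n -> 'rV[K]_n) p :
  twice_differentiable F p -> differentiable A p ->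
  is_diff p (fun x => 'd F x (A x))
    (fun u => hessian F p u (A p) + 'd F p ('d A p u)).
Proof.
move=> tF dA; apply: is_diff_row => j.
have [nF dF _] := tF.
have N : \forall x \near p, 'd (fun y => F y 0 j : K) x (A x) = 'd F x (A x) 0 j.
  apply: filterS nF => x xF.
  exact: is_diff_apply (is_diff_coord j (differentiableP xF)).
have dFj v : differentiable (fun x => 'd (fun y => F y 0 j : K) x v) p.
  by have [] := hessian_coord 0 v j tF.
apply: (near_eq_is_diff N (is_diff_eq (is_diff_evalK dFj dA) _)); apply/funext => u; rewrite mxE; congr (_ + _).
  by have [] := hessian_coord u (A p) j tF.
exact: is_diff_apply (is_diff_coord j (differentiableP (nbhs_singleton nF))).
Qed.

Lemma twice_differentiable_row m (F : 'rV[K]_n -> 'rV[K]_m) p :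
  (forall j, twice_differentiable (fun x => F x 0 j : K) p) ->
  twice_differentiable F p.
Proof.
move=> tF.
have nF : \forall x \near p, forall j, differentiable (fun y => F y 0 j : K) x.
  have H j : nbhs p (fun x => differentiable (fun y => F y 0 j : K) x) by have [] := tF j.
  exact: (filter_forall _ H).
have dF x : (forall j, differentiable (fun y => F y 0 j : K) x) ->
    is_diff x F (fun u => \row_j 'd (fun y => F y 0 j : K) x u).
  move=> xF; apply: is_diff_row => j; apply: (is_diff_eq (differentiableP (xF j))).
  by apply/funext => u; rewrite mxE.
have ddF v : is_diff p (fun x => 'd F x v)
    (fun u => \row_j hessian (fun y => F y 0 j : K) p u v).
  apply: is_diff_row => j.
  have N : \forall x \near p, 'd (fun y => F y 0 j : K) x v = 'd F x v 0 j.
    by apply: filterS nF => x xF; rewrite (is_diff_apply v (dF _ xF)) mxE.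
  have [_ d2 _] := tF j.
  by apply: (near_eq_is_diff N (is_diff_eq (differentiableP (d2 v)) _)); apply/funext => u; rewrite mxE.
split.
- by apply: filterS nF => x /dF [].
- by move=> v; have [] := ddF v.
- move=> u v; apply: (etrans (is_diff_apply u (ddF v))); apply/esym.
  apply: (etrans (is_diff_apply v (ddF u))); apply/rowP => j; rewrite !mxE.
  by have [_ _ sF] := tF j; exact: sF.
Qed.

Definition local_bracket (a b : 'rV[K]_n -> 'rV[K]_n) x := 'd b x (a x) - 'd a x (b x).

(** Differentiating the transformation law of a field along another one produces
    the second differential of phi on the two fields, a symmetric term that the
    antisymmetrization removes. *)
Lemma local_bracket_change (phi a b a' b' : 'rV[K]_n -> 'rV[K]_n) p :
  twice_differentiable phi p ->
  differentiable a p -> differentiable b p ->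
  differentiable a' (phi p) -> differentiable b' (phi p) ->
  (\forall x \near p, 'd phi x (a x) = a' (phi x)) ->
  (\forall x \near p, 'd phi x (b x) = b' (phi x)) ->
  local_bracket a' b' (phi p) = 'd phi p (local_bracket a b p).
Proof.
move=> tphi da db da' db' aa' bb'.
have [nphi _ sphi] := tphi.
have dphi := nbhs_singleton nphi.
have key c c' u : differentiable c p -> differentiable c' (phi p) ->
    (\forall x \near p, 'd phi x (c x) = c' (phi x)) ->
    'd c' (phi p) ('d phi p u) = hessian phi p u (c p) + 'd phi p ('d c p u).
  move=> dc dc' cc'; have H := near_eq_is_diff cc' (is_diff_eval tphi dc).
  have G := is_diff_comp (differentiableP dphi) (differentiableP dc').
  apply: (etrans (esym (is_diff_apply u G))); exact: (is_diff_apply u H).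
rewrite /local_bracket -(nbhs_singleton aa') -(nbhs_singleton bb').
have eb := key b b' (a p) db db' bb'; have ea := key a a' (b p) da da' aa'.
have sy : hessian phi p (a p) (b p) = hessian phi p (b p) (a p) by exact: sphi.
have lB : 'd phi p ('d b p (a p) - 'd a p (b p))
    = 'd phi p ('d b p (a p)) - 'd phi p ('d a p (b p)) by exact: linearB.
have cancel (x y u v : 'rV[K]_n) : x = y -> (x + u) - (y + v) = u - v.
  by move=> ->; rewrite opprD addrACA subrr add0r.
apply: (etrans (congr2 (fun x y => x - y) eb ea)).
exact: (etrans (cancel _ _ _ _ sy) (esym lB)).
Qed.

End VectorEvaluation.

(** * Brackets, derivatives and divergences in one chart *)

Section LocalIdentities.
Variable K : numFieldType.
Variable n : nat.
Local Notation E := 'rV[K]_n.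
Implicit Types (p u v : E) (a b c : E -> E) (f w : E -> K).

Lemma is_diff_local_bracket a b p :
  twice_differentiable a p -> twice_differentiable b p ->
  is_diff p (local_bracket a b)
    (fun u => (hessian b p u (a p) + 'd b p ('d a p u))
            - (hessian a p u (b p) + 'd a p ('d b p u))).
Proof.
move=> ta tb; have [na _ _] := ta; have [nb _ _] := tb.
exact: is_diffB (is_diff_eval tb (nbhs_singleton na)) (is_diff_eval ta (nbhs_singleton nb)).
Qed.

(** The Jacobi identity on the jets at one point: a, b, c are the values of the
    three fields, A, B, C their differentials, hA, hB, hC their second
    differentials. *)
Let jacobi_jets (A B C : {linear E -> E}) (hA hB hC : E -> E -> E) (a b c : E) :
  hA b c = hA c b -> hB a c = hB c a -> hC a b = hC b a ->
  (hC a b + C (B a) - (hB a c + B (C a))) - A (C b - B c)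
  = (C (B a - A b) - (hB c a + B (A c) - (hA c b + A (B c))))
    + ((hC b a + C (A b) - (hA b c + A (C b))) - B (C a - A c)).
Proof.
move=> -> -> ->; rewrite !linearB; apply/rowP => j; rewrite !mxE; ring.
Qed.

Lemma local_bracket_jacobi a b c p :
  twice_differentiable a p -> twice_differentiable b p -> twice_differentiable c p ->
  local_bracket a (local_bracket b c) p
  = local_bracket (local_bracket a b) c p + local_bracket b (local_bracket a c) p.
Proof.
move=> ta tb tc.
have [_ _ sa] := ta; have [_ _ sb] := tb; have [_ _ sc] := tc.
have e1 := is_diff_apply (a p) (is_diff_local_bracket tb tc).
have e2 := is_diff_apply (c p) (is_diff_local_bracket ta tb).
have e3 := is_diff_apply (b p) (is_diff_local_bracket ta tc).
apply: (etrans (congr1 (fun x => x - 'd a p (local_bracket b c p)) e1)).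
apply: (etrans (jacobi_jets ('d a p) ('d b p) ('d c p)
  (sa (b p) (c p)) (sb (a p) (c p)) (sc (a p) (b p)))).
apply/esym; apply: (congr2 +%R).
  exact: (congr1 (fun x => 'd c p (local_bracket a b p) - x) e2).
exact: (congr1 (fun x => x - 'd b p (local_bracket a c p)) e3).
Qed.

Definition local_act a f x : K := 'd f x (a x).

Lemma is_diff_local_act a f p : twice_differentiable f p -> differentiable a p ->
  is_diff p (local_act a f) (fun u => hessian f p u (a p) + 'd f p ('d a p u)).
Proof. by move=> [_ d2 _] da; exact: is_diff_evalK. Qed.

Lemma local_act_bracket a b f p :
  twice_differentiable f p -> differentiable a p -> differentiable b p ->
  local_act (local_bracket a b) f p
  = local_act a (local_act b f) p - local_act b (local_act a f) p.
Proof.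
move=> tf da db; have [_ _ sf] := tf.
have cancel (x y u v : K) : x = y -> u - v = (x + u) - (y + v) by move=> ->; ring.
have e1 := is_diff_apply (a p) (is_diff_local_act tf db).
have e2 := is_diff_apply (b p) (is_diff_local_act tf da).
apply: (etrans (linearB ('d f p) _ _)).
apply: (etrans (cancel _ _ _ _ (sf (a p) (b p)))).
exact: (congr2 (fun x y => x - y) (esym e1) (esym e2)).
Qed.

(** The divergence for the volume form with coefficient 1. *)
Definition local_trace a x : K := \sum_(k < n) 'd a x (delta_mx 0 k) 0 k.

Definition lintrace (L : E -> E) : K := \sum_(k < n) L (delta_mx 0 k) 0 k.

Lemma lintrace_mx (L : {linear E -> E}) : lintrace L = \tr (lin1_mx L).
Proof.
by apply: eq_bigr => k _; rewrite mxE.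
Qed.

Lemma lintrace_comp (A B : {linear E -> E}) : lintrace (A \o B) = lintrace (B \o A).
Proof.
rewrite !lintrace_mx.
have M (F G : {linear E -> E}) : lin1_mx (F \o G) = lin1_mx G *m lin1_mx F.
  by apply/row_matrixP => i; rewrite row_mul !rowE !mul_rV_lin1 //= -rowE row1.
by rewrite !M mxtrace_mulC.
Qed.

Lemma is_diff_local_trace a p : twice_differentiable a p ->
  is_diff p (local_trace a) (fun u => \sum_(k < n) hessian a p u (delta_mx 0 k) 0 k).
Proof.
move=> [_ d2 _]; apply: is_diff_bigsum => k.
exact: is_diff_coord (differentiableP (d2 _)).
Qed.

(** The first order terms are the trace of a commutator, which is 0.  In the second
    order terms, symmetry brings the summation index outside, which gives the
    derivatives of the traces. *)
Lemma local_trace_bracket a b p :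
  twice_differentiable a p -> twice_differentiable b p ->
  local_trace (local_bracket a b) p
  = local_act a (local_trace b) p - local_act b (local_trace a) p.
Proof.
move=> ta tb; have [_ _ sa] := ta; have [_ _ sb] := tb.
have e k : 'd (local_bracket a b) p (delta_mx 0 k) 0 k
  = hessian b p (a p) (delta_mx 0 k) 0 k - hessian a p (b p) (delta_mx 0 k) 0 k
    + (('d b p \o 'd a p) (delta_mx 0 k) 0 k - ('d a p \o 'd b p) (delta_mx 0 k) 0 k).
  have H := is_diff_apply (delta_mx 0 k) (is_diff_local_bracket ta tb).
  apply: (etrans (congr1 (fun v : E => v 0 k) H)).
  apply: (etrans (congr2 (fun x y : E => (x + 'd b p ('d a p (delta_mx 0 k))
    - (y + 'd a p ('d b p (delta_mx 0 k)))) 0 k) (sb _ _) (sa _ _))).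
  have algebra (x y u v : E) : (x + u - (y + v)) 0 k
      = x 0 k - y 0 k + (u 0 k - v 0 k) by rewrite !mxE; ring.
  exact: algebra.
have tr0 := lintrace_comp ('d b p) ('d a p).
apply: (etrans (eq_bigr _ (fun k _ => e k))).
rewrite big_split /= sumrB [X in _ + X]sumrB.
have algebra (x y u v x' y' : K) : u = v -> x = x' -> y = y' -> x - y + (u - v) = x' - y'.
  by move=> -> -> ->; ring.
apply: (algebra _ _ _ _ _ _ tr0).
- exact: esym (is_diff_apply (a p) (is_diff_local_trace tb)).
- exact: esym (is_diff_apply (b p) (is_diff_local_trace ta)).
Qed.

Definition local_divergence w a x : K :=
  (w x)^-1 * \sum_(k < n) 'D_(delta_mx 0 k) (fun y => w y * a y 0 k) x.

Lemma local_divergenceE w a x : differentiable w x -> differentiable a x -> w x != 0 ->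
  local_divergence w a x = (w x)^-1 * local_act a w x + local_trace a x.
Proof.
move=> dw da w0.
have e k : 'D_(delta_mx 0 k) (fun y => w y * a y 0 k) x
    = w x * 'd a x (delta_mx 0 k) 0 k + a x 0 k * 'd w x (delta_mx 0 k).
  have H := is_diff_mul (differentiableP dw) (is_diff_coord k (differentiableP da)).
  apply: (etrans (deriveE _ (@ex_diff _ _ _ _ _ _ _ H))).
  apply: (etrans (is_diff_apply _ H)); congr (_ + _); exact: mulrC.
rewrite /local_divergence (eq_bigr _ (fun k _ => e k)) big_split /= -mulr_sumr mulrDr.
rewrite mulKf // addrC; congr (_ * _ + _).
by apply/esym; exact: linear_expand.
Qed.

(** The form dw / w evaluated on a; being closed, it satisfies the cocycle identity
    on its own. *)
Definition logarithmic_derivative w a x : K := (w x)^-1 * local_act a w x.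

Lemma is_diff_logarithmic_derivative w a p :
  twice_differentiable w p -> differentiable a p -> w p != 0 ->
  is_diff p (logarithmic_derivative w a)
    (fun u => (w p)^-1 * (hessian w p u (a p) + 'd w p ('d a p u))
       + (- (w p) ^- 2 * 'd w p u) * local_act a w p).
Proof.
move=> tw da w0; have [nw _ _] := tw; have dw := nbhs_singleton nw.
have iw : is_diff p (fun y => (w y)^-1) (fun u => - (w p) ^- 2 * 'd w p u).
  by apply: DiffDef; [exact: differentiableV|exact: diffV].
exact: is_diff_mul iw (is_diff_local_act tw da).
Qed.

Lemma logarithmic_derivative_bracket w a b p :
  twice_differentiable w p -> differentiable a p -> differentiable b p -> w p != 0 ->
  logarithmic_derivative w (local_bracket a b) p
  = local_act a (logarithmic_derivative w b) p
    - local_act b (logarithmic_derivative w a) p.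
Proof.
move=> tw da db w0; have [_ _ sw] := tw.
have e1 := is_diff_apply (a p) (is_diff_logarithmic_derivative tw db w0).
have e2 := is_diff_apply (b p) (is_diff_logarithmic_derivative tw da w0).
apply: (etrans (congr1 ( *%R (w p)^-1) (linearB ('d w p) _ _))).
apply/esym; apply: (etrans (congr2 (fun x y => x - y) e1 e2)).
have algebra (c d h h' x y u v : K) : h = h' ->
    (c * (h + x) + (- d * u) * v) - (c * (h' + y) + (- d * v) * u) = c * (x - y).
  by move=> ->; ring.
exact: (algebra _ _ _ _ _ _ _ _ (sw (a p) (b p))).
Qed.

Lemma is_diff_local_divergence w a p :
  twice_differentiable w p -> twice_differentiable a p -> (\forall x \near p, w x != 0) ->
  is_diff p (local_divergence w a)
    (fun u => 'd (logarithmic_derivative w a) p u + 'd (local_trace a) p u).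
Proof.
move=> tw ta w0; have [nw _ _] := tw; have [na _ _] := ta.
have N : \forall x \near p,
    logarithmic_derivative w a x + local_trace a x = local_divergence w a x.
  near=> x; apply/esym; apply: local_divergenceE; near: x.
  - exact: nw.
  - exact: na.
  - exact: w0.
apply: (near_eq_is_diff N); apply: is_diffD; apply: differentiableP.
  have H := is_diff_logarithmic_derivative tw (nbhs_singleton na) (nbhs_singleton w0).
  exact: (@ex_diff _ _ _ _ _ _ _ H).
exact: (@ex_diff _ _ _ _ _ _ _ (is_diff_local_trace ta)).
Unshelve. all: by end_near. Qed.

Lemma local_divergence_bracket w a b p :
  twice_differentiable w p -> twice_differentiable a p -> twice_differentiable b p ->
  (\forall x \near p, w x != 0) ->
  local_divergence w (local_bracket a b) p
  = local_act a (local_divergence w b) p - local_act b (local_divergence w a) p.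
Proof.
move=> tw ta tb nw0; have w0 := nbhs_singleton nw0.
have [nw _ _] := tw; have [na _ _] := ta; have [nb _ _] := tb.
have da := nbhs_singleton na; have db := nbhs_singleton nb; have dw := nbhs_singleton nw.
have dab := @ex_diff _ _ _ _ _ _ _ (is_diff_local_bracket ta tb).
rewrite (local_divergenceE dw dab w0).
have e1 := is_diff_apply (a p) (is_diff_local_divergence tw tb nw0).
have e2 := is_diff_apply (b p) (is_diff_local_divergence tw ta nw0).
apply: (etrans (congr2 +%R (logarithmic_derivative_bracket tw da db w0)
  (local_trace_bracket ta tb))).
apply/esym; apply: (etrans (congr2 (fun x y => x - y) e1 e2)).
have algebra (x y u v : K) : (x + u) - (y + v) = x - y + (u - v) by ring.
exact: algebra.
Qed.

End LocalIdentities.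

(** * The divergence under a change of coordinates *)

Section DeterminantDerivative.
Variables (K : numFieldType) (V : normedModType K).

Lemma is_diff_prod (I : eqType) (r : seq I) (f df : I -> V -> K) p : uniq r ->
  (forall i, is_diff p (f i) (df i)) ->
  is_diff p (fun x => \prod_(i <- r) f i x)
    (fun u => \sum_(k <- r) \prod_(i <- r) (if i == k then df i u else f i p)).
Proof.
move=> + fd; elim: r => [|i r IH] /=.
  move=> _.
  have -> : (fun x => \prod_(i <- [::]) f i x) = cst 1.
    by apply/funext => x; rewrite big_nil.
  have -> : (fun u => \sum_(k <- [::]) \prod_(i <- [::]) (if i == k then df i u else f i p))
      = 0 by apply/funext => x; rewrite big_nil.
  exact: is_diff_cst.
move=> /andP[ir ur].
have -> : (fun x => \prod_(j <- i :: r) f j x) = (fun x => f i x * \prod_(j <- r) f j x).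
  by apply/funext => x; rewrite big_cons.
apply: (is_diff_eq (is_diff_mul (fd i) (IH ur))); apply/funext => u.
rewrite big_cons big_cons eqxx addrC; congr (_ * _ + _).
  apply: eq_big_seq => j jr; case: eqP => // ji; by rewrite -ji jr in ir.
rewrite mulr_sumr; apply: eq_big_seq => k kr; rewrite big_cons.
by case: eqP => // ik; rewrite ik kr in ir.
Qed.

(** Jacobi's formula.  The derivative of each Leibniz term replaces one row k of M
    by that of its derivative; expanding the resulting determinants along their
    rows k gives the adjugate of M. *)
Lemma is_diff_det n (M : V -> 'M[K]_n) (dM : V -> 'M[K]_n) p :
  (forall i j, is_diff p (fun x => M x i j) (fun u => dM u i j)) ->
  is_diff p (fun x => \det (M x)) (fun u => \tr (dM u *m \adj (M p))).
Proof.
move=> Md.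
have Dd : is_diff p (fun x => \sum_(s <- index_enum 'S_n)
      (-1) ^+ s * \prod_(i <- index_enum 'I_n) M x i (s i))
    (fun u => \sum_(s <- index_enum 'S_n) (-1) ^+ s *
      \sum_(k <- index_enum 'I_n) \prod_(i <- index_enum 'I_n)
        (if i == k then dM u i (s i) else M p i (s i))).
  apply: is_diff_bigsum => s.
  have H := is_diff_prod (index_enum_uniq _) (fun i => Md i (s i)).
  apply: (is_diff_eq (is_diff_mul (is_diff_cst ((-1) ^+ s : K) p) H)).
  by apply/funext => u; rewrite /= [X in _ + X](_ : _ = 0) ?addr0 //; exact: mul0r.
apply: (is_diff_eq Dd); apply/funext => u.
transitivity (\sum_k \det (\matrix_(i, j) (if i == k then dM u i j else M p i j))).
  under [LHS]eq_bigr => s _ do rewrite mulr_sumr.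
  rewrite exchange_big /=; apply: eq_bigr => k _; apply: eq_bigr => s _.
  by congr (_ * _); apply: eq_bigr => i _; rewrite mxE.
apply: eq_bigr => k _; rewrite (expand_det_row _ k) mxE; apply: eq_bigr => j _.
rewrite !mxE eqxx; congr (_ * (_ * \det _)).
apply/matrixP => a b; rewrite !mxE; case: eqP => // e.
by have := neq_lift k a; rewrite e eqxx.
Qed.

End DeterminantDerivative.

Section ChangeOfCoordinates.
Variable K : numFieldType.
Variable n : nat.
Local Notation E := 'rV[K]_n.

(** Let J be the Jacobian matrix of phi and N the derivative of J along a.
    Differentiating the transformation law of the field gives
    tr (Da') = tr (J^-1 N) + tr (Da), and the logarithmic derivative of the law
    w = w' det J gives dw / w = dw' / w' + tr (J^-1 N).  The correction terms
    cancel in the sum of trace and logarithmic derivative. *)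
Lemma local_divergence_change (phi a a' : E -> E) (w w' : E -> K) p :
  twice_differentiable phi p ->
  differentiable a p -> differentiable a' (phi p) ->
  differentiable w p -> differentiable w' (phi p) -> w p != 0 ->
  (\forall x \near p, 'd phi x (a x) = a' (phi x)) ->
  (\forall x \near p, w' (phi x) * \det ('J phi x) = w x) ->
  local_divergence w' a' (phi p) = local_divergence w a p.
Proof.
move=> tphi da da' dw dw' w0 aa' ww'.
have [nphi d2phi sphi] := tphi; have dphi := nbhs_singleton nphi.
set J := 'J phi p.
have wE : w' (phi p) * \det J = w p := nbhs_singleton ww'.
have w'0 : w' (phi p) != 0 by apply: contraNneq w0 => e; rewrite -wE e mul0r.
have J0 : \det J != 0 by apply: contraNneq w0 => e; rewrite -wE e mulr0.
have Ju : J \in unitmx by rewrite unitmxE unitfE.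
pose N : 'M[K]_n := \matrix_(k, l) hessian phi p (delta_mx 0 k) (a p) 0 l.
pose T := lin1_mx ('d a p); pose T' := lin1_mx ('d a' (phi p)).
(* the transformation law of the field, differentiated along basis vectors *)
have JT : J *m T' = N + T *m J.
  have eJ v : v *m J = 'd phi p v by exact: mul_rV_lin1.
  have eT v : v *m T = 'd a p v by exact: mul_rV_lin1.
  have eT' v : v *m T' = 'd a' (phi p) v by exact: mul_rV_lin1.
  have L v : v *m (J *m T') = 'd a' (phi p) ('d phi p v).
    by apply: etrans (mulmxA _ _ _) _; apply: etrans (congr1 (mulmx^~ T') (eJ v)) _; exact: eT'.
  have M v : v *m (T *m J) = 'd phi p ('d a p v).
    by apply: etrans (mulmxA _ _ _) _; apply: etrans (congr1 (mulmx^~ J) (eT v)) _; exact: eJ.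
  apply/row_matrixP => k.
  have H := near_eq_is_diff aa' (is_diff_eval tphi da).
  have G := is_diff_comp (differentiableP dphi) (differentiableP da').
  apply: etrans (rowE _ _) _; apply: etrans (L _) _.
  apply: (etrans (esym (is_diff_apply _ G))).
  apply: (etrans (is_diff_apply _ H)); apply/esym.
  apply: etrans (rowE _ _) _; apply: etrans (mulmxDr _ _ _) _.
  apply: (congr2 +%R) (M _).
  by apply/rowP => l; rewrite -rowE !mxE.
have trT : \tr T' = \tr (invmx J *m N) + \tr T.
  have -> : T' = invmx J *m (N + T *m J) by rewrite -JT mulKmx.
  by rewrite mulmxDr mxtraceD; congr (_ + _); rewrite mxtrace_mulC mulmxK.
(* the transformation law of the volume form, differentiated along a *)
have dJ : is_diff p (fun x => \det ('J phi x))
    (fun u => \tr ((\matrix_(k, l) hessian phi p u (delta_mx 0 k) 0 l) *m \adj J)).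
  apply: is_diff_det => k l.
  have H := is_diff_coord l (differentiableP (d2phi (delta_mx 0 k))).
  have -> : (fun x => 'J phi x k l) = (fun x => 'd phi x (delta_mx 0 k) 0 l).
    by apply/funext => x; rewrite /jacobian mxE.
  by apply: (is_diff_eq H); apply/funext => u; rewrite mxE.
have dW := is_diff_mul (is_diff_comp (differentiableP dphi) (differentiableP dw')) dJ.
have dwE := is_diff_apply (a p) (near_eq_is_diff ww' dW).
have NE : \matrix_(k, l) hessian phi p (a p) (delta_mx 0 k) 0 l = N.
  apply/matrixP => k l; rewrite !mxE; exact: (congr1 (fun v : E => v 0 l) (sphi (a p) (delta_mx 0 k))).
have aE : 'd phi p (a p) = a' (phi p) := nbhs_singleton aa'.
rewrite (local_divergenceE dw' da' w'0) (local_divergenceE dw da w0).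
have tra : local_trace a p = \tr T by exact: lintrace_mx.
have tra' : local_trace a' (phi p) = \tr T' by exact: lintrace_mx.
have actE : local_act a w p
    = w' (phi p) * \tr (N *m \adj J) + local_act a' w' (phi p) * \det J.
  apply: (etrans dwE); apply: (congr2 +%R).
    exact: (congr1 (fun X => w' (phi p) * \tr (X *m \adj J)) NE).
  exact: (congr1 (fun v => 'd w' (phi p) v * \det J) aE).
have invE : \tr (invmx J *m N) = (\det J)^-1 * \tr (N *m \adj J).
  apply: etrans (congr1 (fun X => \tr (X *m N)) (_ : _ = (\det J)^-1 *: \adj J)) _.
    by rewrite /invmx Ju.
  by rewrite -scalemxAl mxtraceZ mxtrace_mulC.
apply: etrans (congr1 (fun t => _ + t) (etrans tra' trT)) _.
apply: etrans (addrA _ _ _) _; apply: (congr2 +%R) (esym tra).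
apply: etrans (congr1 (fun t => _ + t) invE) _; apply/esym.
apply: etrans (congr1 ( *%R (w p)^-1) actE) _.
have algebra (x t d y z : K) : y != 0 -> d != 0 -> y * d = z ->
    z^-1 * (y * t + x * d) = y^-1 * x + d^-1 * t.
  by move=> y0 d0 <-; field; rewrite y0 d0.
exact: algebra.
Qed.

End ChangeOfCoordinates.

(** * Holomorphic sections in charts *)

Section Holomorphic.
Variables (R : realType) (n : nat).
Local Notation C := R[i].

Lemma near_differentiable_twice (F : 'rV[C]_n -> C) p :
  (\forall x \near p, differentiable F x) -> twice_differentiable F p.
Proof.
move=> dF; split; first exact: dF.
- by move=> v; exact: differential_differentiable.
- by move=> u v; exact: second_differential_sym.
Qed.

Lemma near_differentiable_row_twice m (F : 'rV[C]_n -> 'rV[C]_m) p :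
  (\forall x \near p, differentiable F x) -> twice_differentiable F p.
Proof.
move=> dF; apply: twice_differentiable_row => j; apply: near_differentiable_twice.
apply: filterS dF => x /differentiableP /(is_diff_coord j) H.
exact: (@ex_diff _ _ _ _ _ _ _ H).
Qed.

End Holomorphic.

Section Charts.
Variables (R : realType) (n : nat) (M : complexManifold R n).
Local Notation C := R[i].
Implicit Types (i j : chart_index M) (p : M) (A B : fields M) (f : M -> C).

Lemma cof_coord i p : cdom (atlas i) p -> cof (atlas i) (coord i p) = p.
Proof. exact: ctoK. Qed.

Lemma inchart_coord (T : Type) i (f : M -> T) p :
  cdom (atlas i) p -> inchart i f (coord i p) = f p.
Proof. by move=> ip; rewrite /inchart /= cof_coord. Qed.

Lemma chart_atP p : cdom (atlas (chart_at p)) p.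
Proof. exact: (projT2 (cid (atlas_cover p))). Qed.

(** Local statements on M become local statements in the chart i. *)
Lemma near_coord i p (O : set M) : cdom (atlas i) p -> nbhs p O ->
  \forall z \near coord i p, exists2 q, z = coord i q &
    [/\ cof (atlas i) z = q, cdom (atlas i) q & O q].
Proof.
move=> ip pO.
have zi : ccod (atlas i) (coord i p) by exact: cto_cod.
have nc : nbhs (coord i p) (ccod (atlas i)) by apply: open_nbhs_nbhs; split => //; exact: ccod_open.
have nO : nbhs (coord i p) (cof (atlas i) @^-1` O).
  by apply: (cof_continuous zi); rewrite cof_coord.
apply: filterS2 nc nO => z zc zO; exists (cof (atlas i) z).
  by rewrite /coord cofK.
by split => //; exact: cof_dom.
Qed.

Lemma near_coordS i p (P : 'rV[C]_n -> Prop) (O : set M) :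
  cdom (atlas i) p -> nbhs p O ->
  (forall q, cdom (atlas i) q -> O q -> P (coord i q)) -> \forall z \near coord i p, P z.
Proof.
move=> ip pO OP; apply: filterS (near_coord ip pO) => z [q -> [_ iq Oq]].
exact: OP.
Qed.

Lemma transition_twice i j p : cdom (atlas i) p -> cdom (atlas j) p ->
  twice_differentiable (transition i j) (coord i p).
Proof.
move=> ip jp; apply: near_differentiable_row_twice.
have pj : nbhs p (cdom (atlas j)) by apply: open_nbhs_nbhs; split => //; exact: cdom_open.
apply: (near_coordS ip pj) => q iq jq; apply: transition_holomorphic.
  exact: cto_cod.
by rewrite cof_coord.
Qed.

Lemma transition_coord i j p : cdom (atlas i) p -> transition i j (coord i p) = coord j p.
Proof. by move=> ip; rewrite /transition /= cof_coord. Qed.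

Variable U : set M.
Hypothesis U_open : open U.

Let nbhs_U p : U p -> nbhs p U.
Proof. by move=> Up; apply: open_nbhs_nbhs; split. Qed.

Lemma function_twice f i p : holomorphic_function U f -> U p -> cdom (atlas i) p ->
  twice_differentiable (inchart i f) (coord i p).
Proof.
move=> [_ df] Up ip; apply: near_differentiable_twice.
by apply: (near_coordS ip (nbhs_U Up)) => q iq Uq; exact: df.
Qed.

Lemma field_twice A i p : holomorphic_field U A -> U p -> cdom (atlas i) p ->
  twice_differentiable (inchart i (A i)) (coord i p).
Proof.
move=> [_ dA _] Up ip; apply: near_differentiable_row_twice.
by apply: (near_coordS ip (nbhs_U Up)) => q iq Uq; exact: dA.
Qed.

Lemma field_transition A i j p : holomorphic_field U A -> U p ->
  cdom (atlas i) p -> cdom (atlas j) p ->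
  \forall z \near coord i p,
    'd (transition i j) z (inchart i (A i) z) = inchart j (A j) (transition i j z).
Proof.
move=> [_ _ tA] Up ip jp.
have pj : nbhs p (cdom (atlas j)) by apply: open_nbhs_nbhs; split => //; exact: cdom_open.
apply: (near_coordS ip (filterI (nbhs_U Up) pj)) => q iq [Uq jq].
rewrite transition_coord // !inchart_coord //; apply/esym; exact: tA.
Qed.

(** The chain rule, as the components of A transform by the differential of the
    transition. *)
Lemma field_act_chart A f i p : holomorphic_field U A -> holomorphic_function U f ->
  U p -> cdom (atlas i) p ->
  field_act A f p = local_act (inchart i (A i)) (inchart i f) (coord i p).
Proof.
move=> hA hf Up ip; have jp := chart_atP p; set j := chart_at p in jp *.
have pj : nbhs p (cdom (atlas j)) by apply: open_nbhs_nbhs; split => //; exact: cdom_open.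
have N : \forall z \near coord i p, (inchart j f \o transition i j) z = inchart i f z.
  apply: (near_coordS ip pj) => q iq jq.
  by rewrite /= transition_coord // !inchart_coord.
have [nphi _ _] := transition_twice ip jp; have dphi := nbhs_singleton nphi.
have [nf _ _] := function_twice hf Up jp.
have df : differentiable (inchart j f) (transition i j (coord i p)).
  rewrite (transition_coord _ ip); exact: nbhs_singleton nf.
have H := near_eq_is_diff N (is_diff_comp (differentiableP dphi) (differentiableP df)).
apply/esym; apply: (etrans (is_diff_apply _ H)); rewrite /= (transition_coord _ ip).
have e := nbhs_singleton (field_transition hA Up ip jp).
apply: (etrans (congr1 ('d (inchart j f) (coord j p)) e)).
by rewrite (transition_coord _ ip) inchart_coord.
Qed.

Lemma lie_bracketE A B i p : cdom (atlas i) p ->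
  lie_bracket A B i p = local_bracket (inchart i (A i)) (inchart i (B i)) (coord i p).
Proof. by move=> ip; rewrite /local_bracket !inchart_coord. Qed.

Lemma divergence_chart (Omega : volumeForm M) A i p : holomorphic_field U A ->
  U p -> cdom (atlas i) p ->
  divergence Omega U A p
    = local_divergence (inchart i (vcoef Omega i)) (inchart i (A i)) (coord i p).
Proof.
move=> hA Up ip; have jp := chart_atP p; set j := chart_at p in jp *.
have pj : nbhs p (cdom (atlas j)) by apply: open_nbhs_nbhs; split => //; exact: cdom_open.
have N : \forall z \near coord i p, inchart j (vcoef Omega j) (transition i j z)
    * \det ('J (transition i j) z) = inchart i (vcoef Omega i) z.
  apply: (near_coordS ip pj) => q iq jq.
  by rewrite transition_coord // !inchart_coord //; apply/esym; exact: vcoef_transition.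
have [_ dA _] := hA.
have dAj := dA j p Up jp; have dwj := vcoef_holomorphic Omega jp.
have w0 : inchart i (vcoef Omega i) (coord i p) != 0.
  by rewrite inchart_coord //; exact: vcoef_neq0.
rewrite -(transition_coord j ip) in dAj dwj.
have H := local_divergence_change (transition_twice ip jp) (dA i p Up ip) dAj
  (vcoef_holomorphic Omega ip) dwj w0 (field_transition hA Up ip jp) N.
apply: etrans _ H; rewrite (transition_coord j ip).
rewrite /divergence /patch (mem_set Up).
apply: (congr2 *%R) (erefl _); apply: (congr1 GRing.inv); apply/esym.
exact: inchart_coord.
Qed.

End Charts.

(** * The operations preserve holomorphy *)

Section SheafOperations.
Variables (R : realType) (n : nat) (M : complexManifold R n).
Variables (Omega : volumeForm M) (U : set M).
Hypothesis U_open : open U.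
Local Notation C := R[i].
Implicit Types (i j : chart_index M) (p : M) (A B D : fields M) (f g : M -> C).
Local Notation hfun := (holomorphic_function U).
Local Notation hfield := (holomorphic_field U).

Let nbhs_U p : U p -> nbhs p U.
Proof. by move=> Up; apply: open_nbhs_nbhs; split. Qed.

Lemma is_diff_lin (V W : normedModType C) (a b da db : V -> W) (c : C) (x : V) :
  is_diff x a da -> is_diff x b db ->
  is_diff x (fun x => c *: a x + b x) (fun u => c *: da u + db u).
Proof. by move=> ad bd; exact: is_diffD (is_diffZ c ad) bd. Qed.

Lemma diff_lin_apply (V W : normedModType C) (a b : V -> W) (c : C) (x u : V) :
  differentiable a x -> differentiable b x ->
  'd (fun y => c *: a y + b y) x u = c *: 'd a x u + 'd b x u.
Proof.
move=> da db.
exact: is_diff_apply (is_diff_lin c (differentiableP da) (differentiableP db)).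
Qed.

Lemma local_act_near (a : 'rV[C]_n -> 'rV[C]_n) (f g : 'rV[C]_n -> C) z :
  (\forall x \near z, f x = g x) -> differentiable f z ->
  local_act a g z = local_act a f z.
Proof.
move=> fg df.
exact: is_diff_apply (near_eq_is_diff fg (differentiableP df)).
Qed.

Lemma holomorphic_function_lin (c : C) f g : hfun f -> hfun g -> hfun (c *: f + g).
Proof.
move=> [f0 df] [g0 dg]; split.
  move=> p pU; rewrite -[LHS]/(c *: f p + g p) f0 // g0 // addr0; exact: mulr0.
move=> i p Up ip.
have H := is_diff_lin c (differentiableP (df i p Up ip)) (differentiableP (dg i p Up ip)).
exact: (@ex_diff _ _ _ _ _ _ _ H).
Qed.

Lemma holomorphic_field_lin (c : C) A B : hfield A -> hfield B -> hfield (c *: A + B).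
Proof.
move=> [A0 dA tA] [B0 dB tB]; split.
- move=> i p pU; rewrite -[LHS]/(c *: A i p + B i p) A0 // B0 // addr0; exact: scaler0.
- move=> i p Up ip.
  have H := is_diff_lin c (differentiableP (dA i p Up ip)) (differentiableP (dB i p Up ip)).
  exact: (@ex_diff _ _ _ _ _ _ _ H).
- move=> i j p Up ip jp.
  apply: etrans (congr2 (fun u v => c *: u + v) (tA i j p Up ip jp) (tB i j p Up ip jp)) _.
  by apply/esym; exact: linearP.
Qed.

Lemma holomorphic_function0 : hfun 0.
Proof.
split=> [p _|i p Up ip]; first exact: erefl.
exact: (differentiable_cst (0 : C)).
Qed.

Lemma holomorphic_field0 : hfield 0.
Proof.
split=> [i p _|i p Up ip|i j p Up ip jp]; first exact: erefl.
  exact: (differentiable_cst (0 : 'rV[C]_n)).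
by apply/esym; exact: linear0.
Qed.

Lemma field_act_off A f p : hfield A -> ~ U p -> field_act A f p = 0.
Proof.
move=> [A0 _ _] pU.
have e : A (chart_at p) p = 0 by apply: A0 => -[].
by apply: etrans (congr1 _ e) _; exact: linear0.
Qed.

Lemma inchart_field_act A f i p : hfield A -> hfun f -> U p -> cdom (atlas i) p ->
  \forall z \near coord i p,
    local_act (inchart i (A i)) (inchart i f) z = inchart i (field_act A f) z.
Proof.
move=> hA hf Up ip; apply: (near_coordS ip (nbhs_U Up)) => q iq Uq.
rewrite inchart_coord //; apply/esym; exact: (field_act_chart U_open hA hf).
Qed.

Lemma holomorphic_field_act A f : hfield A -> hfun f -> hfun (field_act A f).
Proof.
move=> hA hf; split=> [p pU|i p Up ip]; first exact: field_act_off.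
have [_ dA _] := hA.
have H := is_diff_local_act (function_twice U_open hf Up ip) (dA i p Up ip).
exact: (@ex_diff _ _ _ _ _ _ _ (near_eq_is_diff (inchart_field_act hA hf Up ip) H)).
Qed.

Lemma lie_bracket_off A B i p : hfield A -> hfield B -> ~ (U p /\ cdom (atlas i) p) ->
  lie_bracket A B i p = 0.
Proof.
move=> [A0 _ _] [B0 _ _] pU; rewrite /lie_bracket (A0 _ _ pU) (B0 _ _ pU).
apply: etrans (congr2 (fun u v => u - v) (linear0 _) (linear0 _)) _; exact: subrr.
Qed.

Lemma inchart_lie_bracket A B i p : U p -> cdom (atlas i) p ->
  \forall z \near coord i p,
    local_bracket (inchart i (A i)) (inchart i (B i)) z = inchart i (lie_bracket A B i) z.
Proof.
move=> Up ip; apply: (near_coordS ip (nbhs_U Up)) => q iq Uq.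
by rewrite inchart_coord //; apply/esym; exact: lie_bracketE.
Qed.

Lemma holomorphic_lie_bracket A B : hfield A -> hfield B -> hfield (lie_bracket A B).
Proof.
move=> hA hB; split=> [i p pU|i p Up ip|i j p Up ip jp].
- exact: lie_bracket_off.
- have H := is_diff_local_bracket (field_twice U_open hA Up ip) (field_twice U_open hB Up ip).
  exact: (@ex_diff _ _ _ _ _ _ _ (near_eq_is_diff (inchart_lie_bracket A B Up ip) H)).
- have [_ dA _] := hA; have [_ dB _] := hB.
  have dAj := dA j p Up jp; have dBj := dB j p Up jp.
  rewrite -(transition_coord j ip) in dAj dBj.
  have H := local_bracket_change (transition_twice ip jp) (dA i p Up ip) (dB i p Up ip)
    dAj dBj (field_transition U_open hA Up ip jp) (field_transition U_open hB Up ip jp).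
  rewrite (transition_coord j ip) in H.
  rewrite (lie_bracketE _ _ ip) (lie_bracketE _ _ jp); exact: H.
Qed.

Lemma volume_twice i p : cdom (atlas i) p ->
  twice_differentiable (inchart i (vcoef Omega i)) (coord i p).
Proof.
move=> ip; apply: near_differentiable_twice.
apply: (near_coordS ip filterT) => q iq _; exact: vcoef_holomorphic.
Qed.

Lemma volume_neq0 i p : cdom (atlas i) p ->
  \forall z \near coord i p, inchart i (vcoef Omega i) z != 0.
Proof.
move=> ip; apply: (near_coordS ip filterT) => q iq _.
by rewrite inchart_coord //; exact: vcoef_neq0.
Qed.

Lemma divergence_off A p : ~ U p -> divergence Omega U A p = 0.
Proof. by move=> pU; rewrite /divergence /patch (memNset pU). Qed.

Lemma inchart_divergence A i p : hfield A -> U p -> cdom (atlas i) p ->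
  \forall z \near coord i p,
    local_divergence (inchart i (vcoef Omega i)) (inchart i (A i)) z
    = inchart i (divergence Omega U A) z.
Proof.
move=> hA Up ip; apply: (near_coordS ip (nbhs_U Up)) => q iq Uq.
rewrite inchart_coord //; apply/esym; exact: divergence_chart.
Qed.

Lemma holomorphic_divergence A : hfield A -> hfun (divergence Omega U A).
Proof.
move=> hA; split=> [p pU|i p Up ip]; first exact: divergence_off.
have H := is_diff_local_divergence (volume_twice ip) (field_twice U_open hA Up ip)
  (volume_neq0 ip).
exact: (@ex_diff _ _ _ _ _ _ _ (near_eq_is_diff (inchart_divergence hA Up ip) H)).
Qed.

Lemma holomorphic_constant (v : C) : hfun (constant_function U v).
Proof.
split=> [p pU|i p Up ip]; first by rewrite /constant_function /patch (memNset pU).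
have N : \forall z \near coord i p, cst v z = inchart i (constant_function U v) z.
  apply: (near_coordS ip (nbhs_U Up)) => q iq Uq.
  by rewrite inchart_coord // /constant_function /patch (mem_set Uq).
have H : is_diff (coord i p) (cst v : 'rV[C]_n -> C) 0 by exact: is_diff_cst.
exact: (@ex_diff _ _ _ _ _ _ _ (near_eq_is_diff N H)).
Qed.

End SheafOperations.

(** * Identities between the operations *)

Section SheafIdentities.
Variables (R : realType) (n : nat) (M : complexManifold R n).
Variables (Omega : volumeForm M) (U : set M).
Hypothesis U_open : open U.
Local Notation C := R[i].
Implicit Types (i j : chart_index M) (p : M) (A B D : fields M) (f g : M -> C).
Local Notation hfun := (holomorphic_function U).
Local Notation hfield := (holomorphic_field U).

(** Sections vanish off their domain, so an identity between them is checked there,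
    where both sides are 0, and in the charts around the points of U. *)
Let field_eq A B : (forall i p, ~ (U p /\ cdom (atlas i) p) -> A i p = B i p) ->
  (forall i p, U p -> cdom (atlas i) p -> A i p = B i p) -> A = B.
Proof.
move=> H1 H2; apply/funext => i; apply/funext => p.
by have [[Up ip]|] := pselect (U p /\ cdom (atlas i) p); [exact: H2|exact: H1].
Qed.

Let function_eq f g : (forall p, ~ U p -> f p = g p) ->
  (forall p, U p -> f p = g p) -> f = g.
Proof.
move=> H1 H2; apply/funext => p.
by have [Up|] := pselect (U p); [exact: H2|exact: H1].
Qed.

Lemma lie_bracket_antisym A B : lie_bracket A B = - lie_bracket B A.
Proof.
apply/funext => i; apply/funext => p.
by rewrite -[RHS]/(- lie_bracket B A i p) /lie_bracket opprB.
Qed.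

Lemma lie_bracket_linr (c : C) A B D : hfield A -> hfield B -> hfield D ->
  lie_bracket D (c *: A + B) = c *: lie_bracket D A + lie_bracket D B.
Proof.
move=> hA hB hD; apply: field_eq => [i p pU|i p Up ip].
  apply: etrans (lie_bracket_off hD (holomorphic_field_lin c hA hB) pU) _; apply/esym.
  apply: etrans (congr2 (fun x y => c *: x + y) (lie_bracket_off hD hA pU)
    (lie_bracket_off hD hB pU)) _.
  by rewrite scaler0 addr0.
have [_ dA _] := hA; have [_ dB _] := hB.
have e := diff_lin_apply c (D i p) (dA i p Up ip) (dB i p Up ip).
have l := linearP ('d (inchart i (D i)) (coord i p)) c (A i p) (B i p).
have algebra (x y u v : 'rV[C]_n) : (c *: x + y) - (c *: u + v) = c *: (x - u) + (y - v).
  by rewrite scalerBr opprD addrACA.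
exact: etrans (congr2 (fun u v => u - v) e l) (algebra _ _ _ _).
Qed.

(** In a chart, [lie_bracket] is [local_bracket] near the point and not only at it,
    so it may be replaced inside a second bracket, which differentiates it. *)
Lemma lie_bracket_jacobi A B D : hfield A -> hfield B -> hfield D ->
  lie_bracket A (lie_bracket B D)
  = lie_bracket (lie_bracket A B) D + lie_bracket B (lie_bracket A D).
Proof.
move=> hA hB hD.
have hAB := holomorphic_lie_bracket U_open hA hB.
have hAD := holomorphic_lie_bracket U_open hA hD.
have hBD := holomorphic_lie_bracket U_open hB hD.
apply: field_eq => [i p pU|i p Up ip].
  apply: etrans (lie_bracket_off hA hBD pU) _; apply/esym.
  apply: etrans (congr2 +%R (lie_bracket_off hAB hD pU) (lie_bracket_off hB hAD pU)) _.
  exact: addr0.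
have tA := field_twice U_open hA Up ip; have tB := field_twice U_open hB Up ip.
have tD := field_twice U_open hD Up ip.
have key (a b b' : 'rV[C]_n -> 'rV[C]_n) z : (\forall x \near z, b x = b' x) ->
    differentiable b z -> local_bracket a b' z = local_bracket a b z.
  move=> bb' db; have e := is_diff_apply (a z) (near_eq_is_diff bb' (differentiableP db)).
  by apply: (congr2 (fun u v => u - 'd a z v)) e _; apply/esym; exact: nbhs_singleton bb'.
have anti (a b : 'rV[C]_n -> 'rV[C]_n) z : local_bracket a b z = - local_bracket b a z.
  by rewrite /local_bracket opprB.
have J := local_bracket_jacobi tA tB tD.
apply: etrans (lie_bracketE _ _ ip) _; apply/esym.
apply: etrans (congr2 +%R (lie_bracketE _ _ ip) (lie_bracketE _ _ ip)) _.
have dAB := @ex_diff _ _ _ _ _ _ _ (is_diff_local_bracket tA tB).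
have dAD := @ex_diff _ _ _ _ _ _ _ (is_diff_local_bracket tA tD).
have dBD := @ex_diff _ _ _ _ _ _ _ (is_diff_local_bracket tB tD).
have e1 := key (inchart i (A i)) _ _ _ (inchart_lie_bracket U_open B D Up ip) dBD.
have e2 := key (inchart i (D i)) _ _ _ (inchart_lie_bracket U_open A B Up ip) dAB.
have e3 := key (inchart i (B i)) _ _ _ (inchart_lie_bracket U_open A D Up ip) dAD.
apply/esym; apply: etrans e1 _; apply: etrans J _; apply/esym.
apply: (congr2 +%R) _ e3.
apply: etrans (anti _ _ _) _; apply: etrans (congr1 -%R e2) _; apply/esym; exact: anti.
Qed.

Lemma field_act_linl (c : C) A B f :
  field_act (c *: A + B) f = c *: field_act A f + field_act B f.
Proof. by apply/funext => p; exact: linearP. Qed.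

Lemma field_act_linr (c : C) A f g : hfield A -> hfun f -> hfun g ->
  field_act A (c *: f + g) = c *: field_act A f + field_act A g.
Proof.
move=> hA hf hg; apply: function_eq => [p pU|p Up].
  apply: etrans (field_act_off _ hA pU) _; apply/esym.
  apply: etrans (congr2 (fun x y : C => c * x + y) (field_act_off _ hA pU)
    (field_act_off _ hA pU)) _.
  by rewrite mulr0 addr0.
have [_ df] := hf; have [_ dg] := hg; have ip := chart_atP p.
exact: diff_lin_apply (df _ p Up ip) (dg _ p Up ip).
Qed.

Lemma field_act_lie A B f : hfield A -> hfield B -> hfun f ->
  field_act (lie_bracket A B) f
  = field_act A (field_act B f) - field_act B (field_act A f).
Proof.
move=> hA hB hf; have hAB := holomorphic_lie_bracket U_open hA hB.
have hAf := holomorphic_field_act U_open hA hf.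
have hBf := holomorphic_field_act U_open hB hf.
apply: function_eq => [p pU|p Up].
  apply: etrans (field_act_off _ hAB pU) _; apply/esym.
  apply: etrans (congr2 (fun x y => x - y) (field_act_off _ hA pU) (field_act_off _ hB pU)) _.
  exact: subrr.
have ip := chart_atP p; set i := chart_at p in ip.
have tf := function_twice U_open hf Up ip.
have [_ dA _] := hA; have [_ dB _] := hB.
have dAi := dA i p Up ip; have dBi := dB i p Up ip.
have H := local_act_bracket tf dAi dBi.
have e1 := local_act_near (inchart i (A i)) (inchart_field_act U_open hB hf Up ip)
  (@ex_diff _ _ _ _ _ _ _ (is_diff_local_act tf dBi)).
have e2 := local_act_near (inchart i (B i)) (inchart_field_act U_open hA hf Up ip)
  (@ex_diff _ _ _ _ _ _ _ (is_diff_local_act tf dAi)).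
have c1 := field_act_chart U_open hA hBf Up ip.
have c2 := field_act_chart U_open hB hAf Up ip.
have c3 := field_act_chart U_open hAB hf Up ip.
apply: etrans c3 _; apply/esym.
apply: etrans (congr2 (fun u v => u - v) (etrans c1 e1) (etrans c2 e2)) _.
apply: etrans (esym H) _.
have e := nbhs_singleton (inchart_lie_bracket U_open A B Up ip).
exact: (congr1 ('d (inchart i f) (coord i p)) e).
Qed.

Lemma field_act_constant A (v : C) : hfield A -> field_act A (constant_function U v) = 0.
Proof.
move=> hA; apply: function_eq => [p pU|p Up]; first exact: (field_act_off _ hA pU).
have ip := chart_atP p; set i := chart_at p in ip.
have pU : nbhs p U by apply: open_nbhs_nbhs; split.
have N : \forall z \near coord i p, cst v z = inchart i (constant_function U v) z.
  apply: (near_coordS ip pU) => q iq Uq.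
  by rewrite inchart_coord // /constant_function /patch (mem_set Uq).
exact: is_diff_apply (near_eq_is_diff N (is_diff_cst v _)).
Qed.

Lemma constant_function_lin (c v w : C) :
  constant_function U (c * v + w) = c *: constant_function U v + constant_function U w.
Proof.
apply/funext => p.
rewrite -[RHS]/(c * constant_function U v p + constant_function U w p).
by rewrite /constant_function /patch; case: (p \in U) => /=; rewrite ?mulr0 ?addr0.
Qed.

Lemma divergence_lin (c : C) A B : hfield A -> hfield B ->
  divergence Omega U (c *: A + B) = c *: divergence Omega U A + divergence Omega U B.
Proof.
move=> hA hB; have hAB := holomorphic_field_lin c hA hB.
apply: function_eq => [p pU|p Up].
  apply: etrans (divergence_off _ _ pU) _; apply/esym.
  apply: etrans (congr2 (fun x y : C => c * x + y) (divergence_off _ _ pU)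
    (divergence_off _ _ pU)) _.
  by rewrite mulr0 addr0.
have ip := chart_atP p; set i := chart_at p in ip.
have [_ dA _] := hA; have [_ dB _] := hB; have [_ dAB _] := hAB.
have dAi := dA i p Up ip; have dBi := dB i p Up ip; have dABi := dAB i p Up ip.
have dw := vcoef_holomorphic Omega ip.
have w0 := nbhs_singleton (volume_neq0 Omega ip).
have e (D : fields M) (hD : hfield D) :=
  etrans (divergence_chart U_open Omega hD Up ip)
  (local_divergenceE dw (let: And3 _ dD _ := hD in dD i p Up ip) w0).
apply: etrans (e _ hAB) _; apply/esym.
apply: etrans (congr2 (fun x y => c * x + y) (e _ hA) (e _ hB)) _.
have actE : local_act (inchart i ((c *: A + B) i)) (inchart i (vcoef Omega i)) (coord i p)
  = c * local_act (inchart i (A i)) (inchart i (vcoef Omega i)) (coord i p)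
    + local_act (inchart i (B i)) (inchart i (vcoef Omega i)) (coord i p).
  exact: linearP.
have trE : local_trace (inchart i ((c *: A + B) i)) (coord i p)
  = c * local_trace (inchart i (A i)) (coord i p) + local_trace (inchart i (B i)) (coord i p).
  rewrite mulr_sumr -big_split /=; apply: eq_bigr => k _.
  apply: etrans (congr1 (fun v : 'rV[C]_n => v 0 k)
    (diff_lin_apply c (delta_mx 0 k) dAi dBi)) _.
  by rewrite !mxE.
apply/esym; apply: etrans (congr2 (fun x y => _ * x + y) actE trE) _.
have algebra (z x y u v : C) : z * (c * x + y) + (c * u + v) = c * (z * x + u) + (z * y + v).
  by ring.
exact: algebra.
Qed.

Let local_divergence_near (a a' : 'rV[C]_n -> 'rV[C]_n) (w : 'rV[C]_n -> C) z :
  (\forall x \near z, a x = a' x) -> differentiable a z -> differentiable w z ->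
  w z != 0 -> local_divergence w a' z = local_divergence w a z.
Proof.
move=> aa' da dw w0; have [da' dE] := near_eq_diff aa' da.
apply: etrans (local_divergenceE dw da' w0) _; apply/esym.
apply: etrans (local_divergenceE dw da w0) _.
apply: (congr2 +%R).
  by apply: (congr1 (fun v => (w z)^-1 * 'd w z v)); exact: nbhs_singleton aa'.
apply: eq_bigr => k _.
exact: (congr1 (fun h : 'rV[C]_n -> 'rV[C]_n => h (delta_mx 0 k) 0 k) (esym dE)).
Qed.

Lemma divergence_lie A B : hfield A -> hfield B ->
  divergence Omega U (lie_bracket A B)
  = field_act A (divergence Omega U B) - field_act B (divergence Omega U A).
Proof.
move=> hA hB; have hAB := holomorphic_lie_bracket U_open hA hB.
have hdA := holomorphic_divergence Omega U_open hA.
have hdB := holomorphic_divergence Omega U_open hB.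
apply: function_eq => [p pU|p Up].
  apply: etrans (divergence_off _ _ pU) _; apply/esym.
  apply: etrans (congr2 (fun x y => x - y) (field_act_off _ hA pU) (field_act_off _ hB pU)) _.
  exact: subrr.
have ip := chart_atP p; set i := chart_at p in ip.
have tA := field_twice U_open hA Up ip; have tB := field_twice U_open hB Up ip.
have tw := volume_twice Omega ip; have nw0 := volume_neq0 Omega ip.
have H := local_divergence_bracket tw tA tB nw0.
have e1 := local_act_near (inchart i (A i)) (inchart_divergence Omega U_open hB Up ip)
  (@ex_diff _ _ _ _ _ _ _ (is_diff_local_divergence tw tB nw0)).
have e2 := local_act_near (inchart i (B i)) (inchart_divergence Omega U_open hA Up ip)
  (@ex_diff _ _ _ _ _ _ _ (is_diff_local_divergence tw tA nw0)).
have c1 := field_act_chart U_open hA hdB Up ip.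
have c2 := field_act_chart U_open hB hdA Up ip.
apply: etrans (divergence_chart U_open Omega hAB Up ip) _; apply/esym.
apply: etrans (congr2 (fun u v => u - v) (etrans c1 e1) (etrans c2 e2)) _.
apply: etrans (esym H) _.
apply/esym; apply: local_divergence_near (inchart_lie_bracket U_open A B Up ip) _ _ _.
- exact: @ex_diff _ _ _ _ _ _ _ (is_diff_local_bracket tA tB).
- exact: vcoef_holomorphic.
- exact: nbhs_singleton nw0.
Qed.

End SheafIdentities.

(** * Identities in modules by ring normalization *)

Section SquareZero.
Variables (K : fieldType) (V : lmodType K).

(** The commutative ring K + V in which the product of two vectors is 0.  Scaling a
    vector becomes a ring product, so that a linear identity between vectors with
    polynomial coefficients is an identity of commutative rings. *)
Definition square_zero : Type := (K * V)%type.

HB.instance Definition _ := GRing.Zmodule.copy square_zero (K * V)%type.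

Definition square_zero_mul (x y : square_zero) : square_zero :=
  (x.1 * y.1, x.1 *: y.2 + y.1 *: x.2).
Definition square_zero_one : square_zero := (1, 0).

Fact square_zero_mulA : associative square_zero_mul.
Proof.
move=> [a u] [b v] [c w]; congr pair => /=; first exact: mulrA.
by rewrite !scalerDr !scalerA -addrA (mulrC c a) (mulrC c b).
Qed.

Fact square_zero_mulC : commutative square_zero_mul.
Proof. by move=> [a u] [b v]; congr pair => /=; [exact: mulrC|exact: addrC]. Qed.

Fact square_zero_mul1 : left_id square_zero_one square_zero_mul.
Proof. by move=> [a u]; rewrite /square_zero_mul /= mul1r scale1r scaler0 addr0. Qed.

Fact square_zero_mulDl : left_distributive square_zero_mul +%R.
Proof.
move=> [a u] [b v] [c w]; congr pair => /=; first exact: mulrDl.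
by rewrite scalerDl scalerDr addrACA.
Qed.

Fact square_zero_one_neq0 : square_zero_one != 0.
Proof. by apply/eqP => -[] /eqP; rewrite oner_eq0. Qed.

HB.instance Definition _ := GRing.Zmodule_isComNzRing.Build square_zero
  square_zero_mulA square_zero_mulC square_zero_mul1 square_zero_mulDl square_zero_one_neq0.

Definition sz_vector (v : V) : square_zero := (0, v).
Definition sz_scalar (a : K) : square_zero := (a, 0).

Lemma sz_vector_inj : injective sz_vector. Proof. by move=> u v []. Qed.
Lemma sz_vectorD u v : sz_vector (u + v) = sz_vector u + sz_vector v.
Proof. by congr pair; rewrite /= addr0. Qed.
Lemma sz_vectorN u : sz_vector (- u) = - sz_vector u.
Proof. by congr pair; rewrite /= oppr0. Qed.
Lemma sz_vector0 : sz_vector 0 = 0. Proof. by []. Qed.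
Lemma sz_vectorZ a u : sz_vector (a *: u) = sz_scalar a * sz_vector u.
Proof. by congr pair; rewrite /= ?mulr0 // scaler0 addr0. Qed.
Lemma sz_scalarD a b : sz_scalar (a + b) = sz_scalar a + sz_scalar b.
Proof. by congr pair; rewrite /= addr0. Qed.
Lemma sz_scalarN a : sz_scalar (- a) = - sz_scalar a.
Proof. by congr pair; rewrite /= oppr0. Qed.
Lemma sz_scalarM a b : sz_scalar (a * b) = sz_scalar a * sz_scalar b.
Proof. by congr pair; rewrite /= !scaler0 addr0. Qed.
Lemma sz_scalar1 : sz_scalar 1 = 1. Proof. by []. Qed.
Lemma sz_scalar0 : sz_scalar 0 = 0. Proof. by []. Qed.

End SquareZero.

Definition square_zeroE := (sz_vectorD, sz_vectorN, sz_vector0, sz_vectorZ,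
  sz_scalarD, sz_scalarN, sz_scalarM, sz_scalar1, sz_scalar0).

Ltac module := apply: sz_vector_inj; rewrite ?square_zeroE; ring.

(** * Signs and linear maps on a subspace *)

Section Signs.
Variable K : fieldType.
Implicit Types k l : int.
Local Notation sgn := (sgn K).

Lemma sgnD k l : sgn (k + l) = sgn k * sgn l.
Proof. by rewrite /sgn expfzDr // oppr_eq0 oner_eq0. Qed.

Lemma sgn1 : sgn 1 = -1. Proof. by rewrite /sgn expr1z. Qed.

Lemma sgnN1 : sgn (-1) = -1.
Proof. by rewrite /sgn -[RHS]invrK invrN invr1 exprN1 invrN invr1. Qed.

Lemma sgn0 : sgn 0 = 1. Proof. by []. Qed.

Lemma sgnM k l : sgn (k * l) = sgn k ^ l.
Proof. by rewrite /sgn exprz_exp. Qed.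

Lemma sgnP k : sgn k = 1 \/ sgn k = -1.
Proof.
have sq n : ((-1 : K) ^+ n = 1) \/ ((-1 : K) ^+ n = -1).
  by rewrite -signr_odd; case: odd; [right|left].
case: k => n; rewrite /sgn; first exact: sq.
rewrite NegzE -exprnN; case: (sq n.+1) => ->; rewrite ?invr1; [by left|right].
by rewrite invrN invr1.
Qed.

Lemma sgn_exp l : (-1 : K) ^ l = sgn l. Proof. by []. Qed.

End Signs.

Definition sgnE := (sgnM, sgnD, sgn1, sgnN1, sgn0).

Section GradedLinear.
Variables (K : fieldType) (V : lmodType K) (P : set V) (f : V -> V).
Hypothesis P0 : P 0.
Hypothesis P_lin : forall (c : K) x y, P x -> P y -> P (c *: x + y).
Hypothesis f_lin : forall (c : K) x y, P x -> P y -> f (c *: x + y) = c *: f x + f y.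

Lemma linear_on0 : f 0 = 0.
Proof.
have := f_lin (-1) P0 P0; rewrite scaler0 addr0 => e.
by rewrite e scaleN1r addNr.
Qed.

Lemma linear_onZ c x : P x -> f (c *: x) = c *: f x.
Proof. by move=> Px; have := f_lin c Px P0; rewrite addr0 linear_on0 addr0. Qed.

Lemma linear_onD x y : P x -> P y -> f (x + y) = f x + f y.
Proof. by move=> Px Py; have := f_lin 1 Px Py; rewrite !scale1r. Qed.

Lemma linear_onN x : P x -> f (- x) = - f x.
Proof. by move=> Px; rewrite -scaleN1r linear_onZ // scaleN1r. Qed.

End GradedLinear.

(** * The Gerstenhaber bracket of a BV operator *)

Section BVtoGerstenhaber.
Variables (K : fieldType) (V : lmodType K) (F : int -> set V).
Variables (Q b : V -> V) (mul br : V -> V -> V).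
Local Notation sgn := (sgn K).
Implicit Types (k l m : int) (x y z : V).

Hypothesis dga : dg_commutative_algebra F Q mul.
Hypothesis b_graded : graded_linear F (-1) b.
Hypothesis b2 : forall k x, F k x -> b (b x) = 0.
Hypothesis bQ : forall k x, F k x -> b (Q x) + Q (b x) = 0.
Hypothesis b_order2 : second_order F b mul.
Hypothesis brE : forall k l x y, F k x -> F l y ->
  sgn k *: br x y = b (mul x y) - mul (b x) y - sgn k *: mul x (b y).

Let F0 k : F k 0. Proof. by have [] := dgca_space dga k. Qed.
Let F_lin k (c : K) x y : F k x -> F k y -> F k (c *: x + y).
Proof. by have [_ H] := dgca_space dga k; exact: H. Qed.
Let FD k x y : F k x -> F k y -> F k (x + y).
Proof. by move=> Fx Fy; rewrite -[x]scale1r; exact: F_lin. Qed.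
Let FZ k (c : K) x : F k x -> F k (c *: x).
Proof. by move=> Fx; rewrite -[_ *: _]addr0; exact: F_lin. Qed.
Let FN k x : F k x -> F k (- x).
Proof. by move=> Fx; rewrite -scaleN1r; exact: FZ. Qed.
Let mulF j k l x y : F k x -> F l y -> k + l = j -> F j (mul x y).
Proof. by move=> Fx Fy <-; have [H _ _] := dgca_mul dga; rewrite -[k + l]addr0; exact: H. Qed.
Let bF j k x : F k x -> k - 1 = j -> F j (b x).
Proof. by move=> Fx <-; have [H _] := b_graded; exact: H. Qed.
Let QF j k x : F k x -> k + 1 = j -> F j (Q x).
Proof. by move=> Fx <-; have [H _] := dgca_diff dga; exact: H. Qed.

Let sgnK k : sgn k * sgn k = 1.
Proof. by case: (sgnP K k) => ->; rewrite ?mulr1 // mulrNN mulr1. Qed.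

Let brE' k l x y : F k x -> F l y ->
  br x y = sgn k *: (b (mul x y) - mul (b x) y) - mul x (b y).
Proof.
move=> Fx Fy; rewrite -[LHS]scale1r -(sgnK k) -scalerA (brE Fx Fy).
by rewrite scalerBr scalerA sgnK scale1r.
Qed.

Let brF j k l x y : F k x -> F l y -> k + l - 1 = j -> F j (br x y).
Proof.
move=> Fx Fy <-; rewrite (brE' Fx Fy); apply: FD.
  apply: FZ; apply: FD; first by apply: (bF (mulF Fx Fy erefl)); lia.
  by apply: FN; apply: (mulF (bF Fx erefl) Fy); lia.
by apply: FN; apply: (mulF Fx (bF Fy erefl)); lia.
Qed.

(** Proves that an expression is homogeneous, of a degree equal to the given one. *)
Ltac mem := first [eassumption
  | match goal with
    | |- F _ 0 => exact: F0
    | |- F _ (_ + _) => apply: FD; mem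
    | |- F _ (- _) => apply: FN; mem
    | |- F _ (_ *: _) => apply: FZ; mem
    | |- F _ (mul _ _) => eapply mulF; [mem|mem|first [reflexivity|lia]]
    | |- F _ (br _ _) => eapply brF; [mem|mem|first [reflexivity|lia]]
    | |- F _ (b _) => eapply bF; [mem|first [reflexivity|lia]]
    | |- F _ (Q _) => eapply QF; [mem|first [reflexivity|lia]]
    end].

Let mul_linl l z : F l z -> forall k (c : K) x y, F k x -> F k y ->
  mul (c *: x + y) z = c *: mul x z + mul y z.
Proof. by move=> Fz k c x y Fx Fy; have [_ H _] := dgca_mul dga; exact: (H k l). Qed.
Let mul_linr k z : F k z -> forall l (c : K) x y, F l x -> F l y ->
  mul z (c *: x + y) = c *: mul z x + mul z y.
Proof. by move=> Fz l c x y Fx Fy; have [_ _ H] := dgca_mul dga; exact: (H k l). Qed.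
Let mulDl k l x y z : F k x -> F k y -> F l z -> mul (x + y) z = mul x z + mul y z.
Proof. by move=> Fx Fy Fz; exact: (linear_onD (mul_linl Fz (k := k))). Qed.
Let mulZl k l (c : K) x z : F k x -> F l z -> mul (c *: x) z = c *: mul x z.
Proof. by move=> Fx Fz; exact: (linear_onZ (F0 k) (mul_linl Fz (k := k))). Qed.
Let mulNl k l x z : F k x -> F l z -> mul (- x) z = - mul x z.
Proof. by move=> Fx Fz; exact: (linear_onN (F0 k) (mul_linl Fz (k := k))). Qed.
Let mulDr k l x y z : F l x -> F l y -> F k z -> mul z (x + y) = mul z x + mul z y.
Proof. by move=> Fx Fy Fz; exact: (linear_onD (mul_linr Fz (l := l))). Qed.
Let mulZr k l (c : K) x z : F l x -> F k z -> mul z (c *: x) = c *: mul z x.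
Proof. by move=> Fx Fz; exact: (linear_onZ (F0 l) (mul_linr Fz (l := l))). Qed.
Let mulNr k l x z : F l x -> F k z -> mul z (- x) = - mul z x.
Proof. by move=> Fx Fz; exact: (linear_onN (F0 l) (mul_linr Fz (l := l))). Qed.
Let mul0r' k z : F k z -> mul z 0 = 0.
Proof. by move=> Fz; exact: (linear_on0 (F0 0) (mul_linr Fz (l := 0))). Qed.
Let mul0l' k z : F k z -> mul 0 z = 0.
Proof. by move=> Fz; exact: (linear_on0 (F0 0) (mul_linl Fz (k := 0))). Qed.

Let b_lin k := (proj2 b_graded) k.
Let b0 : b 0 = 0. Proof. exact: (linear_on0 (F0 0) (b_lin (k := 0))). Qed.
Let bD k x y : F k x -> F k y -> b (x + y) = b x + b y.
Proof. exact: (linear_onD (b_lin (k := k))). Qed.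
Let bZ k c x : F k x -> b (c *: x) = c *: b x.
Proof. exact: (linear_onZ (F0 k) (b_lin (k := k))). Qed.
Let bN k x : F k x -> b (- x) = - b x.
Proof. exact: (linear_onN (F0 k) (b_lin (k := k))). Qed.

Let Q_lin k := (proj2 (dgca_diff dga)) k.
Let QD k x y : F k x -> F k y -> Q (x + y) = Q x + Q y.
Proof. exact: (linear_onD (Q_lin (k := k))). Qed.
Let QZ k c x : F k x -> Q (c *: x) = c *: Q x.
Proof. exact: (linear_onZ (F0 k) (Q_lin (k := k))). Qed.
Let QN k x : F k x -> Q (- x) = - Q x.
Proof. exact: (linear_onN (F0 k) (Q_lin (k := k))). Qed.

Let br_lin_l l z : F l z -> forall k (c : K) x y, F k x -> F k y ->
  br (c *: x + y) z = c *: br x z + br y z.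
Proof.
move=> Fz k c x y Fx Fy.
have Fxy : F k (c *: x + y) by exact: F_lin.
rewrite (brE' Fxy Fz) (brE' Fx Fz) (brE' Fy Fz).
rewrite (mul_linl Fz c Fx Fy) (b_lin c Fx Fy).
rewrite (mul_linl Fz c (bF Fx erefl) (bF Fy erefl)).
rewrite (b_lin c (mulF Fx Fz erefl) (mulF Fy Fz erefl)).
rewrite (mul_linl (bF Fz erefl) c Fx Fy).
by module.
Qed.

Let br_lin_r k z : F k z -> forall l (c : K) x y, F l x -> F l y ->
  br z (c *: x + y) = c *: br z x + br z y.
Proof.
move=> Fz l c x y Fx Fy.
have Fxy : F l (c *: x + y) by exact: F_lin.
rewrite (brE' Fz Fxy) (brE' Fz Fx) (brE' Fz Fy).
rewrite (mul_linr Fz c Fx Fy) (b_lin c Fx Fy).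
rewrite (mul_linr Fz c (bF Fx erefl) (bF Fy erefl)).
rewrite (b_lin c (mulF Fz Fx erefl) (mulF Fz Fy erefl)).
rewrite (mul_linr (bF Fz erefl) c Fx Fy).
by module.
Qed.

Let brDr k l x y z : F l x -> F l y -> F k z -> br z (x + y) = br z x + br z y.
Proof. by move=> Fx Fy Fz; exact: (linear_onD (br_lin_r Fz (l := l))). Qed.
Let brZr k l (c : K) x z : F l x -> F k z -> br z (c *: x) = c *: br z x.
Proof. by move=> Fx Fz; exact: (linear_onZ (F0 l) (br_lin_r Fz (l := l))). Qed.

Let mulC k l x y : F k x -> F l y -> mul x y = sgn (k * l) *: mul y x.
Proof. exact: (dgca_mulC dga). Qed.
Let mulA k l m x y z : F k x -> F l y -> F m z -> mul (mul x y) z = mul x (mul y z).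
Proof. exact: (dgca_mulA dga). Qed.

(** The sign of a product of degrees is not a polynomial in the signs of the
    degrees, so identities between signs are checked for each parity. *)
Ltac signs k l m :=
  let ek := fresh "ek" in let el := fresh "el" in let em := fresh "em" in
  case: (sgnP K k) => ek; case: (sgnP K l) => el; case: (sgnP K m) => em;
  rewrite ?(sgnE, ek, el, em, exp1rz, mulrN1, mulNr, mulN1r, mul1r, mulr1, opprK, sgn_exp).

Lemma bracket_antisym k l x y : F k x -> F l y ->
  br x y = - (sgn ((k - 1) * (l - 1)) *: br y x).
Proof.
move=> Fx Fy; rewrite (brE' Fx Fy) (brE' Fy Fx).
have Fxy : F (k + l) (mul y x) by mem.
rewrite (mulC Fx Fy) (bZ _ Fxy) (mulC (bF Fx erefl) Fy) (mulC Fx (bF Fy erefl)).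
by signs k l k; module.
Qed.

(** This is the second order identity with the value of b on a triple product
    eliminated; associativity and commutativity only reorder the factors. *)
Lemma bracket_leibnizr k l m x y z : F k x -> F l y -> F m z ->
  br x (mul y z) = mul (br x y) z + sgn ((k - 1) * l) *: mul y (br x z).
Proof.
move=> Fx Fy Fz; have Fyz : F (l + m) (mul y z) by mem.
rewrite (brE' Fx Fyz) (brE' Fx Fy) (brE' Fx Fz).
rewrite -(mulA Fx Fy Fz) (b_order2 Fx Fy Fz).
have Fxz : F (k + m) (mul x z) by mem.
have Fbxy : F (k + l - 1) (b (mul x y)) by mem.
have Fbxz : F (k + m - 1) (b (mul x z)) by mem.
have Fbx : F (k - 1) (b x) by mem.
have Fby : F (l - 1) (b y) by mem.
have Fbz : F (m - 1) (b z) by mem.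
have F1 : F (k + l - 1) (mul (b x) y) by mem.
have F2 : F (k + l - 1) (mul x (b y)) by mem.
have F3 : F (k + m - 1) (mul (b x) z) by mem.
have F4 : F (k + m - 1) (mul x (b z)) by mem.
have F5 : F (k + l - 1) (sgn k *: (b (mul x y) - mul (b x) y)) by mem.
have F6 : F (k + m - 1) (sgn k *: (b (mul x z) - mul (b x) z)) by mem.
have F7 : F (k + l - 1) (b (mul x y) - mul (b x) y) by mem.
have F8 : F (k + m - 1) (b (mul x z) - mul (b x) z) by mem.
rewrite (mulDl F5 (FN F2) Fz) (mulZl _ F7 Fz) (mulDl Fbxy (FN F1) Fz) (mulNl F1 Fz) (mulNl F2 Fz).
rewrite (mulDr F6 (FN F4) Fy) (mulZr _ F8 Fy) (mulDr Fbxz (FN F3) Fy) (mulNr F3 Fy) (mulNr F4 Fy).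
rewrite (mulA Fx Fy Fbz) (mulA Fx Fby Fz) (mulA Fbx Fy Fz).
have -> : mul x (mul y (b z)) = sgn (k * l) *: mul y (mul x (b z)).
  have Fyx : F (l + k) (mul y x) by mem.
  by rewrite -(mulA Fx Fy Fbz) (mulC Fx Fy) (mulZl _ Fyx Fbz) (mulA Fy Fx Fbz).
have -> : mul y (mul (b x) z) = sgn (l * (k - 1)) *: mul (b x) (mul y z).
  by rewrite -(mulA Fy Fbx Fz) (mulC Fy Fbx) (mulZl _ F1 Fz) (mulA Fbx Fy Fz).
by signs k l k; module.
Qed.

(** Antisymmetry exchanges the arguments in the rule on the right. *)
Lemma bracket_leibnizl k l m x y z : F k x -> F l y -> F m z ->
  br (mul x y) z = mul x (br y z) + sgn ((m - 1) * l) *: mul (br x z) y.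
Proof.
move=> Fx Fy Fz; have Fxy : F (k + l) (mul x y) by mem.
have Fzx : F (m + k - 1) (br z x) by mem.
have Fzy : F (m + l - 1) (br z y) by mem.
rewrite (bracket_antisym Fxy Fz) (bracket_leibnizr Fz Fx Fy).
rewrite (bracket_antisym Fy Fz) (bracket_antisym Fx Fz).
rewrite (mulNr (FZ _ Fzy) Fx) (mulZr _ Fzy Fx) (mulNl (FZ _ Fzx) Fy) (mulZl _ Fzx Fy).
by signs k l m; module.
Qed.

(** Apply b to the formula defining the bracket: as b squares to 0, the terms that
    remain are those of the brackets of b x with y and of x with b y. *)
Lemma bracket_b k l x y : F k x -> F l y ->
  b (br x y) = br (b x) y - sgn k *: br x (b y).
Proof.
move=> Fx Fy.
have Fbx : F (k - 1) (b x) by mem.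
have Fby : F (l - 1) (b y) by mem.
have F1 : F (k + l - 1) (b (mul x y)) by mem.
have F2 : F (k + l - 1) (mul (b x) y) by mem.
have F3 : F (k + l - 1) (mul x (b y)) by mem.
have F4 : F (k + l - 1) (b (mul x y) - mul (b x) y) by mem.
have F5 : F (k + l) (mul x y) by mem.
rewrite (brE' Fx Fy) (brE' Fbx Fy) (brE' Fx Fby) (b2 Fx) (b2 Fy).
rewrite (mul0l' Fy) (mul0r' Fx).
rewrite (bD (FZ _ F4) (FN F3)) (bZ _ F4) (bD F1 (FN F2)) (bN F2) (bN F3) (b2 F5).
by signs k l k; module.
Qed.

Lemma b_mul k l x y : F k x -> F l y ->
  b (mul x y) = mul (b x) y + sgn k *: mul x (b y) + sgn k *: br x y.
Proof. by move=> Fx Fy; rewrite (brE Fx Fy); module. Qed.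

Lemma eq_of_scaled_eq (c : K) x y u v : u = v -> x - y = c *: (u - v) -> x = y.
Proof. by move=> ->; rewrite subrr scaler0 => /eqP; rewrite subr_eq0 => /eqP. Qed.

(** b is a derivation of the bracket, and fails to be one of the product by exactly
    the bracket.  Compute b of the bracket of x with y z in two ways, before and
    after the Leibniz rule: all terms that contain b x, b y or b z cancel by the
    Leibniz rule again, and the rest is the Jacobi identity up to a sign. *)
Lemma bracket_jacobi k l m x y z : F k x -> F l y -> F m z ->
  br x (br y z) = br (br x y) z + sgn ((k - 1) * (l - 1)) *: br y (br x z).
Proof.
move=> Fx Fy Fz.
have Fbx : F (k - 1) (b x) by mem.
have Fby : F (l - 1) (b y) by mem.
have Fbz : F (m - 1) (b z) by mem.
have Fyz : F (l + m) (mul y z) by mem.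
have Fxy : F (k + l - 1) (br x y) by mem.
have Fxz : F (k + m - 1) (br x z) by mem.
have Fbyz : F (l + m - 1) (br y z) by mem.
have E1 := bracket_b Fx Fyz.
rewrite (bracket_leibnizr Fbx Fy Fz) (b_mul Fy Fz) in E1.
have G1 : F (l + m - 1) (mul (b y) z) by mem.
have G2 : F (l + m - 1) (mul y (b z)) by mem.
have G3 : F (l + m - 1) (mul (b y) z + sgn l *: mul y (b z)) by mem.
rewrite (brDr G3 (FZ _ Fbyz) Fx) (brZr _ Fbyz Fx) (brDr G1 (FZ _ G2) Fx) (brZr _ G2 Fx) in E1.
rewrite (bracket_leibnizr Fx Fby Fz) (bracket_leibnizr Fx Fy Fbz) in E1.
rewrite (bracket_leibnizr Fx Fy Fz) in E1.
have G4 : F (k + l + m - 1) (mul (br x y) z) by mem.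
have G5 : F (k + l + m - 1) (mul y (br x z)) by mem.
rewrite (bD G4 (FZ _ G5)) (bZ _ G5) (b_mul Fxy Fz) (b_mul Fy Fxz) in E1.
rewrite (bracket_b Fx Fy) (bracket_b Fx Fz) in E1.
have G6 : F (k + l - 1 - 1) (br (b x) y) by mem.
have G7 : F (k + l - 1 - 1) (br x (b y)) by mem.
have G8 : F (k + m - 1 - 1) (br (b x) z) by mem.
have G9 : F (k + m - 1 - 1) (br x (b z)) by mem.
rewrite (mulDl G6 (FN (FZ _ G7)) Fz) (mulNl (FZ _ G7) Fz) (mulZl _ G7 Fz) in E1.
rewrite (mulDr G8 (FN (FZ _ G9)) Fy) (mulNr (FZ _ G9) Fy) (mulZr _ G9 Fy) in E1.
apply: (eq_of_scaled_eq (c := sgn k * sgn l) E1).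
clear E1; by signs k l m; module.
Qed.

(** Q is a derivation of the product and anticommutes with b, hence with the two
    ingredients of the bracket. *)
Lemma bracket_Q k l x y : F k x -> F l y ->
  Q (br x y) = br (Q x) y + sgn (k - 1) *: br x (Q y).
Proof.
move=> Fx Fy.
have Qb j u : F j u -> Q (b u) = - b (Q u).
  by move=> Fu; have /eqP := bQ Fu; rewrite addr_eq0 => /eqP ->; rewrite opprK.
have FQx : F (k + 1) (Q x) by mem.
have FQy : F (l + 1) (Q y) by mem.
have Fbx : F (k - 1) (b x) by mem.
have Fby : F (l - 1) (b y) by mem.
have F1 : F (k + l - 1) (b (mul x y)) by mem.
have F2 : F (k + l - 1) (mul (b x) y) by mem.
have F3 : F (k + l - 1) (mul x (b y)) by mem.
have F4 : F (k + l - 1) (b (mul x y) - mul (b x) y) by mem.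
have F5 : F (k + l) (mul x y) by mem.
have F6 : F (k + l + 1) (mul (Q x) y) by mem.
have F7 : F (k + l + 1) (mul x (Q y)) by mem.
have FbQx : F k (b (Q x)) by mem.
have FbQy : F l (b (Q y)) by mem.
rewrite (brE' Fx Fy) (brE' FQx Fy) (brE' Fx FQy).
rewrite (QD (FZ _ F4) (FN F3)) (QZ _ F4) (QD F1 (FN F2)) (QN F2) (QN F3) (Qb _ _ F5).
rewrite (dgca_derivation dga Fx Fy) (dgca_derivation dga Fbx Fy) (dgca_derivation dga Fx Fby).
rewrite (bD F6 (FZ _ F7)) (bZ _ F7) (Qb _ _ Fx) (Qb _ _ Fy) (mulNl FbQx Fy) (mulNr FbQy Fx).
by signs k l k; module.
Qed.

Theorem bracket_gerstenhaber : dg_gerstenhaber_algebra F Q mul br.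
Proof.
split.
- exact: dga.
- split.
  + by move=> k l x y Fx Fy; mem.
  + by move=> k l c x y z Fx Fy Fz; exact: (br_lin_l Fz c Fx Fy).
  + by move=> k l c x y z Fx Fy Fz; exact: (br_lin_r Fx c Fy Fz).
- exact: bracket_antisym.
- exact: bracket_leibnizr.
- exact: bracket_leibnizl.
- exact: bracket_jacobi.
- exact: bracket_Q.
Qed.

End BVtoGerstenhaber.

(** The bracket as a function of b, the product and the parity operator alone, so
    that two brackets agree once these do. *)
Definition generated_bracket (V : zmodType) (b : V -> V) (mul : V -> V -> V)
    (parity : V -> V) (x y : V) : V :=
  b (mul (parity x) y) - mul (b (parity x)) y - mul x (b y).

(** * The BV algebra of a Lie algebra, a module and a cocycle *)

Section LieModuleBV.
Variables (K : fieldType) (G O : lmodType K).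
(** hG and hO single out the elements for which the laws hold, as sections of a
    sheaf among all families of functions. *)
Variables (hG : set G) (hO : set O).
Variables (lie : G -> G -> G) (act : G -> O -> O) (delta : G -> O) (kappa : K -> O).
Local Notation sgn := (sgn K).
Implicit Types (A B : G) (f g : O) (u v c : K).

Hypothesis hG0 : hG 0.
Hypothesis hG_lin : forall c A B, hG A -> hG B -> hG (c *: A + B).
Hypothesis hO0 : hO 0.
Hypothesis hO_lin : forall c f g, hO f -> hO g -> hO (c *: f + g).
Hypothesis lie_closed : forall A B, hG A -> hG B -> hG (lie A B).
Hypothesis act_closed : forall A f, hG A -> hO f -> hO (act A f).
Hypothesis delta_closed : forall A, hG A -> hO (delta A).
Hypothesis kappa_closed : forall v, hO (kappa v).
Hypothesis lie_antisym : forall A B, lie A B = - lie B A.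
Hypothesis lie_linr : forall c A B D, hG A -> hG B -> hG D ->
  lie D (c *: A + B) = c *: lie D A + lie D B.
Hypothesis lie_jacobi : forall A B D, hG A -> hG B -> hG D ->
  lie A (lie B D) = lie (lie A B) D + lie B (lie A D).
Hypothesis act_linl : forall c A B f, act (c *: A + B) f = c *: act A f + act B f.
Hypothesis act_linr : forall c A f g, hG A -> hO f -> hO g ->
  act A (c *: f + g) = c *: act A f + act A g.
Hypothesis act_lie : forall A B f, hG A -> hG B -> hO f ->
  act (lie A B) f = act A (act B f) - act B (act A f).
Hypothesis act_kappa : forall A v, hG A -> act A (kappa v) = 0.
Hypothesis kappa_lin : forall c u v, kappa (c * u + v) = c *: kappa u + kappa v.
Hypothesis delta_lin : forall c A B, hG A -> hG B ->
  delta (c *: A + B) = c *: delta A + delta B.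
Hypothesis delta_lie : forall A B, hG A -> hG B ->
  delta (lie A B) = act A (delta B) - act B (delta A).

(** The scalars of degrees 0 and 1 enter as the module K^o, so that the total space
    is a product of modules. *)
Definition lm_total : lmodType K := (K^o * (G * K^o) * (G * O) * O)%type.
Implicit Types x y z : lm_total.

Definition lm_space (k : int) : set lm_total :=
  match k with
  | Posz 0 => [set x | exists u, x = (u, 0, 0, 0)]
  | Posz 1 => [set x | exists A v, hG A /\ x = (0, (A, v), 0, 0)]
  | Posz 2 => [set x | exists A f, [/\ hG A, hO f & x = (0, 0, (A, f), 0)]]
  | Posz 3 => [set x | exists f, hO f /\ x = (0, 0, 0, f)]
  | _ => [set 0]
  end.

Definition lm_Q (x : lm_total) : lm_total :=
  let: (_, (A, v), (A', _), _) := x in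
  (0, 0, (0, kappa v - delta A), delta A').

Definition lm_mul (x1 x2 : lm_total) : lm_total :=
  let: (u1, (A1, v1), (A1', v1'), u1') := x1 in
  let: (u2, (A2, v2), (A2', v2'), u2') := x2 in
  (u1 * u2,
   (u1 *: A2 + u2 *: A1, u1 * v2 + u2 * v1),
   (u1 *: A2' + u2 *: A1' - lie A1 A2 - v1 *: A2 + v2 *: A1,
    u1 *: v2' + u2 *: v1'),
   u1 *: u2' + u2 *: u1'
   - act A1 v2' - act A2 v1' - v1 *: v2' - v2 *: v1').

Definition lm_b (x : lm_total) : lm_total :=
  let: (_, (_, v), (A', _), u') := x in (v, (- A', 0), (0, - u'), 0).

Definition lm_parity (x : lm_total) : lm_total :=
  let: (u, Av, Av', u') := x in (u, - Av, Av', - u').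

Definition lm_bracket := generated_bracket lm_b lm_mul lm_parity.

Definition deg0 u : lm_total := (u, 0, 0, 0).
Definition deg1 A v : lm_total := (0, (A, v), 0, 0).
Definition deg2 A f : lm_total := (0, 0, (A, f), 0).
Definition deg3 f : lm_total := (0, 0, 0, f).

Let hG_N A : hG A -> hG (- A).
Proof. by move=> hA; rewrite -scaleN1r -[_ *: _]addr0; exact: hG_lin. Qed.
Let hG_D A B : hG A -> hG B -> hG (A + B).
Proof. by move=> hA hB; rewrite -[A]scale1r; exact: hG_lin. Qed.
Let hG_Z c A : hG A -> hG (c *: A).
Proof. by move=> hA; rewrite -[_ *: _]addr0; exact: hG_lin. Qed.
Let hO_N f : hO f -> hO (- f).
Proof. by move=> hA; rewrite -scaleN1r -[_ *: _]addr0; exact: hO_lin. Qed.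
Let hO_D f g : hO f -> hO g -> hO (f + g).
Proof. by move=> hA hB; rewrite -[f]scale1r; exact: hO_lin. Qed.
Let hO_Z c f : hO f -> hO (c *: f).
Proof. by move=> hA; rewrite -[_ *: _]addr0; exact: hO_lin. Qed.

Let lie_linl c A B D : hG A -> hG B -> hG D ->
  lie (c *: A + B) D = c *: lie A D + lie B D.
Proof.
move=> hA hB hD; rewrite lie_antisym lie_linr // (lie_antisym A D) (lie_antisym B D).
by module.
Qed.

Let lie0r A : hG A -> lie A 0 = 0.
Proof.
move=> hA; have := lie_linr (-1) hG0 hG0 hA; rewrite scaler0 addr0 => ->.
by rewrite scaleN1r addNr.
Qed.
Let lie0l A : hG A -> lie 0 A = 0.
Proof. by move=> hA; rewrite lie_antisym lie0r // oppr0. Qed.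
Let act0r A : hG A -> act A 0 = 0.
Proof.
move=> hA; have := act_linr (-1) hA hO0 hO0; rewrite scaler0 addr0 => ->.
by rewrite scaleN1r addNr.
Qed.
Let act0l f : act 0 f = 0.
Proof.
have := act_linl (-1) 0 0 f; rewrite scaler0 addr0 => ->.
by rewrite scaleN1r addNr.
Qed.
Let delta0 : delta 0 = 0.
Proof.
have := delta_lin (-1) hG0 hG0; rewrite scaler0 addr0 => ->.
by rewrite scaleN1r addNr.
Qed.
Let kappa0 : kappa 0 = 0.
Proof.
have := kappa_lin (-1) 0 0; rewrite mulr0 addr0 => ->.
by rewrite scaleN1r addNr.
Qed.

Definition lm_admissible x : Prop :=
  let: (_, (A, _), (A', f), f') := x in [/\ hG A, hG A', hO f & hO f'].

Variant lm_homogeneous_spec (k : int) x : Prop :=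
  | LmScalar u of x = deg0 u & k = 0
  | LmDegree1 A v of x = deg1 A v & k = 1 & hG A
  | LmDegree2 A f of x = deg2 A f & k = 2 & hG A & hO f
  | LmDegree3 f of x = deg3 f & k = 3 & hO f
  | LmOutside of x = 0 & (k < 0) || (4 <= k).

Lemma lm_homogeneousP k x : lm_space k x -> lm_homogeneous_spec k x.
Proof.
case: k => [[|[|[|[|k]]]]|k] /=.
- by move=> [u ->]; exact: LmScalar.
- by move=> [A [v [hA ->]]]; apply: LmDegree1 hA.
- by move=> [A [f [hA hf ->]]]; apply: LmDegree2 hf.
- by move=> [f [hf ->]]; apply: LmDegree3 hf.
- by move=> ->; exact: LmOutside.
- by move=> ->; exact: LmOutside.
Qed.

Lemma lm_space_admissible k x : lm_space k x -> lm_admissible x.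
Proof. by case/lm_homogeneousP => [u -> _|A v -> _ hA|A f -> _ hA hf|f -> _ hf|-> _]; split. Qed.

Lemma lm_space_high k x : lm_space k x -> 4 <= k -> x = 0.
Proof. by case: k => [[|[|[|[|k]]]]|k]. Qed.

Lemma lm_space0 k : lm_space k 0.
Proof.
case: k => [[|[|[|[|k]]]]|k] //=.
- by exists 0.
- by exists 0, 0.
- by exists 0, 0.
- by exists 0.
Qed.

Let scaleK c (u : K^o) : c *: u = c * u. Proof. by []. Qed.

Lemma lm_eqP x y : x.1.1.1 = y.1.1.1 -> x.1.1.2.1 = y.1.1.2.1 ->
  x.1.1.2.2 = y.1.1.2.2 -> x.1.2.1 = y.1.2.1 -> x.1.2.2 = y.1.2.2 -> x.2 = y.2 -> x = y.
Proof.
by move: x y => [[[u [A v]] [A' f]] f'] [[[u1 [A1 v1]] [A1' f1]] f1'] /= -> -> -> -> -> ->.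
Qed.

Lemma lm_mul_linl c x y z : lm_admissible x -> lm_admissible y -> lm_admissible z ->
  lm_mul (c *: x + y) z = c *: lm_mul x z + lm_mul y z.
Proof.
move: x y z => [[[u1 [A1 v1]] [B1 f1]] g1] [[[u2 [A2 v2]] [B2 f2]] g2].
move=> [[[u3 [A3 v3]] [B3 f3]] g3] [hA1 hB1 hf1 hg1] [hA2 hB2 hf2 hg2] [hA3 hB3 hf3 hg3].
apply: lm_eqP; rewrite /lm_mul /= ?scaleK.
- by ring.
- by module.
- by ring.
- by rewrite lie_linl //; module.
- by module.
- by rewrite act_linl act_linr //; module.
Qed.

Lemma lm_mul_linr c x y z : lm_admissible x -> lm_admissible y -> lm_admissible z ->
  lm_mul z (c *: x + y) = c *: lm_mul z x + lm_mul z y.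
Proof.
move: x y z => [[[u1 [A1 v1]] [B1 f1]] g1] [[[u2 [A2 v2]] [B2 f2]] g2].
move=> [[[u3 [A3 v3]] [B3 f3]] g3] [hA1 hB1 hf1 hg1] [hA2 hB2 hf2 hg2] [hA3 hB3 hf3 hg3].
apply: lm_eqP; rewrite /lm_mul /= ?scaleK.
- by ring.
- by module.
- by ring.
- by rewrite lie_linr //; module.
- by module.
- by rewrite act_linl act_linr //; module.
Qed.

Lemma lm_b_lin c x y : lm_b (c *: x + y) = c *: lm_b x + lm_b y.
Proof.
move: x y => [[[u1 [A1 v1]] [B1 f1]] g1] [[[u2 [A2 v2]] [B2 f2]] g2].
by apply: lm_eqP; rewrite /lm_b /= ?scaleK ?mulr0 ?addr0 ?scaler0 ?addr0 //; module.
Qed.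

Lemma lm_b2 x : lm_b (lm_b x) = 0.
Proof.
move: x => [[[u1 [A1 v1]] [B1 f1]] g1].
by apply: lm_eqP; rewrite /lm_b /= ?oppr0.
Qed.

Lemma lm_Q_lin c x y : lm_admissible x -> lm_admissible y ->
  lm_Q (c *: x + y) = c *: lm_Q x + lm_Q y.
Proof.
move: x y => [[[u1 [A1 v1]] [B1 f1]] g1] [[[u2 [A2 v2]] [B2 f2]] g2].
move=> [hA1 hB1 hf1 hg1] [hA2 hB2 hf2 hg2].
apply: lm_eqP; rewrite /lm_Q /= ?scaleK.
- by rewrite mulr0 addr0.
- by module.
- by rewrite mulr0 addr0.
- by module.
- by rewrite kappa_lin delta_lin //; module.
- by rewrite delta_lin.
Qed.

Lemma lm_space_lin k c x y : lm_space k x -> lm_space k y -> lm_space k (c *: x + y).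
Proof.
case: k => [[|[|[|[|k]]]]|k] /=.
- move=> [u ->] [v ->]; exists (c * u + v).
  by apply: lm_eqP; rewrite /= ?scaleK ?mulr0 ?scaler0 ?addr0.
- move=> [A [u [hA ->]]] [B [v [hB ->]]]; exists (c *: A + B), (c * u + v).
  by split; [exact: hG_lin|apply: lm_eqP; rewrite /= ?scaleK ?mulr0 ?scaler0 ?addr0].
- move=> [A [f [hA hf ->]]] [B [g [hB hg ->]]]; exists (c *: A + B), (c *: f + g).
  split; [exact: hG_lin|exact: hO_lin|].
  by apply: lm_eqP; rewrite /= ?scaleK ?mulr0 ?scaler0 ?addr0.
- move=> [f [hf ->]] [g [hg ->]]; exists (c *: f + g).
  by split; [exact: hO_lin|apply: lm_eqP; rewrite /= ?scaleK ?mulr0 ?scaler0 ?addr0].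
- by move=> -> ->; rewrite scaler0 addr0.
- by move=> -> ->; rewrite scaler0 addr0.
Qed.

Lemma lm_space_graded : graded_space lm_space.
Proof.
move=> k; split; first exact: lm_space0.
by move=> c x y; exact: lm_space_lin.
Qed.

Lemma lm_mul_deg0l u x : lm_admissible x -> lm_mul (deg0 u) x = u *: x.
Proof.
move: x => [[[u1 [A1 v1]] [B1 f1]] g1] [hA hB hf hg].
apply: lm_eqP; rewrite /lm_mul /= ?scaleK.
- by [].
- by module.
- by rewrite mulr0 addr0.
- by rewrite lie0l //; module.
- by module.
- by rewrite act0l act0r //; module.
Qed.

Lemma lm_mul_deg0r u x : lm_admissible x -> lm_mul x (deg0 u) = u *: x.
Proof.
move: x => [[[u1 [A1 v1]] [B1 f1]] g1] [hA hB hf hg].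
apply: lm_eqP; rewrite /lm_mul /= ?scaleK.
- by rewrite mulrC.
- by module.
- by rewrite mulr0 add0r.
- by rewrite lie0r //; module.
- by module.
- by rewrite act0l act0r //; module.
Qed.

Lemma lm_mul_deg11 A u B v : hG A -> hG B ->
  lm_mul (deg1 A u) (deg1 B v) = deg2 (- lie A B - u *: B + v *: A) 0.
Proof.
move=> hA hB; apply: lm_eqP; rewrite /lm_mul /=.
- by ring.
- by module.
- by ring.
- by module.
- by module.
- by rewrite !act0r //; module.
Qed.

Lemma lm_mul_deg12 A u B f : hG A -> hG B -> hO f ->
  lm_mul (deg1 A u) (deg2 B f) = deg3 (- act A f - u *: f).
Proof.
move=> hA hB hf; apply: lm_eqP; rewrite /lm_mul /=.
- by ring.
- by module.
- by ring.
- by rewrite lie0r //; module.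
- by module.
- by rewrite act0l; module.
Qed.

Lemma lm_mul_deg21 A u B f : hG A -> hG B -> hO f ->
  lm_mul (deg2 B f) (deg1 A u) = deg3 (- act A f - u *: f).
Proof.
move=> hA hB hf; apply: lm_eqP; rewrite /lm_mul /=.
- by ring.
- by module.
- by ring.
- by rewrite lie0l //; module.
- by module.
- by rewrite act0l; module.
Qed.

Lemma lm_mul_high k l x y : lm_space k x -> lm_space l y -> 0 < k -> 0 < l ->
  4 <= k + l -> lm_mul x y = 0.
Proof.
have Z (A B : G) (f g f' g' : O) : hG A -> hG B ->
    lm_mul (0, 0, (A, f), f') (0, 0, (B, g), g') = 0.
  move=> hA hB; apply: lm_eqP; rewrite /lm_mul /=; first [by ring|by module|idtac].
    by rewrite lie0r //; module.
  by rewrite !act0l; module.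
have Z13 A v f : hG A -> lm_mul (deg1 A v) (deg3 f) = 0.
  move=> hA; apply: lm_eqP; rewrite /lm_mul /=; first [by ring|by module|idtac].
    by rewrite lie0r //; module.
  by rewrite act0l act0r //; module.
have Z31 A v f : hG A -> lm_mul (deg3 f) (deg1 A v) = 0.
  move=> hA; apply: lm_eqP; rewrite /lm_mul /=; first [by ring|by module|idtac].
    by rewrite lie0l //; module.
  by rewrite act0l act0r //; module.
move=> Fx Fy; have hx := lm_space_admissible Fx; have hy := lm_space_admissible Fy.
have O0 : deg0 0 = 0 by [].
case: (lm_homogeneousP Fy) hy => [u' -> ->|A' v' -> -> hA'|A' f' -> -> hA' hf'|f' -> -> hf'|-> _] hy;
  last (by rewrite -O0 lm_mul_deg0r // scale0r).
all: case: (lm_homogeneousP Fx) hx => [u -> ->|A v -> -> hA|A f -> -> hA hf|f -> -> hf|-> _] hx //;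
  try (by rewrite -O0 lm_mul_deg0l // scale0r).
all: move=> _ _ _.
- exact: Z31.
- exact: Z.
- exact: Z.
- exact: Z13.
- exact: Z.
- exact: Z.
Qed.

Let lm_deg0 u : lm_space 0 (deg0 u). Proof. by exists u. Qed.
Let lm_deg1 A v : hG A -> lm_space 1 (deg1 A v). Proof. by move=> hA; exists A, v. Qed.
Let lm_deg2 A f : hG A -> hO f -> lm_space 2 (deg2 A f).
Proof. by move=> hA hf; exists A, f. Qed.
Let lm_deg3 f : hO f -> lm_space 3 (deg3 f). Proof. by move=> hf; exists f. Qed.

Let lm_scale k c x : lm_space k x -> lm_space k (c *: x).
Proof. by move=> Fx; rewrite -[_ *: _]addr0; apply: lm_space_lin => //; exact: lm_space0. Qed.

Lemma lm_b_deg0 u : lm_b (deg0 u) = 0.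
Proof. by apply: lm_eqP; rewrite /= ?oppr0. Qed.
Lemma lm_b_deg1 A v : lm_b (deg1 A v) = deg0 v.
Proof. by apply: lm_eqP; rewrite /= ?oppr0. Qed.
Lemma lm_b_deg2 A f : lm_b (deg2 A f) = deg1 (- A) 0.
Proof. by apply: lm_eqP; rewrite /= ?oppr0. Qed.
Lemma lm_b_deg3 f : lm_b (deg3 f) = deg2 0 (- f).
Proof. by apply: lm_eqP; rewrite /= ?oppr0. Qed.

Lemma lm_Q_deg0 u : lm_Q (deg0 u) = 0.
Proof. by apply: lm_eqP; rewrite /= ?kappa0 ?delta0 ?subr0. Qed.
Lemma lm_Q_deg1 A v : lm_Q (deg1 A v) = deg2 0 (kappa v - delta A).
Proof. by apply: lm_eqP; rewrite /= ?delta0. Qed.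
Lemma lm_Q_deg2 A f : lm_Q (deg2 A f) = deg3 (delta A).
Proof. by apply: lm_eqP; rewrite /= ?kappa0 ?delta0 ?subr0. Qed.
Lemma lm_Q_deg3 f : lm_Q (deg3 f) = 0.
Proof. by apply: lm_eqP; rewrite /= ?kappa0 ?delta0 ?subr0. Qed.

Lemma lm_scale_deg2 c A f : c *: deg2 A f = deg2 (c *: A) (c *: f).
Proof. by apply: lm_eqP; rewrite /= ?scaleK ?mulr0 ?scaler0. Qed.

Lemma lm_b_graded : graded_linear lm_space (-1) lm_b.
Proof.
split; last by move=> k c x y _ _; exact: lm_b_lin.
move=> k x /lm_homogeneousP[u -> _|A v -> -> hA|A f -> -> hA hf|f -> -> hf|-> _].
- by rewrite lm_b_deg0; exact: lm_space0.
- by rewrite lm_b_deg1; exact: lm_deg0.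
- by rewrite lm_b_deg2; apply: lm_deg1; exact: hG_N.
- by rewrite lm_b_deg3; apply: lm_deg2 => //; exact: hO_N.
- by rewrite -[0]/(deg0 0) lm_b_deg0; exact: lm_space0.
Qed.

Lemma lm_Q_graded : graded_linear lm_space 1 lm_Q.
Proof.
split; last first.
  move=> k c x y /lm_space_admissible hx /lm_space_admissible hy; exact: lm_Q_lin.
move=> k x /lm_homogeneousP[u -> _|A v -> -> hA|A f -> -> hA hf|f -> -> hf|-> _].
- by rewrite lm_Q_deg0; exact: lm_space0.
- rewrite lm_Q_deg1; apply: lm_deg2 => //; apply: hO_D; first exact: kappa_closed.
  by apply: hO_N; exact: delta_closed.
- by rewrite lm_Q_deg2; apply: lm_deg3; exact: delta_closed.
- by rewrite lm_Q_deg3; exact: lm_space0.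
- by rewrite -[0]/(deg0 0) lm_Q_deg0; exact: lm_space0.
Qed.

(** In negative degrees the only element is 0, which is counted among the scalars:
    products with such an element are then known without any case analysis. *)
Lemma lm_scalar_or_positive k x : lm_space k x ->
  (exists u, x = deg0 u /\ (k = 0 \/ u = 0)) \/ 0 < k.
Proof.
case/lm_homogeneousP => [u -> ku|A v _ ->|A f _ ->|f _ ->|-> /orP[k0|k4]].
- by left; exists u; split; [|left].
- by right.
- by right.
- by right.
- by left; exists 0; split; [|right].
- by right; lia.
Qed.

Variant lm_positive_spec (k l : int) x y : Prop :=
  | LmPositive11 A u B v of x = deg1 A u & y = deg1 B v & k = 1 & l = 1 & hG A & hG B
  | LmPositive12 A u B f of x = deg1 A u & y = deg2 B f & k = 1 & l = 2 & hG A & hG B & hO f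
  | LmPositive21 A u B f of x = deg2 B f & y = deg1 A u & k = 2 & l = 1 & hG A & hG B & hO f.

Lemma lm_positiveP k l x y : lm_space k x -> lm_space l y -> 0 < k -> 0 < l ->
  k + l < 4 -> lm_positive_spec k l x y.
Proof.
case/lm_homogeneousP => [u xE ->|A u xE -> hA|A f xE -> hA hf|f xE -> hf|xE /orP[xk|xk]];
case/lm_homogeneousP => [v yE ->|B v yE -> hB|B g yE -> hB hg|g yE -> hg|yE /orP[yk|yk]];
  try (by move=> *; exfalso; lia).
- by move=> _ _ _; exact: (LmPositive11 xE yE).
- by move=> _ _ _; exact: (LmPositive12 xE yE).
- by move=> _ _ _; exact: (LmPositive21 xE yE).
Qed.

Lemma lm_mul_degree k l x y : lm_space k x -> lm_space l y -> lm_space (k + l) (lm_mul x y).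
Proof.
move=> Fx Fy.
have hx := lm_space_admissible Fx; have hy := lm_space_admissible Fy.
have [[u [xE ku]]|k0] := lm_scalar_or_positive Fx.
  subst; rewrite lm_mul_deg0l //; case: ku => ->; first by rewrite add0r; exact: lm_scale.
  by rewrite scale0r; exact: lm_space0.
have [[u [yE lu]]|l0] := lm_scalar_or_positive Fy.
  subst; rewrite lm_mul_deg0r //; case: lu => ->; first by rewrite addr0; exact: lm_scale.
  by rewrite scale0r; exact: lm_space0.
have [h|h] := lerP 4 (k + l); first by rewrite (lm_mul_high Fx Fy) //; exact: lm_space0.
case: (lm_positiveP Fx Fy k0 l0 h) => [A u B v xE yE kE lE hA hB
  |A u B f xE yE kE lE hA hB hf|A u B f xE yE kE lE hA hB hf]; subst.
- rewrite lm_mul_deg11 //; apply: lm_deg2 => //.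
  by apply: hG_D; [apply: hG_D; apply: hG_N; [exact: lie_closed|exact: hG_Z]|exact: hG_Z].
- rewrite lm_mul_deg12 //; apply: lm_deg3; apply: hO_D; apply: hO_N; [exact: act_closed|exact: hO_Z].
- rewrite lm_mul_deg21 //; apply: lm_deg3; apply: hO_D; apply: hO_N; [exact: act_closed|exact: hO_Z].
Qed.

Lemma lm_mul_graded : graded_bilinear lm_space 0 lm_mul.
Proof.
split.
- by move=> k l x y Fx Fy; rewrite addr0; exact: lm_mul_degree.
- move=> k l c x y z /lm_space_admissible hx /lm_space_admissible hy /lm_space_admissible hz.
  exact: lm_mul_linl.
- move=> k l c x y z /lm_space_admissible hx /lm_space_admissible hy /lm_space_admissible hz.
  exact: lm_mul_linr.
Qed.

Let mulZl k l c x y : lm_space k x -> lm_space l y -> lm_mul (c *: x) y = c *: lm_mul x y.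
Proof.
move=> Fx Fy; have [_ H _] := lm_mul_graded.
exact: (@linear_onZ K lm_total (lm_space k) (lm_mul^~ y) (lm_space0 k)
  (fun c' x1 x2 F1 F2 => H k l c' x1 x2 y F1 F2 Fy) c x Fx).
Qed.
Let mulZr k l c x y : lm_space k x -> lm_space l y -> lm_mul x (c *: y) = c *: lm_mul x y.
Proof.
move=> Fx Fy; have [_ _ H] := lm_mul_graded.
exact: (@linear_onZ K lm_total (lm_space l) (lm_mul x) (lm_space0 l)
  (fun c' y1 y2 F1 F2 => H k l c' x y1 y2 Fx F1 F2) c y Fy).
Qed.
Let bZ c x : lm_b (c *: x) = c *: lm_b x.
Proof.
exact: (@linear_onZ K lm_total setT lm_b I (fun c' x1 x2 _ _ => lm_b_lin c' x1 x2) c x I).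
Qed.
Let QZ k c x : lm_space k x -> lm_Q (c *: x) = c *: lm_Q x.
Proof.
move=> Fx; have [_ H] := lm_Q_graded.
exact: (@linear_onZ K lm_total (lm_space k) lm_Q (lm_space0 k) (H k) c x Fx).
Qed.
Let mul_sl k u x : lm_space k x -> lm_mul (deg0 u) x = u *: x.
Proof. by move/lm_space_admissible; exact: lm_mul_deg0l. Qed.
Let mul_sr k u x : lm_space k x -> lm_mul x (deg0 u) = u *: x.
Proof. by move/lm_space_admissible; exact: lm_mul_deg0r. Qed.
Let mul0 k x : lm_space k x -> lm_mul 0 x = 0.
Proof. by move=> Fx; rewrite (mul_sl 0 Fx) scale0r. Qed.
Let mulr0' k x : lm_space k x -> lm_mul x 0 = 0.
Proof. by move=> Fx; rewrite (mul_sr 0 Fx) scale0r. Qed.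

Let sgn2 : sgn 2 = 1. Proof. by rewrite /sgn -exprnP sqrrN expr1n. Qed.

Lemma lm_mulC k l x y : lm_space k x -> lm_space l y ->
  lm_mul x y = sgn (k * l) *: lm_mul y x.
Proof.
move=> Fx Fy.
have [[u [-> [->|->]]]|k0] := lm_scalar_or_positive Fx.
- by rewrite mul0r sgn0 scale1r (mul_sl u Fy) (mul_sr u Fy).
- by rewrite (mul_sl 0 Fy) (mul_sr 0 Fy) scale0r scaler0.
have [[u [-> [->|->]]]|l0] := lm_scalar_or_positive Fy.
- by rewrite mulr0 sgn0 scale1r (mul_sl u Fx) (mul_sr u Fx).
- by rewrite (mul_sl 0 Fx) (mul_sr 0 Fx) scale0r scaler0.
have [kl|kl] := lerP 4 (k + l).
  by rewrite (lm_mul_high Fx Fy) // (lm_mul_high Fy Fx) ?scaler0 // addrC.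
case: (lm_positiveP Fx Fy k0 l0 kl) => [A u B v xE yE kE lE hA hB
  |A u B f xE yE kE lE hA hB hf|A u B f xE yE kE lE hA hB hf]; subst.
- rewrite !lm_mul_deg11 // mulr1 sgn1 scaleN1r (lie_antisym B A).
  by apply: lm_eqP; rewrite /= ?oppr0 ?opprK //; module.
- by rewrite lm_mul_deg12 // lm_mul_deg21 // mul1r sgn2 scale1r.
- by rewrite lm_mul_deg12 // lm_mul_deg21 // mulr1 sgn2 scale1r.
Qed.

(** Only degrees (1, 1, 1) are left.  There both sides are 0, because a product of
    two elements of degree 1 has no component in O, the only component on which an
    element of degree 1 acts. *)
Lemma lm_mulA k l m x y z : lm_space k x -> lm_space l y -> lm_space m z ->
  lm_mul (lm_mul x y) z = lm_mul x (lm_mul y z).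
Proof.
move=> Fx Fy Fz.
have Fxy := lm_mul_degree Fx Fy; have Fyz := lm_mul_degree Fy Fz.
have Fxyz := lm_mul_degree Fxy Fz; have Fxyz' := lm_mul_degree Fx Fyz.
have [[u [xE _]]|k0] := lm_scalar_or_positive Fx.
  by subst; rewrite (mul_sl u Fy) (mul_sl u Fyz) (mulZl u Fy Fz).
have [[u [yE _]]|l0] := lm_scalar_or_positive Fy.
  by subst; rewrite (mul_sr u Fx) (mul_sl u Fz) (mulZl u Fx Fz) (mulZr u Fx Fz).
have [[u [zE _]]|m0] := lm_scalar_or_positive Fz.
  by subst; rewrite (mul_sr u Fxy) (mul_sr u Fy) (mulZr u Fx Fy).
have [h|h] := lerP 4 (k + l + m).
  by rewrite (lm_space_high Fxyz h) (lm_space_high Fxyz') // addrA.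
have kl : k + l < 4 by lia.
have lm : l + m < 4 by lia.
case: (lm_positiveP Fx Fy k0 l0 kl) Fz => [A u B v xE yE kE lE hA hB
  |A u B f xE yE kE lE hA hB hf|A u B f xE yE kE lE hA hB hf] Fz; last 2 first.
- by subst; exfalso; lia.
- by subst; exfalso; lia.
case: (lm_positiveP Fy Fz l0 m0 lm) => [B' v' D w yE' zE _ mE hB' hD
  |B' v' D f yE' zE lE' mE hB' hD hf|D w B' f yE' zE lE' mE hB' hD hf]; last 2 first.
- by subst; exfalso; lia.
- by subst; exfalso; lia.
subst; rewrite !lm_mul_deg11 // lm_mul_deg12 ?lm_mul_deg21 //.
- by apply: lm_eqP; rewrite /= ?act0r //; module.
- by do ?[apply: hG_D | apply: hG_N | apply: hG_Z | apply: lie_closed].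
- by do ?[apply: hG_D | apply: hG_N | apply: hG_Z | apply: lie_closed].
Qed.

(** In degrees (1, 1) the identity compares delta of - [A, B] - u B + v A with the
    actions of A and B on kappa v - delta B and kappa u - delta A: this is the
    cocycle identity, once the invariants kappa are killed. *)
Lemma lm_derivation k l x y : lm_space k x -> lm_space l y ->
  lm_Q (lm_mul x y) = lm_mul (lm_Q x) y + sgn k *: lm_mul x (lm_Q y).
Proof.
move=> Fx Fy; have [QF _] := lm_Q_graded.
have FQx := QF _ _ Fx; have FQy := QF _ _ Fy.
have [[u [xE ku]]|k0] := lm_scalar_or_positive Fx.
  subst; rewrite (mul_sl u Fy) (mul_sl u FQy) lm_Q_deg0 (mul0 Fy) add0r (QZ u Fy).
  by case: ku => ->; rewrite ?sgn0 ?scale1r // !scale0r scaler0.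
have [[u [yE lu]]|l0] := lm_scalar_or_positive Fy.
  by subst; rewrite (mul_sr u Fx) (mul_sr u FQx) lm_Q_deg0 (mulr0' Fx) scaler0 addr0 (QZ u Fx).
have F1 := QF _ _ (lm_mul_degree Fx Fy).
have F2 := lm_mul_degree FQx Fy; have F3 := lm_mul_degree Fx FQy.
have [h|h] := lerP 3 (k + l).
  rewrite (lm_space_high F1) ?(lm_space_high F2) ?(lm_space_high F3) ?scaler0 ?addr0 //; lia.
have kl : k + l < 4 by lia.
case: (lm_positiveP Fx Fy k0 l0 kl) => [A u B v xE yE kE lE hA hB
  |A u B f xE yE kE lE hA hB hf|A u B f xE yE kE lE hA hB hf]; last 2 first.
- by subst; exfalso; lia.
- by subst; exfalso; lia.
have hk A' v' : hG A' -> hO (kappa v' - delta A').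
  by move=> hA'; apply: hO_D; [exact: kappa_closed|apply: hO_N; exact: delta_closed].
have actk A' B' v' : hG A' -> hG B' -> act A' (kappa v' - delta B') = - act A' (delta B').
  move=> hA' hB'; have e := act_linr (-1) hA' (delta_closed hB') (kappa_closed v').
  by rewrite addrC -[- delta B']scaleN1r e act_kappa // addr0 scaleN1r.
have dW : delta (- lie A B - u *: B + v *: A)
    = - (act A (delta B) - act B (delta A)) - u *: delta B + v *: delta A.
  have hL := lie_closed hA hB.
  have -> : - lie A B - u *: B + v *: A = (-1) *: lie A B + ((- u) *: B + (v *: A + 0)).
    by module.
  have h1 : hG (v *: A + 0) by exact: hG_lin.
  have h2 : hG ((- u) *: B + (v *: A + 0)) by exact: hG_lin.
  by rewrite !delta_lin // delta0 delta_lie //; module.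
subst; rewrite lm_mul_deg11 // lm_Q_deg2 !lm_Q_deg1 lm_mul_deg12 ?lm_mul_deg21 //; last 2 first.
- exact: hk.
- exact: hk.
have kappaE c : kappa c = c *: kappa 1.
  by have := kappa_lin c 1 0; rewrite mulr1 addr0 kappa0 addr0.
rewrite !actk // dW sgn1 (kappaE u) (kappaE v).
apply: lm_eqP; rewrite /= ?scaleK ?mulr0 ?scaler0 ?addr0 //.
by module.
Qed.

Let lie_W A B D u v : hG A -> hG B -> hG D ->
  lie (- (- lie A B - u *: B + v *: A)) D
  = lie (lie A B) D + u *: lie B D - v *: lie A D.
Proof.
move=> hA hB hD; have hL := lie_closed hA hB.
have -> : - (- lie A B - u *: B + v *: A) = 1 *: lie A B + (u *: B + ((- v) *: A + 0)).
  by module.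
have h1 : hG ((- v) *: A + 0) by exact: hG_lin.
have h2 : hG (u *: B + ((- v) *: A + 0)) by exact: hG_lin.
by rewrite !lie_linl // lie0l //; module.
Qed.

Let act_W A B f u v : hG A -> hG B -> hO f ->
  act (- (- lie A B - u *: B + v *: A)) f
  = act A (act B f) - act B (act A f) + u *: act B f - v *: act A f.
Proof.
move=> hA hB hf.
have -> : - (- lie A B - u *: B + v *: A) = 1 *: lie A B + (u *: B + ((- v) *: A + 0)).
  by module.
by rewrite !act_linl act0l act_lie //; module.
Qed.

Let act_w A B f v : hG A -> hG B -> hO f ->
  act A (- (- act B f - v *: f)) = act A (act B f) + v *: act A f.
Proof.
move=> hA hB hf; have ha := act_closed hB hf.
have -> : - (- act B f - v *: f) = 1 *: act B f + (v *: f + 0) by module.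
have h1 : hO (v *: f + 0) by exact: hO_lin.
by rewrite !act_linr // act0r //; module.
Qed.

Let sgn3 : sgn 3 = -1. Proof. by rewrite -[3]/(2 + 1 : int) sgnD sgn2 sgn1 mul1r. Qed.

Let hG_W A B u v : hG A -> hG B -> hG (- lie A B - u *: B + v *: A).
Proof.
move=> hA hB; apply: hG_D; last exact: hG_Z.
by apply: hG_D; apply: hG_N; [exact: lie_closed|exact: hG_Z].
Qed.

Let hO_w A f u : hG A -> hO f -> hO (- act A f - u *: f).
Proof. by move=> hA hf; apply: hO_D; apply: hO_N; [exact: act_closed|exact: hO_Z]. Qed.

(** The component in G is the Jacobi identity; all terms with scalars cancel. *)
Let order2_111 A u B v D w : hG A -> hG B -> hG D ->
  lm_b (lm_mul (lm_mul (deg1 A u) (deg1 B v)) (deg1 D w)) =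
    lm_mul (lm_b (lm_mul (deg1 A u) (deg1 B v))) (deg1 D w)
    - lm_mul (deg1 A u) (lm_b (lm_mul (deg1 B v) (deg1 D w)))
    + lm_mul (deg1 B v) (lm_b (lm_mul (deg1 A u) (deg1 D w)))
    - lm_mul (lm_mul (lm_b (deg1 A u)) (deg1 B v)) (deg1 D w)
    + lm_mul (lm_mul (deg1 A u) (lm_b (deg1 B v))) (deg1 D w)
    - lm_mul (lm_mul (deg1 A u) (deg1 B v)) (lm_b (deg1 D w)).
Proof.
move=> hA hB hD.
have hAB := hG_W u v hA hB; have hBD := hG_W v w hB hD; have hAD := hG_W u w hA hD.
have FA := lm_deg1 u hA; have FB := lm_deg1 v hB; have FD := lm_deg1 w hD.
rewrite !lm_b_deg1 (mul_sl u FB) (mul_sr v FA) (mulZl u FB FD) (mulZl v FA FD).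
rewrite !lm_mul_deg11 // !lm_b_deg2 (mul_sr w (lm_deg2 hAB hO0)).
rewrite lm_mul_deg21 // lm_b_deg3 !lm_mul_deg11 ?hG_N //; try exact: hG_N.
rewrite act0r // !lm_scale_deg2.
have r A' B' D' v' w' : hG A' -> hG B' -> hG D' ->
    lie A' (- (- lie B' D' - v' *: D' + w' *: B'))
    = lie A' (lie B' D') + v' *: lie A' D' - w' *: lie A' B'.
  move=> hA' hB' hD'; rewrite lie_antisym lie_W // (lie_antisym A' (lie B' D')).
  by rewrite (lie_antisym A' D') (lie_antisym A' B'); module.
rewrite lie_W // !r // (lie_antisym B A) (lie_jacobi hA hB hD).
by apply: lm_eqP; rewrite /= ?scaleK ?oppr0 ?scaler0 ?addr0 ?subr0 //; module.
Qed.

(** The triple product vanishes for degree reasons, and the component in O is the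
    module law for the bracket of A and B.  The next two identities are the same
    with the factor of degree 2 in another place. *)
Let order2_112 A u B v D f : hG A -> hG B -> hG D -> hO f ->
  lm_b (lm_mul (lm_mul (deg1 A u) (deg1 B v)) (deg2 D f)) =
    lm_mul (lm_b (lm_mul (deg1 A u) (deg1 B v))) (deg2 D f)
    - lm_mul (deg1 A u) (lm_b (lm_mul (deg1 B v) (deg2 D f)))
    + lm_mul (deg1 B v) (lm_b (lm_mul (deg1 A u) (deg2 D f)))
    - lm_mul (lm_mul (lm_b (deg1 A u)) (deg1 B v)) (deg2 D f)
    + lm_mul (lm_mul (deg1 A u) (lm_b (deg1 B v))) (deg2 D f)
    - lm_mul (lm_mul (deg1 A u) (deg1 B v)) (lm_b (deg2 D f)).
Proof.
move=> hA hB hD hf.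
have hAB := hG_W u v hA hB; have hfA := hO_w u hA hf; have hfB := hO_w v hB hf.
have FA := lm_deg1 u hA; have FB := lm_deg1 v hB; have FD := lm_deg2 hD hf.
have nAB := hG_N hAB; have nD := hG_N hD; have nfA := hO_N hfA; have nfB := hO_N hfB.
rewrite !lm_b_deg1 (mul_sl u FB) (mul_sr v FA) (mulZl u FB FD) (mulZl v FA FD).
rewrite !lm_mul_deg11 // (lm_mul_high (lm_deg2 hAB hO0) FD) //.
rewrite -[X in lm_b X]/(deg0 0) lm_b_deg0 !lm_mul_deg12 // !lm_b_deg2 !lm_b_deg3.
rewrite !lm_mul_deg12 // lm_mul_deg21 // act_W // !act_w // act0r //.
by apply: lm_eqP; rewrite /= ?scaleK ?oppr0 ?scaler0 ?addr0 ?subr0 //; module.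
Qed.

Let order2_121 A u B v D f : hG A -> hG B -> hG D -> hO f ->
  lm_b (lm_mul (lm_mul (deg1 A u) (deg2 D f)) (deg1 B v)) =
    lm_mul (lm_b (lm_mul (deg1 A u) (deg2 D f))) (deg1 B v)
    - lm_mul (deg1 A u) (lm_b (lm_mul (deg2 D f) (deg1 B v)))
    + lm_mul (deg2 D f) (lm_b (lm_mul (deg1 A u) (deg1 B v)))
    - lm_mul (lm_mul (lm_b (deg1 A u)) (deg2 D f)) (deg1 B v)
    + lm_mul (lm_mul (deg1 A u) (lm_b (deg2 D f))) (deg1 B v)
    + lm_mul (lm_mul (deg1 A u) (deg2 D f)) (lm_b (deg1 B v)).
Proof.
move=> hA hB hD hf.
have hAB := hG_W u v hA hB; have hfA := hO_w u hA hf; have hfB := hO_w v hB hf.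
have FA := lm_deg1 u hA; have FB := lm_deg1 v hB; have FD := lm_deg2 hD hf.
have nAB := hG_N hAB; have nD := hG_N hD; have nfA := hO_N hfA; have nfB := hO_N hfB.
have hAD := hG_W u 0 hA nD.
rewrite !lm_b_deg1 (mul_sl u FD) (mulZl u FD FB) (mul_sr v (lm_mul_degree FA FD)).
rewrite !lm_mul_deg12 // !lm_mul_deg21 // (lm_mul_high (lm_deg3 hfA) FB) //.
rewrite -[X in lm_b X]/(deg0 0) lm_b_deg0 !lm_mul_deg11 // !lm_b_deg2 !lm_b_deg3 !lm_mul_deg11 //.
rewrite !lm_mul_deg12 // !lm_mul_deg21 // act_W // !act_w // act0r //.
by apply: lm_eqP; rewrite /= ?scaleK ?oppr0 ?scaler0 ?addr0 ?subr0 //; module.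
Qed.

Let order2_211 A u B v D f : hG A -> hG B -> hG D -> hO f ->
  lm_b (lm_mul (lm_mul (deg2 D f) (deg1 A u)) (deg1 B v)) =
    lm_mul (lm_b (lm_mul (deg2 D f) (deg1 A u))) (deg1 B v)
    + lm_mul (deg2 D f) (lm_b (lm_mul (deg1 A u) (deg1 B v)))
    - lm_mul (deg1 A u) (lm_b (lm_mul (deg2 D f) (deg1 B v)))
    - lm_mul (lm_mul (lm_b (deg2 D f)) (deg1 A u)) (deg1 B v)
    - lm_mul (lm_mul (deg2 D f) (lm_b (deg1 A u))) (deg1 B v)
    + lm_mul (lm_mul (deg2 D f) (deg1 A u)) (lm_b (deg1 B v)).
Proof.
move=> hA hB hD hf.
have hAB := hG_W u v hA hB; have hfA := hO_w u hA hf; have hfB := hO_w v hB hf.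
have FA := lm_deg1 u hA; have FB := lm_deg1 v hB; have FD := lm_deg2 hD hf.
have nAB := hG_N hAB; have nD := hG_N hD; have nfA := hO_N hfA; have nfB := hO_N hfB.
have hAD := hG_W 0 u nD hA.
rewrite !lm_b_deg1 (mul_sr u FD) (mulZl u FD FB) (mul_sr v (lm_mul_degree FD FA)).
rewrite !lm_mul_deg21 // (lm_mul_high (lm_deg3 hfA) FB) //.
rewrite -[X in lm_b X]/(deg0 0) lm_b_deg0 !lm_mul_deg11 // !lm_b_deg2 !lm_b_deg3 !lm_mul_deg11 //.
rewrite !lm_mul_deg12 // !lm_mul_deg21 // act_W // !act_w // act0r //.
by apply: lm_eqP; rewrite /= ?scaleK ?oppr0 ?scaler0 ?addr0 ?subr0 //; module.
Qed.

(** If one factor is a scalar, the identity reduces to the linearity of the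
    operations.  Otherwise the total degree is at least 3, and all terms vanish as
    soon as it is 5 or more. *)
Lemma lm_second_order : second_order lm_space lm_b lm_mul.
Proof.
move=> k l m x y z Fx Fy Fz; have [bF _] := lm_b_graded.
have Fxy := lm_mul_degree Fx Fy; have Fyz := lm_mul_degree Fy Fz.
have Fxz := lm_mul_degree Fx Fz.
have Fbx := bF _ _ Fx; have Fby := bF _ _ Fy; have Fbz := bF _ _ Fz.
have Fbxy := bF _ _ Fxy; have Fbyz := bF _ _ Fyz; have Fbxz := bF _ _ Fxz.
have [[u [xE ku]]|k0] := lm_scalar_or_positive Fx.
  subst; rewrite lm_b_deg0 (mul0 Fy) (mul0 Fz).
  rewrite (mul_sl u Fy) (mul_sl u Fz) (mul_sl u Fbyz) (mul_sl u Fby).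
  rewrite (mulZl u Fy Fz) !bZ (mulZl u Fby Fz) (mulZr u Fy Fbz) (mulZl u Fy Fbz).
  case: ku => ->; last by rewrite !scale0r !scaler0 !subr0 !addr0.
  by rewrite !(sgnE, sgn0, mul1r, mulN1r, opprK, sgn_exp); module.
have [[u [yE lu]]|l0] := lm_scalar_or_positive Fy.
  subst; rewrite lm_b_deg0 (mulr0' Fx) (mul0 Fz).
  rewrite (mul_sr u Fx) (mul_sl u Fz) (mul_sl u Fbxz) (mul_sr u Fbx).
  rewrite (mulZl u Fx Fz) !bZ (mulZl u Fbx Fz) (mulZr u Fx Fbz) (mulZl u Fx Fbz).
  case: lu => ->; last by rewrite !scale0r !scaler0 !subr0 !addr0.
  by rewrite mulr0 addr0 sgn0; module.
have [[u [zE _]]|m0] := lm_scalar_or_positive Fz.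
  subst; rewrite lm_b_deg0 (mulr0' Fxy).
  rewrite (mul_sr u Fx) (mul_sr u Fy) (mul_sr u Fxy) (mul_sr u Fbxy).
  rewrite !bZ (mulZr u Fx Fby) (mulZr u Fy Fbx) (mul_sr u (lm_mul_degree Fbx Fy)).
  by rewrite (mul_sr u (lm_mul_degree Fx Fby)) (lm_mulC Fbx Fy); module.
have [h|h] := lerP 5 (k + l + m).
  rewrite (lm_space_high (bF _ _ (lm_mul_degree Fxy Fz))); last lia.
  rewrite (lm_space_high (lm_mul_degree Fbxy Fz)); last lia.
  rewrite (lm_space_high (lm_mul_degree Fx Fbyz)); last lia.
  rewrite (lm_space_high (lm_mul_degree Fy Fbxz)); last lia.
  rewrite (lm_space_high (lm_mul_degree (lm_mul_degree Fbx Fy) Fz)); last lia.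
  rewrite (lm_space_high (lm_mul_degree (lm_mul_degree Fx Fby) Fz)); last lia.
  rewrite (lm_space_high (lm_mul_degree Fxy Fbz)); last lia.
  by rewrite !scaler0 !subr0 !addr0.
have kl : k + l < 4 by lia.
have lm : l + m < 4 by lia.
case: (lm_positiveP Fx Fy k0 l0 kl) => [A u B v xE yE kE lE hA hB
  |A u D f xE yE kE lE hA hD hf|A u D f xE yE kE lE hA hD hf];
case: (lm_positiveP Fy Fz l0 m0 lm) => [B' v' E w yE' zE lE' mE hB' hE
  |B' v' E g yE' zE lE' mE hB' hE hg|B' v' E g yE' zE lE' mE hB' hE hg];
  try (by exfalso; lia).
- rewrite xE yE' zE kE lE' (order2_111 u v' w hA hB' hE).
  by rewrite subrr !(sgnM, sgnD, sgn1, expr0z, mulN1r, opprK, exp1rz); module.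
- rewrite xE yE' zE kE lE' (order2_112 u v' hA hB' hE hg).
  by rewrite subrr !(sgnM, sgnD, sgn1, expr0z, mulN1r, opprK, exp1rz); module.
- rewrite xE yE' zE kE lE' (order2_121 u v' hA hB' hE hg).
  by rewrite subrr !(sgnM, sgnD, sgn0, sgn1, sgn2, exp1rz, mulr1); module.
- rewrite xE yE' zE kE lE' (order2_211 v' w hB' hE hD hf).
  by rewrite !(sgnM, sgnD, sgnN1, sgn1, sgn2, mulrN1, mulr1, expr1z); module.
Qed.

Lemma lm_parityE k x : lm_space k x -> lm_parity x = sgn k *: x.
Proof.
move=> Fx; have P0 : lm_parity 0 = 0 by apply: lm_eqP; rewrite /= ?oppr0.
case: (lm_homogeneousP Fx) => [u -> ->|A v -> -> _|A f -> -> _ _|f -> -> _|-> _].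
- by rewrite sgn0 scale1r; apply: lm_eqP; rewrite /= ?oppr0.
- by rewrite sgn1 scaleN1r; apply: lm_eqP; rewrite /= ?oppr0.
- by rewrite sgn2 scale1r; apply: lm_eqP; rewrite /= ?oppr0.
- by rewrite sgn3 scaleN1r; apply: lm_eqP; rewrite /= ?oppr0.
- by rewrite P0 scaler0.
Qed.

Lemma lm_bracketE k l x y : lm_space k x -> lm_space l y ->
  sgn k *: lm_bracket x y
  = lm_b (lm_mul x y) - lm_mul (lm_b x) y - sgn k *: lm_mul x (lm_b y).
Proof.
move=> Fx Fy; have [bF _] := lm_b_graded; have Fbx := bF _ _ Fx.
rewrite /lm_bracket /generated_bracket (lm_parityE Fx) (mulZl _ Fx Fy) !bZ (mulZl _ Fbx Fy).
by case: (sgnP K k) => ->; module.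
Qed.

Lemma lm_dga : dg_commutative_algebra lm_space lm_Q lm_mul.
Proof.
have Q0 : lm_Q 0 = 0 by exact: (lm_Q_deg0 0).
split.
- exact: lm_space_graded.
- exact: lm_Q_graded.
- move=> k x /lm_homogeneousP[u -> _|A v -> _ hA|A f -> _ hA hf|f -> _ hf|-> _].
  + by rewrite lm_Q_deg0 Q0.
  + by rewrite lm_Q_deg1 lm_Q_deg2 delta0.
  + by rewrite lm_Q_deg2 lm_Q_deg3.
  + by rewrite lm_Q_deg3 Q0.
  + by rewrite !Q0.
- exact: lm_mul_graded.
- exact: lm_mulC.
- exact: lm_mulA.
- exact: lm_derivation.
Qed.

Lemma lm_bQ k x : lm_space k x -> lm_b (lm_Q x) + lm_Q (lm_b x) = 0.
Proof.
have Q0 : lm_Q 0 = 0 by exact: (lm_Q_deg0 0).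
have b0 : lm_b 0 = 0 by exact: (lm_b_deg0 0).
case/lm_homogeneousP => [u -> _|A v -> _ hA|A f -> _ hA hf|f -> _ hf|-> _].
- by rewrite lm_Q_deg0 lm_b_deg0 Q0 b0 addr0.
- by rewrite lm_Q_deg1 lm_b_deg1 lm_b_deg2 lm_Q_deg0; apply: lm_eqP; rewrite /= ?oppr0 ?addr0.
- have dN : delta (- A) = - delta A.
    by have := delta_lin (-1) hA hG0; rewrite addr0 !scaleN1r delta0 addr0.
  rewrite lm_Q_deg2 lm_b_deg3 lm_b_deg2 lm_Q_deg1 kappa0 dN.
  by apply: lm_eqP; rewrite /= ?addr0 //; module.
- by rewrite lm_Q_deg3 b0 lm_b_deg3 lm_Q_deg2 delta0; apply: lm_eqP; rewrite /= ?addr0.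
- by rewrite Q0 b0 Q0 addr0.
Qed.

Theorem lie_module_BV : BV_algebra lm_space lm_Q lm_b lm_mul lm_bracket.
Proof.
split.
- exact: lm_dga.
- exact: lm_b_graded.
- by move=> k x _; exact: lm_b2.
- exact: lm_bQ.
- exact: lm_second_order.
- exact: lm_bracketE.
- apply: (bracket_gerstenhaber lm_dga lm_b_graded _ lm_bQ lm_second_order lm_bracketE).
  by move=> k x _; exact: lm_b2.
Qed.

End LieModuleBV.

(** * The BV algebra of holomorphic vector fields *)

(** The Lie module of holomorphic functions, with half the divergence as cocycle
    and the constant functions as invariants. *)
Theorem proposition4p1 (R : realType) (n : nat) (M : complexManifold R n)
    (Omega : volumeForm M) (U : set M) (hU : open U) :
  BV_algebra (sm_space U)
    (sm_Q Omega U) (@sm_b R n M) (@sm_mul R n M) (@sm_bracket R n M).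
Proof.
pose delta (A : fields M) : M -> R[i] := 2^-1 *: divergence Omega U A.
have delta_closed A : holomorphic_field U A -> holomorphic_function U (delta A).
  move=> hA; have hd := holomorphic_divergence Omega hU hA.
  have := holomorphic_function_lin 2^-1 hd (holomorphic_function0 U); rewrite addr0; exact.
have delta_lin c A B : holomorphic_field U A -> holomorphic_field U B ->
    delta (c *: A + B) = c *: delta A + delta B.
  move=> hA hB; rewrite /delta (divergence_lin Omega hU c hA hB).
  by rewrite scalerDr !scalerA (mulrC c).
have delta_lie A B : holomorphic_field U A -> holomorphic_field U B ->
    delta (lie_bracket A B) = field_act A (delta B) - field_act B (delta A).
  move=> hA hB; have hdA := holomorphic_divergence Omega hU hA.
  have hdB := holomorphic_divergence Omega hU hB.
  have half D E : holomorphic_field U D -> holomorphic_field U E ->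
      field_act D (delta E) = 2^-1 *: field_act D (divergence Omega U E).
    move=> hD hE; have hdE := holomorphic_divergence Omega hU hE.
    have h0 := holomorphic_function0 U.
    have act0 : field_act D 0 = 0.
      have e := field_act_linr (-1) hD h0 h0; rewrite scaler0 addr0 in e.
      by rewrite e scaleN1r addNr.
    by have := field_act_linr 2^-1 hD hdE h0; rewrite act0 !addr0.
  by rewrite /delta (divergence_lie Omega hU hA hB) scalerBr !half.
have bv := @lie_module_BV R[i] (fields M) (M -> R[i]) (holomorphic_field U)
  (holomorphic_function U) (@lie_bracket R n M) (@field_act R n M) delta
  (constant_function U) (holomorphic_field0 U)
  (@holomorphic_field_lin R n M U) (holomorphic_function0 U)
  (@holomorphic_function_lin R n M U)
  (holomorphic_lie_bracket hU) (holomorphic_field_act hU) delta_closed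
  (holomorphic_constant hU)
  (@lie_bracket_antisym R n M) (@lie_bracket_linr R n M U)
  (lie_bracket_jacobi hU) (@field_act_linl R n M) (@field_act_linr R n M U)
  (field_act_lie hU) (field_act_constant hU) (constant_function_lin U)
  delta_lin delta_lie.
have spaceE : lm_space (holomorphic_field U) (holomorphic_function U)
    = sm_space U :> (int -> set (sm_total M)) by reflexivity.
have QE : lm_Q delta (constant_function U) = sm_Q Omega U by reflexivity.
have bE : @lm_b R[i] (fields M) (M -> R[i]) = @sm_b R n M by reflexivity.
have mulE : lm_mul (@lie_bracket R n M) (@field_act R n M) = @sm_mul R n M by reflexivity.
have parityE : @lm_parity R[i] (fields M) (M -> R[i]) = @sm_parity R n M by reflexivity.
have bracketE : lm_bracket (@lie_bracket R n M) (@field_act R n M) = @sm_bracket R n M.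
  transitivity (generated_bracket (@sm_b R n M) (@sm_mul R n M) (@sm_parity R n M));
    last reflexivity.
  exact: (f_equal3 (@generated_bracket (sm_total M)) bE mulE parityE).
have transport F F' Q Q' b b' mul mul' br br' : F = F' -> Q = Q' -> b = b' -> mul = mul' ->
    br = br' -> @BV_algebra R[i] (sm_total M) F Q b mul br -> BV_algebra F' Q' b' mul' br'.
  by move=> -> -> -> -> ->.
exact: transport spaceE QE bE mulE bracketE bv.
Qed.
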